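(* Let $k\ge1$. The critical points of $\mathcal W_{k,\phi}$ in $\mathcal C_1$ are those for which $$v_{k,\phi}-\lambda v_{k-1,\phi}=a$$ for some constant $a\in\mathbb R$, where $v_{0,\phi}:=1$.
   Context: $(M^n,g,\phi,\lambda)$ is a manifold with density (Riemannian manifold $(M,g)$, $\phi\in C^\infty(M)$, $\lambda\in\mathbb R$), with $\lambda\ne0$, $\tau=\frac1{2\lambda}$; $g$ and $\tau$ are held fixed. $\mathcal C=\{\phi+\omega:\omega\in C^\infty(M)\}$ is the weighted conformal class, and $\mathcal C_1$ is the subset of those members for which $\int_M(4\pi\tau)^{-n/2}e^{-\phi}\mathrm{dvol}_g=1$. For a (pseudo-)Riemannian manifold of dimension $m$ with function $\phi$ and $\lambda\in\mathbb R$: $P_\phi=\mathrm{Ric}+\nabla^2\phi-\lambda g$, $F_\phi=\Delta\phi-|\nabla\phi|^2+2\lambda\phi-m\lambda$. The normal weighted ambient metric of $(M^n,g,\phi,\lambda)$ is the structure $\widetilde g=2\,du\,dv+g_u$, $\widetilde\phi=\phi_u-v+\lambda uv$ near $u=0$ in $\mathbb R_v\times M\times\mathbb R_u$, with $(g_u,\phi_u)$ a smooth family with $(g_0,\phi_0)=(g,\phi)$, such that $\widetilde P_\phi=O(u^\infty)$, $\widetilde F_\phi=O(u^\infty)$ at $u=0$ (tildes: quantities of $(\widetilde g,\widetilde\phi,\lambda)$, $m=n+2$); it is determined modulo $O(u^\infty)$. $v_\phi=\frac{e^{-\widetilde\phi}}{e^{-\phi}}\left(\frac{\det g_u}{\det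 g}\right)^{1/2}$, $v_{k,\phi}=\frac1{k!}\partial_u^kv_\phi|_{u,v=0}$, and $\mathcal W_{k,\phi}=\int_M\tau^kv_{k,\phi}(4\pi\tau)^{-n/2}e^{-\phi}\mathrm{dvol}_g$. *)

(* Defs.v *)
From HB Require Import structures.
From mathcomp Require Import all_boot all_order all_algebra.
From mathcomp Require Import all_classical all_reals all_analysis.

Set Implicit Arguments.
Unset Strict Implicit.
Unset Printing Implicit Defensive.

Import Order.TTheory GRing.Theory Num.Theory.
Import numFieldNormedType.Exports.

Local Open Scope classical_set_scope.
Local Open Scope ring_scope.

(* C^k regularity on an open set U, through iterated directional derivatives;
   in finite dimension this is the usual notion. *)
Fixpoint Ck_on (R : realType) (V W : normedModType R) (k : nat) (U : set V)
    (f : V -> W) : Prop :=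
  (forall x, U x -> {for x, continuous f}) /\
  match k with
  | 0 => True
  | k'.+1 => forall w : V, (forall x, U x -> derivable f x w) /\
                           Ck_on k' U (fun x => 'D_w f x)
  end.

Definition smooth_on (R : realType) (V W : normedModType R) (U : set V)
  (f : V -> W) : Prop := forall k, Ck_on k U f.

Section local_geometry.
Context (R : realType) (m : nat).
Implicit Types (G : 'rV[R]_m -> 'M[R]_m) (f : 'rV[R]_m -> R) (x : 'rV[R]_m).

Definition partial (a : 'I_m) f x : R := 'D_('e_a) f x.

Definition christoffel G (c a b : 'I_m) x : R :=
  2^-1 * \sum_d (invmx (G x)) c d *
    (partial a (fun y => G y b d) x + partial b (fun y => G y a d) x
     - partial d (fun y => G y a b) x).

Definition ricci G x : 'M[R]_m := \matrix_(a, b)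
  (\sum_c (partial c (christoffel G c a b) x
           - partial b (christoffel G c a c) x)
   + \sum_c \sum_d (christoffel G c c d x * christoffel G d a b x
                    - christoffel G c b d x * christoffel G d a c x)).

Definition hessian G f x : 'M[R]_m := \matrix_(a, b)
  (partial a (partial b f) x - \sum_c christoffel G c a b x * partial c f x).

Definition laplacian G f x : R :=
  \sum_a \sum_b (invmx (G x)) a b * hessian G f x a b.

Definition grad_sqnorm G f x : R :=
  \sum_a \sum_b (invmx (G x)) a b * partial a f x * partial b f x.

Definition Ptensor (lambda : R) G f x : 'M[R]_m :=
  ricci G x + hessian G f x - lambda *: G x.

Definition Fscalar (lambda : R) G f x : R :=
  laplacian G f x - grad_sqnorm G f x + 2 * lambda * f x - m%:R * lambda.

End local_geometry.

(* A smooth atlas on M, modelled on R^n.  [chart_coord i] and [chart_param i]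
   are mutually inverse homeomorphisms between the open sets [chart_dom i] and
   [chart_coord i @` chart_dom i]; their values elsewhere are irrelevant. *)
Record atlas (R : realType) (n : nat) (M : ptopologicalType) := Atlas {
  chart_index : Type;
  chart_dom : chart_index -> set M;
  chart_coord : chart_index -> M -> 'rV[R]_n;
  chart_param : chart_index -> 'rV[R]_n -> M;
  chart_at : M -> chart_index;
  chart_atP : forall p, chart_dom (chart_at p) p;
  dom_open : forall i, open (chart_dom i);
  img_open : forall i, open (chart_coord i @` chart_dom i);
  coordK : forall i p, chart_dom i p -> chart_param i (chart_coord i p) = p;
  coord_continuous : forall i p, chart_dom i p ->
    {for p, continuous (chart_coord i)};
  param_continuous : forall i x, (chart_coord i @` chart_dom i) x ->
    {for x, continuous (chart_param i)};
  transition_smooth : forall i j,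
    smooth_on [set x | (chart_coord i @` chart_dom i) x /\
                       chart_dom j (chart_param i x)]
              (chart_coord j \o chart_param i)
}.

Section manifold.
Context (R : realType) (n : nat) (M : ptopologicalType) (A : atlas R n M).

Definition chart_img (i : chart_index A) : set 'rV[R]_n :=
  chart_coord i @` chart_dom i.

Definition smooth_fun (f : M -> R) : Prop :=
  forall i : chart_index A, smooth_on (chart_img i) (f \o chart_param i).

(* A covariant 2-tensor is given by its component matrices, as functions of
   the coordinates of each chart. *)
Definition components := chart_index A -> 'rV[R]_n -> 'M[R]_n.

Definition tensor_on (U : set M) (h : components) : Prop :=
  forall i j x, chart_img i x -> U (chart_param i x) ->
    chart_dom j (chart_param i x) ->
    let J := 'J (chart_coord j \o chart_param i) x in
    h i x = J *m h j (chart_coord j (chart_param i x)) *m J^T.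

Definition posdef_on (U : set M) (h : components) : Prop :=
  forall i x, chart_img i x -> U (chart_param i x) ->
    (h i x)^T = h i x /\
    forall w : 'rV[R]_n, w != 0 -> 0 < (w *m h i x *m w^T) 0 0.

Definition riemannian (g : components) : Prop :=
  [/\ forall i, smooth_on (chart_img i) (g i),
      tensor_on setT g & posdef_on setT g].

End manifold.

(* Lebesgue integral over R^n of a nonnegative Borel function, as an iterated
   integral (Tonelli). *)
Fixpoint lebesgue_int (R : realType) (n : nat) :
    ('rV[R]_n -> \bar R) -> \bar R :=
  match n with
  | 0 => fun f => f 0
  | n'.+1 => fun f : 'rV[R]_(1 + n') -> \bar R =>
      (\int[@lebesgue_measure R]_t
         lebesgue_int (fun x : 'rV[R]_n' => f (row_mx t%:M x)))%E
  end.

Notation borel M := (g_sigma_algebraType (@open M)).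

(* On a second countable manifold this determines dvol_g uniquely. *)
Definition riemannian_volume (R : realType) (n : nat) (M : ptopologicalType)
    (A : atlas R n M) (g : components A)
    (vol : {measure set (borel M) -> \bar R}) : Prop :=
  forall (i : chart_index A) (B : set (borel M)),
    measurable B -> B `<=` chart_dom i ->
    vol B = lebesgue_int (fun x =>
      (Num.sqrt (\det (g i x)) * \1_(chart_coord i @` B) x)%:E).

Section density.
Context (R : realType) (n : nat) (M : ptopologicalType) (A : atlas R n M).

Record wfamily := WFamily {
  metric_at : R -> components A;
  fun_at : R -> M -> R
}.

(* [U] is the neighbourhood of u = 0 on which the family is defined. *)
Definition smooth_family (F : wfamily) (g : components A) (phi : M -> R) :=
  exists U : set (R * M),
  [/\ open U /\ (forall p, U (0, p)),
      forall i, smooth_on [set q : R * 'rV[R]_n |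
          chart_img i q.2 /\ U (q.1, chart_param i q.2)]
        (fun q => metric_at F q.1 i q.2),
      forall i : chart_index A, smooth_on [set q : R * 'rV[R]_n |
          chart_img i q.2 /\ U (q.1, chart_param i q.2)]
        (fun q => fun_at F q.1 (chart_param i q.2)),
      forall u, tensor_on [set p | U (u, p)] (metric_at F u) /\
                posdef_on [set p | U (u, p)] (metric_at F u) &
      (forall i x, chart_img i x -> metric_at F 0 i x = g i x) /\
      (forall p, fun_at F 0 p = phi p)].

(* Coordinates on the ambient space are ordered (v, x, u), and the entries
   (v, u) and (u, v) of the ambient metric are 1, for 2 du dv. *)
Definition v_of (q : 'rV[R]_(1 + n + 1)) : R := lsubmx (lsubmx q) 0 0.
Definition x_of (q : 'rV[R]_(1 + n + 1)) : 'rV[R]_n := rsubmx (lsubmx q).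
Definition u_of (q : 'rV[R]_(1 + n + 1)) : R := rsubmx q 0 0.

Definition ambient_point (v : R) (x : 'rV[R]_n) (u : R) :
  'rV[R]_(1 + n + 1) := row_mx (row_mx v%:M x) u%:M.

Definition ambient_metric (F : wfamily) (i : chart_index A)
    (q : 'rV[R]_(1 + n + 1)) : 'M[R]_(1 + n + 1) :=
  block_mx (block_mx 0 0 0 (metric_at F (u_of q) i (x_of q)))
           (col_mx 1%:M 0)
           (row_mx 1%:M 0) 0.

Definition ambient_fun (lambda : R) (F : wfamily) (v : R) (p : M) (u : R) : R :=
  fun_at F u p - v + lambda * u * v.

Definition ambient_fun_chart (lambda : R) (F : wfamily) (i : chart_index A)
    (q : 'rV[R]_(1 + n + 1)) : R :=
  ambient_fun lambda F (v_of q) (chart_param i (x_of q)) (u_of q).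

(* T = O(u^oo) at u = 0, over the chart i: for every N, T = O(u^N) locally
   uniformly near each point of {u = 0}. *)
Definition O_u_infty (i : chart_index A) (T : 'rV[R]_(1 + n + 1) -> R) : Prop :=
  forall (v : R) (x : 'rV[R]_n) (N : nat), chart_img i x ->
    exists C : R, \forall q \near ambient_point v x 0,
      `|T q| <= C * `|u_of q| ^+ N.

Definition normal_ambient (g : components A) (lambda : R) (phi : M -> R)
    (F : wfamily) : Prop :=
  [/\ smooth_family F g phi,
      forall i a b, O_u_infty i (fun q =>
        Ptensor lambda (ambient_metric F i) (ambient_fun_chart lambda F i)
          q a b) &
      forall i : chart_index A, O_u_infty i
        (Fscalar lambda (ambient_metric F i) (ambient_fun_chart lambda F i))].

(* The ratio of determinants does not depend on the chart. *)
Definition v_phi (g : components A) (lambda : R) (phi : M -> R) (F : wfamily)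
    (v : R) (p : M) (u : R) : R :=
  let i := chart_at A p in
  expR (- ambient_fun lambda F v p u) / expR (- phi p) *
  Num.sqrt (\det (metric_at F u i (chart_coord i p)) /
            \det (g i (chart_coord i p))).

Definition v_coef (g : components A) (lambda : R) (phi : M -> R) (F : wfamily)
    (k : nat) (p : M) : R :=
  if k is 0 then 1
  else (k`!%:R)^-1 * derive1n k (v_phi g lambda phi F 0 p) 0.

(* (4 pi tau)^(-n/2).  For n odd and tau < 0 there is no real value; the
   formula then gives 0, so that the normalised class C_1 is empty, as it is
   for the complex values of the power. *)
Definition gauss_factor (tau : R) : R :=
  if odd n then (Num.sqrt (4 * pi * tau)) ^- n else (4 * pi * tau) ^- n./2.

Definition conformal_class (phi0 : M -> R) : set (M -> R) :=
  [set phi | exists2 w, smooth_fun A w & phi = phi0 \+ w].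

Definition conformal_class1 (vol : {measure set (borel M) -> \bar R})
    (phi0 : M -> R) (lambda : R) : set (M -> R) :=
  [set phi | conformal_class phi0 phi /\
     \int[vol]_p (gauss_factor (1 / (2 * lambda)) * expR (- phi p)) = 1].

Definition W_integrand (g : components A) (lambda : R)
    (amb : (M -> R) -> wfamily) (k : nat) (phi : M -> R) (p : M) : R :=
  let tau := 1 / (2 * lambda) in
  tau ^+ k * v_coef g lambda phi (amb phi) k p * gauss_factor tau
  * expR (- phi p).

Definition W_functional (vol : {measure set (borel M) -> \bar R})
    (g : components A) (lambda : R) (amb : (M -> R) -> wfamily)
    (k : nat) (phi : M -> R) : R :=
  \int[vol]_p W_integrand g lambda amb k phi p.

(* A smooth curve in C_1 through phi, equal to phi outside a compact
   set (no restriction if M is compact). *)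
Definition C1_curve (vol : {measure set (borel M) -> \bar R})
    (phi0 : M -> R) (lambda : R) (phi : M -> R) (Phi : R -> M -> R) : Prop :=
  [/\ forall i : chart_index A,
        smooth_on [set q : R * 'rV[R]_n | chart_img i q.2]
          (fun q => Phi q.1 (chart_param i q.2)),
      Phi 0 = phi,
      (exists2 K : set M, compact K &
        forall t p, ~ K p -> Phi t p = phi p) &
      forall t, conformal_class1 vol phi0 lambda (Phi t)].

Definition critical_point (vol : {measure set (borel M) -> \bar R})
    (phi0 : M -> R) (g : components A) (lambda : R)
    (amb : (M -> R) -> wfamily) (k : nat) (phi : M -> R) : Prop :=
  conformal_class1 vol phi0 lambda phi /\
  forall Phi, C1_curve vol phi0 lambda phi Phi ->
    is_derive (0 : R) 1 (fun t => W_functional vol g lambda amb k (Phi t)) 0.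

End density.

(* Main.v *)
(** Put s = 1 - lambda u. For a metric of the form 2 du dv + g_u and a potential
phi_u - v + lambda u v, the components P_ab of the first ambient equation and the
second ambient equation reduce to the flow s g_u' = 2 P_{phi_u}(g_u),
2 s phi_u' = tr P - F, modulo O(u^oo). Let (g_u, phi_u) depend on a parameter t, with
g_0 fixed and omega = d/dt phi_0, and let X be the vector field with
X' = grad_{g_u} omega and X = 0 at u = 0. Since Ricci and Hessian are natural,
d/dt g_u - L_X g_u and d/dt phi_u - X phi_u - s omega solve a linear homogeneous flow
with zero initial value, so their jets in u vanish. Hence V = e^{-phi_u} sqrt(det g_u)
satisfies d/dt V = div(V X) - s omega V, and comparing the coefficients of u^k,
d/dt (v_k e^{-phi}) is a divergence minus omega (v_k - lambda v_{k-1}) e^{-phi}.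
The divergence is linear in omega and integrates to zero: by a partition of omega one
may assume it supported in a chart, where translation invariance of Lebesgue measure
applies. So the derivative of W_k along a curve in C_1 is a nonzero multiple of the
integral of omega (v_k - lambda v_{k-1}) e^{-phi}, subject to the constraint that the
integral of omega e^{-phi} vanishes, and the multiplier rule follows by testing with
differences of two bumps. *)

Require Import Defs.
From HB Require Import structures.
From mathcomp Require Import all_boot all_order all_algebra.
From mathcomp Require Import all_classical all_reals all_analysis.
From mathcomp Require Import ring lra measurable_realfun.
Import Order.TTheory GRing.Theory Num.Theory.
Import numFieldNormedType.Exports.

Set Implicit Arguments.
Unset Strict Implicit.
Unset Printing Implicit Defensive.

Local Open Scope classical_set_scope.
Local Open Scope ring_scope.

(** * Functions of class C^k *)

(** The hypotheses supply one ambient metric for each potential separately, determined only modulo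
    O(u^oo) and with no regularity in the parameter t of a curve. So the family is never
    differentiated in t directly. The flow, whose factor s equals 1 at u = 0, expresses each u-jet
    of (g_u, phi_u) through lower ones; hence the jets are smooth in t by induction on their order,
    and Taylor polynomials built from them replace the family. These satisfy the flow only to a
    finite order, which is why the tensor calculus takes place in a ring with commuting derivations
    modulo an ideal: that of the functions whose u-jet of a given order vanishes. The field X, too,
    is needed only as a jet, and its primitive in u becomes a polynomial. The flux obtained in this
    way depends on the potential and, linearly, on omega, but not on the curve, so one operator
    serves all curves through phi. M is not assumed compact: a curve moves phi only inside a compact
    set, and integrability at phi is carried along the curve by a dominating function supported
    there. *)

Section CkTheory.
Context {R : realType}.
Implicit Types (V W : normedModType R).

Lemma Ck_on_cont {V W} k (U : set V) (f : V -> W) :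
  Ck_on k U f -> forall x, U x -> {for x, continuous f}.
Proof. by case: k => [|k] []. Qed.

Lemma Ck_onS {V W} k (U : set V) (f : V -> W) : Ck_on k.+1 U f -> Ck_on k U f.
Proof.
elim: k f => [|k IH] f [cf df]; split => // w.
by have [d dC] := df w; split=> //; apply: IH.
Qed.

Lemma near_eq_continuous {V W : topologicalType} (f g : V -> W) x :
  {near x, f =1 g} -> {for x, continuous f} -> {for x, continuous g}.
Proof.
move=> fg cf; have fgx : f x = g x := nbhs_singleton fg.
by move: cf; rewrite /prop_for /continuous_at fgx; apply: cvg_trans; exact: near_eq_cvg.
Qed.

(** Mostly applied with [g] equal to [f]: regularity is then checked on an open cover, possibly for
    a different reason on each piece. *)
Lemma Ck_on_local {V W} k (U : set V) (f g : V -> W) : open U ->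
  (forall x, U x -> exists U', [/\ open U', U' x, {in U', f =1 g} & Ck_on k U' f]) ->
  Ck_on k U g.
Proof.
move=> oU; elim: k f g => [|k IH] f g h; split=> //.
- move=> x Ux; have [U' [oU' U'x fg [cf _]]] := h x Ux.
  apply: near_eq_continuous (cf x U'x).
  by move/open_nbhs_nbhs: (conj oU' U'x); apply: filterS => z /mem_set/fg.
- move=> x Ux; have [U' [oU' U'x fg /Ck_on_cont cf]] := h x Ux.
  apply: near_eq_continuous (cf x U'x).
  by move/open_nbhs_nbhs: (conj oU' U'x); apply: filterS => z /mem_set/fg.
- move=> w; split=> [x Ux|].
  + have [U' [oU' U'x fg [_ /(_ w) [df _]]]] := h x Ux.
    apply: near_eq_derivable (df x U'x).
    by move/open_nbhs_nbhs: (conj oU' U'x); apply: filterS => z /mem_set/fg.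
  + apply: (IH ('D_w f)) => x Ux.
    have [U' [oU' U'x fg [_ /(_ w) [_ df]]]] := h x Ux.
    exists U'; split=> // z /set_mem U'z; apply: near_eq_derive.
    by move/open_nbhs_nbhs: (conj oU' U'z); apply: filterS => y /mem_set/fg.
Qed.

Lemma eq_Ck_on {V W} k (U : set V) (f g : V -> W) : open U ->
  {in U, f =1 g} -> Ck_on k U f -> Ck_on k U g.
Proof. by move=> oU fg Cf; apply: (Ck_on_local (f := f) oU) => x Ux; exists U. Qed.

Lemma Ck_on_cst {V W} k (U : set V) (c : W) : Ck_on k U (fun=> c).
Proof.
elim: k c => [|k IH] c; split=> //; try by move=> x _; exact: cvg_cst.
move=> w; split=> [x _|]; first exact: derivable_cst.
have -> : 'D_w (fun=> c) = (fun _ : V => 0) by apply/funext => x; rewrite derive_cst.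
exact: IH.
Qed.

Lemma Ck_onD {V W} k (U : set V) (f g : V -> W) : open U ->
  Ck_on k U f -> Ck_on k U g -> Ck_on k U (f \+ g).
Proof.
move=> oU; elim: k f g => [|k IH] f g [cf df] [cg dg]; split=> //;
  try by move=> x Ux; apply: cvgD; [exact: cf | exact: cg].
move=> w; have [d dC] := df w; have [e eC] := dg w; split=> [x Ux|].
  by apply: derivableD; [exact: d|exact: e].
apply: (eq_Ck_on oU) (IH _ _ dC eC) => x /set_mem Ux /=.
by rewrite deriveD //; [exact: d|exact: e].
Qed.

Lemma Ck_onM {V} k (U : set V) (f g : V -> R) : open U ->
  Ck_on k U f -> Ck_on k U g -> Ck_on k U (f \* g).
Proof.
move=> oU; elim: k f g => [|k IH] f g Cf Cg.
  by case: Cf Cg => cf _ [cg _]; split=> // x Ux; apply: cvgM; [exact: cf | exact: cg].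
split; first by move=> x Ux; apply: cvgM; [exact: (Ck_on_cont Cf)|exact: (Ck_on_cont Cg)].
have [_ df] := Cf; have [_ dg] := Cg.
move=> w; have [d dC] := df w; have [e eC] := dg w; split=> [x Ux|].
  by apply: derivableM; [exact: d|exact: e].
apply: (eq_Ck_on oU) (Ck_onD oU (IH _ _ (Ck_onS Cf) eC) (IH _ _ (Ck_onS Cg) dC)).
by move=> x /set_mem Ux /=; rewrite deriveM //; [exact: d|exact: e].
Qed.

Lemma Ck_onN {V} k (U : set V) (f : V -> R) : open U ->
  Ck_on k U f -> Ck_on k U (fun x => - f x).
Proof.
move=> oU Cf; apply: (eq_Ck_on oU) (Ck_onM oU (Ck_on_cst k U (-1 : R)) Cf).
by move=> x _ /=; rewrite mulN1r.
Qed.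

Lemma Ck_on_sum {V} (I : Type) (r : seq I) (P : pred I) k (U : set V)
  (F : I -> V -> R) : open U -> (forall i, Ck_on k U (F i)) ->
  Ck_on k U (fun x => \sum_(i <- r | P i) F i x).
Proof.
move=> oU CF; elim: r => [|i r IH].
  by apply: (eq_Ck_on oU) (Ck_on_cst k U (0 : R)) => x _; rewrite big_nil.
case Pi: (P i); last by apply: (eq_Ck_on oU) IH => x _; rewrite big_cons Pi.
by apply: (eq_Ck_on oU) (Ck_onD oU (CF i) IH) => x _; rewrite big_cons Pi.
Qed.

Lemma Ck_on_prod {V} (I : Type) (r : seq I) (P : pred I) k (U : set V)
  (F : I -> V -> R) : open U -> (forall i, Ck_on k U (F i)) ->
  Ck_on k U (fun x => \prod_(i <- r | P i) F i x).
Proof.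
move=> oU CF; elim: r => [|i r IH].
  by apply: (eq_Ck_on oU) (Ck_on_cst k U (1 : R)) => x _; rewrite big_nil.
case Pi: (P i); last by apply: (eq_Ck_on oU) IH => x _; rewrite big_cons Pi.
by apply: (eq_Ck_on oU) (Ck_onM oU (CF i) IH) => x _; rewrite big_cons Pi.
Qed.

(* Only directional derivatives enter [Ck_on], so that composing with an affine
   map on the right needs no chain rule: the difference quotients agree. *)
Lemma derive_affine {V V' W} (f : V -> W) (A L : V' -> V) (x w : V') :
  (forall h : R, A (h *: w + x) = h *: L w + A x) ->
  'D_w (f \o A) x = 'D_(L w) f (A x).
Proof.
by move=> AL; rewrite /derive; under eq_fun do rewrite /= AL.
Qed.

Lemma derivable_affine {V V' W} (f : V -> W) (A L : V' -> V) (x w : V') :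
  (forall h : R, A (h *: w + x) = h *: L w + A x) ->
  derivable (f \o A) x w <-> derivable f (A x) (L w).
Proof.
move=> AL; rewrite /derivable.
by under eq_fun do rewrite /= AL.
Qed.

Lemma Ck_on_affine {V V' W} k (U : set V) (U' : set V') (f : V -> W) (A L : V' -> V) :
  (forall (h : R) w x, A (h *: w + x) = h *: L w + A x) ->
  continuous A -> U' `<=` A @^-1` U -> Ck_on k U f -> Ck_on k U' (f \o A).
Proof.
move=> AL cA UU; elim: k f => [|k IH] f [cf df]; split=> //;
  try by move=> x /UU Ux; apply: continuous_comp; [exact: cA | exact: cf].
move=> w; have [d dC] := df (L w); split=> [x /UU Ux|].
  by apply/(derivable_affine _ (fun h => AL h w x))/d.
have -> : 'D_w (f \o A) = 'D_(L w) f \o A.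
  by apply/funext => x; rewrite (derive_affine f (fun h => AL h w x)).
exact: IH.
Qed.

Lemma Ck_on_linear {V} k (U : set V) (f : V -> R) :
  (forall (h : R) w x, f (h *: w + x) = h * f w + f x) -> continuous f -> Ck_on k U f.
Proof.
move=> fL cf; have q w x : (fun h : R => h^-1 *: (f (h *: w + x) - f x)) @ 0^' --> f w.
  apply: cvg_near_cst; rewrite near_withinE; near=> h => h0.
  by rewrite fL addrK /GRing.scale /= mulKf.
case: k => [|k]; split=> //; first by move=> *; exact: cf.
  by move=> *; exact: cf.
move=> w; split=> [x _|]; first by apply/cvg_ex; exists (f w); exact: q.
have -> : 'D_w f = (fun=> f w) by apply/funext => x; exact/cvg_lim/q.
exact: Ck_on_cst.
Unshelve. all: by end_near.
Qed.

(** Derivability in one direction does not give differentiability at the point. On the line through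
    [x] in the direction [w] it does, and the one-variable chain rule applies there. *)
Lemma is_derive_comp1 {V} (b : R -> R) (f : V -> R) (x w : V) (b' f' : R) :
  is_derive (f x) 1 b b' -> is_derive x w f f' -> is_derive x w (b \o f) (b' * f').
Proof.
move=> [db Db] [df Df]; set F := fun h : R => f (h *: w + x).
have F0 : F 0 = f x by rewrite /F scale0r add0r.
have dF : derivable F 0 1 by exact: (derivable1P f x w).1 df.
have DF : derive1 F 0 = f'.
  rewrite derive1E -Df /derive /F.
  by under eq_fun do rewrite /= addr0 scale0r add0r [_%:A]mulr1.
have dbF : derivable (b \o F) 0 1.
  apply/derivable1_diffP; apply: differentiable_comp.
    exact/derivable1_diffP.
  by apply/derivable1_diffP; rewrite F0.
apply: DeriveDef; first exact: (derivable1P (b \o f) x w).2 dbF.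
have := derive1_comp dF; rewrite F0 => /(_ b db).
rewrite DF [derive1 b _]derive1E Db derive1E => <-.
rewrite /derive /F.
by under [in RHS]eq_fun do rewrite /= addr0 scale0r add0r [_%:A]mulr1.
Qed.

(** Regularity of the outer function of a composition. The derivative enters as a witness, so that
    functions with a closed-form derivative are treated by induction on the order. *)
Fixpoint Ck1 (k : nat) (I : set R) (b : R -> R) : Prop :=
  (forall x, I x -> {for x, continuous b}) /\
  match k with
  | 0 => True
  | k'.+1 => exists2 b' : R -> R, (forall x, I x -> is_derive x 1 b (b' x)) & Ck1 k' I b'
  end.

Lemma Ck_on_comp1 {V} k (U : set V) (I : set R) (b : R -> R) (f : V -> R) : open U ->
  (forall x, U x -> I (f x)) -> Ck1 k I b -> Ck_on k U f -> Ck_on k U (b \o f).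
Proof.
move=> oU fI; elim: k b => [|k IH] b Cb Cf.
  case: Cb Cf => cb _ [cf _]; split=> // x Ux.
  by apply: continuous_comp; [exact: cf|exact/cb/fI].
split; first by move=> x Ux; apply: continuous_comp;
  [exact: (Ck_on_cont Cf)|apply: (proj1 Cb); exact: fI].
have [cb [b' db Cb']] := Cb; have [_ df] := Cf.
move=> w; have [d dC] := df w.
have D x : U x -> is_derive x w (b \o f) (b' (f x) * 'D_w f x).
  by move=> Ux; apply: is_derive_comp1; [exact/db/fI|exact/derivableP/d].
split=> [x /D []//|].
apply: (eq_Ck_on oU) (Ck_onM oU (IH b' Cb' (Ck_onS Cf)) dC).
by move=> x /set_mem/D [_ ->].
Qed.

Lemma Ck1_expR k I : Ck1 k I (@expR R).
Proof.
elim: k => [|k IH]; split=> //; try by move=> *; exact: continuous_expR.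
by exists expR => // x _; exact: is_derive_expR.
Qed.

Lemma is_derive_exprV i (x : R) : x != 0 ->
  is_derive x 1 (fun x : R => x ^- i) (- i%:R * x ^- i.+1).
Proof.
move=> x0; apply: DeriveDef; first by apply: derivableV; [rewrite expf_neq0|exact: exprn_derivable].
rewrite deriveV ?expf_neq0//; last exact: exprn_derivable.
rewrite exp_derive /GRing.scale /= mulr1.
case: i => [|i]; first by rewrite !mul0r mulr0 oppr0 mul0r.
rewrite /= -!exprVn !exprS expr0 !mulr1 exprVn.
have : x ^+ i != 0 by rewrite expf_neq0.
by move: (x ^+ i) => y y0; field; rewrite x0 y0.
Qed.

Lemma Ck1_inv k : Ck1 k [set x : R | x != 0] (fun x => x^-1).
Proof.
(* The derivative of a negative power is a multiple of the next one, so the induction on [k] has to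
   range over all exponents. *)
suff H j : Ck1 k [set x : R | x != 0] (fun x => x^- j).
  by have := H 1; congr Ck1; apply/funext => x; rewrite expr1.
have cj i (x : R) : x != 0 -> {for x, continuous (fun x : R => x ^- i)}.
  move=> x0; apply: cvgV; first by rewrite expf_neq0.
  exact: exprn_continuous.
have sc (c : R) (b : R -> R) I i : Ck1 i I b -> Ck1 i I (fun x => c * b x).
  elim: i b => [|i IH] b; first by case=> cb _; split=> // x Ix; apply: cvgM => //;
     [exact: cvg_cst|exact: cb].
  case=> cb [b' db Cb]; split.
    by move=> x Ix; apply: cvgM; [exact: cvg_cst|exact: cb].
  exists (fun x => c * b' x); last exact: IH.
  move=> x Ix; have [d1 d2] := db x Ix; split; first by apply: derivableM.
  by rewrite deriveM // derive_cst scaler0 addr0 d2.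
elim: k j => [|k IH] j; first by split=> // x; exact: cj.
split; first by move=> x; exact: cj.
by exists (fun x => - j%:R * x ^- j.+1); [move=> x; exact: is_derive_exprV|exact/sc/IH].
Qed.

Lemma Ck1_ln k : Ck1 k [set x : R | 0 < x] (@ln R).
Proof.
have dl (x : R) : 0 < x -> is_derive x 1 (@ln R) x^-1 by exact: is_derive1_ln.
have cl (x : R) : 0 < x -> {for x, continuous (@ln R)} by exact: continuous_ln.
case: k => [|k]; split=> //.
exists (fun x => x^-1) => //.
have sb (I J : set R) b i : I `<=` J -> Ck1 i J b -> Ck1 i I b.
  move=> IJ; elim: i b => [|i IH] b; first by case=> cb _; split=> // x /IJ/cb.
  case=> cb [b' db Cb]; split; first by move=> x /IJ/cb.
  by exists b'; [move=> x /IJ/db|exact: IH].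
by apply: sb (Ck1_inv k) => x /lt0r_neq0.
Qed.

Lemma Ck_onV {V} k (U : set V) (f : V -> R) : open U ->
  (forall x, U x -> f x != 0) -> Ck_on k U f -> Ck_on k U (fun x => (f x)^-1).
Proof. by move=> oU f0; apply: (Ck_on_comp1 oU f0); exact: Ck1_inv. Qed.

Lemma Ck_on_exp {V} k (U : set V) (f : V -> R) : open U ->
  Ck_on k U f -> Ck_on k U (fun x => expR (f x)).
Proof. by move=> oU; apply: (@Ck_on_comp1 _ _ _ setT) => //; exact: Ck1_expR. Qed.

Lemma Ck_on_ln {V} k (U : set V) (f : V -> R) : open U ->
  (forall x, U x -> 0 < f x) -> Ck_on k U f -> Ck_on k U (fun x => ln (f x)).
Proof. by move=> oU f0; apply: (Ck_on_comp1 oU f0); exact: Ck1_ln. Qed.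

Lemma Ck_on_sqrt {V} k (U : set V) (f : V -> R) : open U ->
  (forall x, U x -> 0 < f x) -> Ck_on k U f -> Ck_on k U (fun x => Num.sqrt (f x)).
Proof.
move=> oU f0 Cf.
(* For positive [f] the square root is exp (ln f / 2). *)
apply: (eq_Ck_on oU) (Ck_on_exp oU (Ck_onM oU (Ck_on_cst k U (2^-1 : R)) (Ck_on_ln oU f0 Cf))).
move=> x /set_mem/f0 fx /=.
have e2 : expR (2^-1 * ln (f x)) ^+ 2 = f x.
  by rewrite -expRM_natr mulrAC mulVf ?pnatr_eq0// mul1r lnK.
by rewrite -{2}e2 sqrtr_sqr ger0_norm ?expR_ge0.
Qed.

Lemma Ck_on_mx {V} m n k (U : set V) (f : V -> 'M[R]_(m, n)) : open U ->
  Ck_on k U f <-> forall i j, Ck_on k U (fun x => f x i j).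
Proof.
move=> oU; split.
  move=> + i j; elim: k f => [|k IH] f [cf df]; split=> //;
    try by move=> x Ux; apply: (@continuous_comp _ _ _ f (fun M : 'M[R]_(m, n) => M i j));
       [exact: cf|exact: coord_continuous].
  move=> w; have [d dC] := df w; split=> [x Ux|]; first exact: (derivable_mxP _ _ _).1 (d x Ux) i j.
  apply: (eq_Ck_on oU) (IH _ dC) => x /set_mem Ux /=.
  by rewrite derive_mx ?mxE//; exact: d.
have cm (g : V -> 'M[R]_(m, n)) x : (forall i j, {for x, continuous (fun x => g x i j)}) ->
    {for x, continuous g}.
  move=> cg; apply/cvgrPdist_le => /= e e0; near=> y.
  rewrite /Num.Def.normr/= mx_normrE (bigmax_le _ (ltW e0))//= => i _.
  rewrite !mxE/=; move: i; near: y; apply: filter_forall => /= i.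
  exact: ((cvgrPdist_le _ _).1 (cg i.1 i.2) e e0).
elim: k f => [|k IH] f Cf.
  by split=> // x Ux; apply: cm => i j; apply: (Ck_on_cont (Cf i j)).
split; first by move=> x Ux; apply: cm => i j; apply: (Ck_on_cont (Cf i j)).
move=> w; have d x : U x -> derivable f x w.
  by move=> Ux; apply/derivable_mxP => i j; have [_ /(_ w) [d _]] := Cf i j; exact: d.
split=> //; apply: IH => i j; have [_ /(_ w) [_]] := Cf i j.
by apply: (eq_Ck_on oU) => x /set_mem Ux /=; rewrite derive_mx ?mxE//; exact: d.
Unshelve. all: by end_near.
Qed.

End CkTheory.

(** * Symmetry of mixed directional derivatives *)

Section Schwarz.
Context {R : realType} {V : normedModType R}.
Implicit Types (f : V -> R).

Lemma is_derive_line {W : normedModType R} (f : V -> W) (y w : V) (s : R) :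
  derivable f (s *: w + y) w ->
  is_derive s 1 (fun s => f (s *: w + y)) ('D_w f (s *: w + y)).
Proof.
move=> df; have AL (h : R) : (h *: 1 + s) *: w + y = h *: (1 *: w) + (s *: w + y).
  by rewrite scalerDl scale1r [_%:A]mulr1 addrA.
have E : (fun h : R => h^-1 *: (((fun s => f (s *: w + y)) \o shift s) (h *: 1) - f (s *: w + y)))
   = (fun h : R => h^-1 *: ((f \o shift (s *: w + y)) (h *: w) - f (s *: w + y))).
  by apply/funext => h /=; rewrite AL scale1r.
by apply: DeriveDef; [rewrite /derivable E|rewrite /derive E].
Qed.

(** The mean value theorem is applied twice to the second difference over the parallelogram spanned
    by [h *: w] and [h *: z]. The left side is symmetric in [w] and [z], the right side is not. *)
Let second_difference f (x w z : V) (h : R) : 0 < h -> forall U, Ck_on 2 U f ->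
  (forall s t, 0 <= s <= h -> 0 <= t <= h -> U (s *: w + (t *: z + x))) ->
  exists c d, [/\ 0 <= c <= h, 0 <= d <= h &
    f (h *: w + (h *: z + x)) - f (h *: w + x) - f (h *: z + x) + f x =
    'D_z ('D_w f) (c *: w + (d *: z + x)) * h * h].
Proof.
move=> h0 U [_ Cf] Uh; have [dw [_ Cw]] := Cf w; have [dz _] := Cw z.
have hh : 0 <= h <= h by rewrite lexx ltW.
have h00 : 0 <= (0 : R) <= h by rewrite lexx ltW.
have Uh0 s : 0 <= s <= h -> U (s *: w + x).
  by move=> sh; have := Uh s 0 sh h00; rewrite scale0r add0r.
have itv (s : R) : s \in `[0, h] -> 0 <= s <= h by rewrite in_itv.
have oitv (s : R) : s \in `]0, h[ -> 0 <= s <= h.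
  by rewrite in_itv /= => /andP[/ltW -> /ltW ->].
pose phi s := f (s *: w + (h *: z + x)) - f (s *: w + x).
have dphi s : 0 <= s <= h ->
    is_derive s 1 phi ('D_w f (s *: w + (h *: z + x)) - 'D_w f (s *: w + x)).
  move=> sh; apply: is_deriveB; apply: is_derive_line; apply: dw; [exact: Uh|exact: Uh0].
have cphi : {within `[0, h], continuous phi}.
  by apply: derivable_within_continuous => s /itv/dphi [].
have [c /oitv ch Ec] := MVT h0 (fun s hs => dphi s (oitv s hs)) cphi.
pose psi t := 'D_w f (t *: z + (c *: w + x)).
have AC t : t *: z + (c *: w + x) = c *: w + (t *: z + x) by rewrite addrCA.
have dpsi t : 0 <= t <= h -> is_derive t 1 psi ('D_z ('D_w f) (t *: z + (c *: w + x))).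
  by move=> th; apply: is_derive_line; apply: dz; rewrite AC; exact: Uh.
have cpsi : {within `[0, h], continuous psi}.
  by apply: derivable_within_continuous => s /itv/dpsi [].
have [d /oitv dh Ed] := MVT h0 (fun s hs => dpsi s (oitv s hs)) cpsi.
exists c, d; split=> //; rewrite -AC.
transitivity (phi h - phi 0); first by rewrite /phi scale0r !add0r; ring.
rewrite Ec subr0; congr (_ * h); rewrite -[in RHS](subr0 h) -Ed /psi scale0r add0r.
by rewrite AC.
Qed.

(** Both mixed derivatives, taken at suitable points of a small parallelogram, equal the same second
    difference divided by h^2; continuity brings the two points back to [x]. *)
Lemma schwarz f (U : set V) (x w z : V) : open U -> U x -> Ck_on 2 U f ->
  'D_w ('D_z f) x = 'D_z ('D_w f) x.
Proof.
move=> oU Ux Cf; apply/eqP; rewrite -subr_eq0 -normr_le0; apply/ler_addgt0Pl => e e0.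
have c2 (a b : V) : {for x, continuous ('D_a ('D_b f))}.
  by have [_ /(_ b) [_ [_ /(_ a) [_ [c _]]]]] := Cf; exact: c.
have e2 : 0 < e / 2 by rewrite divr_gt0.
have : \forall y \near x, U y /\
   (`|'D_w ('D_z f) x - 'D_w ('D_z f) y| <= e / 2 /\
    `|'D_z ('D_w f) x - 'D_z ('D_w f) y| <= e / 2).
  have A1 := (cvgrPdist_le _ _).1 (c2 w z) _ e2.
  have A2 := (cvgrPdist_le _ _).1 (c2 z w) _ e2.
  by apply: filterI; [exact: open_nbhs_nbhs|apply: filterI; [exact: A1|exact: A2]].
move=> /nbhs_ballP[r /= r0 xr].
(* With this size the whole parallelogram lies in the ball of radius [r]; the summand 1 keeps the
   denominator positive when [w] and [z] vanish. *)
pose h := r / (`|w| + `|z| + 1) / 2.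
have wz0 : 0 < `|w| + `|z| + 1 by rewrite ltr_wpDl// addr_ge0.
have h0 : 0 < h by rewrite !divr_gt0.
have Br s t : 0 <= s <= h -> 0 <= t <= h -> ball x r (s *: w + (t *: z + x)).
  move=> /andP[s0 sh] /andP[t0 th]; rewrite -ball_normE /ball_ /=.
  rewrite addrA opprD addrCA subrr addr0 normrN.
  apply: le_lt_trans (ler_normD _ _) _; rewrite !normrZ !ger0_norm//.
  apply: le_lt_trans (_ : h * (`|w| + `|z| + 1) < _).
    rewrite mulrDr mulrDr mulr1 -[leLHS]addr0; apply: lerD; last exact: ltW.
    by apply: lerD; apply: ler_wpM2r.
  rewrite /h mulrAC divfK ?lt0r_neq0// ltr_pdivrMr// ltr_pMr//.
  by rewrite ltr1n.
have [c [d [ch dh E1]]] := second_difference h0 Cf (fun s t hs ht => (xr _ (Br s t hs ht)).1).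
have Br' s t : 0 <= s <= h -> 0 <= t <= h -> ball x r (s *: z + (t *: w + x)).
  by move=> hs ht; rewrite addrCA; exact: Br.
have [c' [d' [ch' dh' E2]]] := second_difference h0 Cf (fun s t hs ht => (xr _ (Br' s t hs ht)).1).
have E : 'D_z ('D_w f) (c *: w + (d *: z + x)) = 'D_w ('D_z f) (c' *: z + (d' *: w + x)).
  apply: (mulIf (lt0r_neq0 h0)); apply: (mulIf (lt0r_neq0 h0)).
  have EE : h *: w + (h *: z + x) = h *: z + (h *: w + x) by exact: addrCA.
  apply: etrans (esym E1) _; apply: etrans E2; rewrite EE.
  by congr (_ + _); rewrite addrAC.
have [_ [_ B1]] := xr _ (Br _ _ ch dh); have [_ [B2 _]] := xr _ (Br' _ _ ch' dh').
rewrite addr0; move: B1 B2; rewrite E; move: ('D_w _ (c' *: z + _)) => q B1 B2.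
have := lerD B2 B1; rewrite -splitr; apply: le_trans.
by rewrite [X in _ <= _ + X]distrC; exact: ler_distD.
Qed.

End Schwarz.

(* The derivatives of [exp(-1/x)] are combinations of the functions
   [x^-m exp(-1/x)], all flat at [0]; the following family is thus closed under
   differentiation. *)
Section FlatFunction.
Context {R : realType}.

Definition flat (m : nat) (x : R) : R := if 0 < x then x ^- m * expR (- x^-1) else 0.

Lemma expR_lower (m : nat) (y : R) : 0 <= y -> (y / m.+1%:R) ^+ m.+1 <= expR y.
Proof.
move=> y0; have -> : expR y = expR (y / m.+1%:R) ^+ m.+1.
  by rewrite -expRM_natr divfK ?pnatr_eq0.
rewrite lerXn2r ?nnegrE ?expR_ge0 ?divr_ge0//.
by apply: le_trans (expR_ge1Dx _); rewrite lerDr.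
Qed.

(** Quadratic decay at 0 is enough for a vanishing derivative there. It comes from exp (1/x)
    dominating a multiple of x^-(m+2). *)
Lemma flat_le (m : nat) (x : R) : 0 < x -> 0 <= flat m x <= m.+2%:R ^+ m.+2 * x ^+ 2.
Proof.
move=> x0; rewrite /flat x0; apply/andP; split.
  by rewrite mulr_ge0 ?expR_ge0// invr_ge0 exprn_ge0// ltW.
rewrite expRN; have x1 : 0 <= x^-1 by rewrite invr_ge0 ltW.
have := expR_lower m.+1 x1; rewrite exprMn exprVn => h.
have p0 : 0 < x ^- m.+2 * m.+2%:R^-1 ^+ m.+2.
  by rewrite mulr_gt0 ?exprn_gt0 ?invr_gt0 ?ltr0n// exprn_gt0.
have h2 : (expR x^-1)^-1 <= m.+2%:R ^+ m.+2 * x ^+ m.+2.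
  have K0 : 0 < m.+2%:R ^+ m.+2 * x ^+ m.+2 by rewrite mulr_gt0 ?exprn_gt0 ?ltr0n.
  by rewrite invf_ple ?posrE ?expR_gt0//; apply: le_trans h; rewrite invfM mulrC exprVn.
apply: le_trans (ler_wpM2l _ h2) _; first by rewrite invr_ge0 exprn_ge0// ltW.
rewrite mulrCA; have -> : x ^+ m.+2 = x ^+ m * x ^+ 2 by rewrite -exprD addn2.
by rewrite mulKf// expf_neq0// lt0r_neq0.
Qed.

Lemma is_derive_flat m (x : R) : is_derive x 1 (flat m) (- m%:R * flat m.+1 x + flat m.+2 x).
Proof.
have [x0|x0|->] := ltgtP x 0.
- have -> : - m%:R * flat m.+1 x + flat m.+2 x = 0.
    by rewrite /flat ltNge (ltW x0) /= mulr0 addr0.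
  apply: near_eq_is_derive (is_derive_cst (0 : R) x 1).
  near=> y; rewrite /flat ltNge ifF//; apply/negbTE; rewrite negbK ltW//.
  by near: y; exact: lt_nbhsl.
- have x0' := lt0r_neq0 x0.
  have D : is_derive x 1 (fun y : R => y ^- m * expR (- y^-1))
      (- m%:R * flat m.+1 x + flat m.+2 x).
    have D1 : is_derive x 1 (fun y : R => y^-1) (- x ^- 2).
      apply: DeriveDef; first by apply: derivableV.
      by rewrite deriveV// derive_id [_%:A]mulr1.
    have D2 : is_derive x 1 (fun y : R => expR (- y^-1)) (expR (- x^-1) * (- - x ^- 2)).
      by apply: is_derive_comp1; exact: is_derive_expR.
    have D := is_deriveM (is_derive_exprV m x0') D2; apply: is_derive_eq D _.
    rewrite /flat x0 /GRing.scale /= opprK -!exprVn !exprS expr0 mulr1; ring.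
  apply: near_eq_is_derive D; near=> y; rewrite /flat ifT//.
  by near: y; exact: lt_nbhsr.
- have -> : - m%:R * flat m.+1 0 + flat m.+2 0 = 0 :> R.
    by rewrite /flat ltxx mulr0 addr0.
  suff L : (fun h : R => h^-1 *: ((flat m \o shift 0) (h *: 1) - flat m 0)) @ 0^' --> (0 : R).
    by apply: DeriveDef; [apply/cvg_ex; exists 0|exact: cvg_lim L].
  set K := m.+2%:R ^+ m.+2 : R.
  have K0 : 0 < K by rewrite exprn_gt0// ltr0n.
  apply/cvgrPdist_le => e e0; rewrite near_withinE; near=> h => h0.
  rewrite sub0r normrN /= addr0 [_%:A]mulr1 {2}/flat ltxx subr0 normrZ.
  have [hp|hn] := ltP 0 h; last first.
    by rewrite /flat ltNge hn /= normr0 mulr0 ltW.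
  have /andP[f0 fK] := flat_le m hp.
  rewrite (ger0_norm f0) normfV gtr0_norm// ler_pdivrMl//.
  apply: le_trans fK _; rewrite -/K expr2 mulrA mulrC; apply: ler_wpM2l; first exact: ltW.
  rewrite mulrC -ler_pdivlMr// ltW//.
  by near: h; apply: lt_nbhsl; rewrite divr_gt0.
Unshelve. all: by end_near.
Qed.

Lemma Ck1_flat k m : Ck1 k setT (flat m).
Proof.
have c j (x : R) : {for x, continuous (flat j)}.
  by apply: differentiable_continuous; apply/derivable1_diffP; have [] := is_derive_flat j x.
have cs (l : seq (R * nat)) (x : R) : {for x, continuous (fun x => \sum_(p <- l) p.1 * flat p.2 x)}.
  elim: l => [|p l IH].
    have -> : (fun x : R => \sum_(p <- [::]) p.1 * flat p.2 x) = cst 0.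
      by apply/funext => y; rewrite big_nil.
    exact: cvg_cst.
  have -> : (fun x : R => \sum_(q <- p :: l) q.1 * flat q.2 x) =
      (fun x => p.1 * flat p.2 x + \sum_(q <- l) q.1 * flat q.2 x).
    by apply/funext => y; rewrite big_cons.
  by apply: cvgD IH; apply: cvgM; [exact: cvg_cst|exact: c].
(* Finite linear combinations of the functions [flat m] are stable under differentiation, so the
   induction is on those; the list holds coefficients and indices. *)
suff H b (l : seq (R * nat)) : b = (fun x => \sum_(p <- l) p.1 * flat p.2 x) -> Ck1 k setT b.
  by apply: (H _ [:: (1, m)]); apply/funext => x; rewrite big_seq1 mul1r.
elim: k b l => [|k IH] b l ->; first by split=> // x _; exact: cs.
split; first by move=> x _; exact: cs.
pose l' := flatten [seq [:: (- p.2%:R * p.1, p.2.+1); (p.1, p.2.+2)] | p <- l].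
exists (fun x => \sum_(p <- l') p.1 * flat p.2 x); last exact: (IH _ l').
move=> x _; rewrite /l'; elim: l {l'} => [|p l IHl].
  apply: (@near_eq_is_derive _ _ _ (fun=> 0)); first by near=> y; rewrite big_nil.
  by rewrite big_nil; exact: is_derive_cst.
apply: (@near_eq_is_derive _ _ _ ((fun x => p.1 * flat p.2 x) \+ (fun x => \sum_(p <- l) p.1 * flat p.2 x))).
  by near=> y; rewrite big_cons.
rewrite /= !big_cons addrA; apply: is_deriveD IHl.
have D := is_deriveM (is_derive_cst p.1 x 1) (is_derive_flat p.2 x).
by apply: is_derive_eq D _; rewrite /GRing.scale /=; ring.
Unshelve. all: by end_near.
Qed.

(** A smooth transition from 0 on y <= 0 to 1 on y >= 1. The two summands of the denominator never
    vanish together. *)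
Definition step (y : R) : R := flat 0 y / (flat 0 y + flat 0 (1 - y)).

Lemma flat_ge0 m x : 0 <= flat m x.
Proof. by have [/(flat_le m)/andP[]//|h] := ltP 0 x; rewrite /flat ltNge h. Qed.

Lemma flat_gt0 m x : 0 < x -> 0 < flat m x.
Proof.
by move=> x0; rewrite /flat x0 mulr_gt0 ?expR_gt0// invr_gt0 exprn_gt0.
Qed.

Lemma step_den y : 0 < flat 0 y + flat 0 (1 - y).
Proof.
have [y0|y0] := ltP 0 y; first by rewrite ltr_pwDl ?flat_gt0 ?flat_ge0.
by rewrite ltr_wpDl ?flat_ge0// flat_gt0// subr_gt0 (le_lt_trans y0).
Qed.

Lemma step_ge0 y : 0 <= step y.
Proof. by rewrite divr_ge0 ?flat_ge0// ltW// step_den. Qed.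

Lemma step_le1 y : step y <= 1.
Proof. by rewrite ler_pdivrMr ?step_den// mul1r lerDl flat_ge0. Qed.

Lemma step_le0 y : y <= 0 -> step y = 0.
Proof. by move=> y0; rewrite /step /flat ltNge y0 /= mul0r. Qed.

Lemma step_ge1 y : 1 <= y -> step y = 1.
Proof.
move=> y1; rewrite /step {3}/flat subr_gt0 ltNge y1 /= addr0 divff// lt0r_neq0//.
by rewrite flat_gt0// (lt_le_trans ltr01).
Qed.

Lemma Ck_on_step {V : normedModType R} k (U : set V) (f : V -> R) : open U ->
  Ck_on k U f -> Ck_on k U (fun x => step (f x)).
Proof.
move=> oU Cf; have C1 : Ck_on k U (fun x => flat 0 (f x)).
  by apply: (@Ck_on_comp1 _ _ _ _ setT (flat 0)) => //; exact: Ck1_flat.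
have C2 : Ck_on k U (fun x => flat 0 (1 - f x)).
  apply: (@Ck_on_comp1 _ _ _ _ setT (flat 0)) => //; first exact: Ck1_flat.
  by apply: (Ck_onD oU (Ck_on_cst k U (1 : R))); exact: Ck_onN.
apply: (Ck_onM oU C1); apply: (Ck_onV oU); last exact: Ck_onD.
by move=> x _; rewrite lt0r_neq0 ?step_den.
Qed.

End FlatFunction.

(** * Curvature in a differential ring modulo an ideal *)

Section DifferentialRing.
Context {S : comNzRingType} {n : nat}.
Implicit Types (x y : S).

Definition derivation (d : S -> S) :=
  (forall x y, d (x + y) = d x + d y) /\ (forall x y, d (x * y) = d x * y + x * d y).

Section DerivationTheory.
Variables (d : S -> S) (hd : derivation d).

Lemma derivD x y : d (x + y) = d x + d y. Proof. exact: hd.1. Qed.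
Lemma derivM x y : d (x * y) = d x * y + x * d y. Proof. exact: hd.2. Qed.
Lemma deriv0 : d 0 = 0.
Proof. by apply: (addrI (d 0)); rewrite -derivD !addr0. Qed.
Lemma derivN x : d (- x) = - d x.
Proof. by apply/eqP; rewrite -subr_eq0 opprK -derivD addNr deriv0. Qed.
Lemma derivB x y : d (x - y) = d x - d y. Proof. by rewrite derivD derivN. Qed.
Lemma deriv1 : d 1 = 0.
Proof. by apply: (addrI (d 1)); rewrite addr0 -{3}[1]mulr1 derivM mulr1 mul1r. Qed.
Lemma deriv_natr m : d m%:R = 0.
Proof. by elim: m => [|m IH]; rewrite ?deriv0// -addn1 natrD derivD IH deriv1 addr0. Qed.
Lemma deriv_sum (I : Type) (r : seq I) (P : pred I) (F : I -> S) :
  d (\sum_(i <- r | P i) F i) = \sum_(i <- r | P i) d (F i).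
Proof. exact: (big_morph d derivD deriv0). Qed.
Lemma deriv_mulr_cst x y : d x = 0 -> d (x * y) = x * d y.
Proof. by move=> dx; rewrite derivM dx mul0r add0r. Qed.
Lemma deriv_half x : 2 * x = 1 -> d x = 0.
Proof.
move=> x2; have := deriv1; rewrite -x2 deriv_mulr_cst ?deriv_natr// => /(congr1 ( *%R x)).
by rewrite mulr0 mulrA [x * 2]mulrC x2 mul1r.
Qed.

Lemma deriv_mulmx p q r (A : 'M[S]_(p, q)) (B : 'M[S]_(q, r)) :
  map_mx d (A *m B) = map_mx d A *m B + A *m map_mx d B.
Proof.
apply/matrixP => i j; rewrite !mxE deriv_sum -big_split /=.
by apply: eq_bigr => k _; rewrite !mxE derivM.
Qed.

End DerivationTheory.

(** Coordinate tensor calculus over an abstract ring: [hf] stands for 1/2, [e a] for the partial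
    derivatives, [G] and [H] for the metric and its inverse. *)
Definition christ (hf : S) (e : 'I_n -> S -> S) (G H : 'M[S]_n) (c a b : 'I_n) : S :=
  hf * \sum_d H c d * (e a (G b d) + e b (G a d) - e d (G a b)).

Definition ricc (e : 'I_n -> S -> S) (K : 'I_n -> 'I_n -> 'I_n -> S) (a b : 'I_n) : S :=
  \sum_c (e c (K c a b) - e b (K c a c))
  + \sum_c \sum_d (K c c d * K d a b - K c b d * K d a c).

Definition hess (e : 'I_n -> S -> S) (K : 'I_n -> 'I_n -> 'I_n -> S) (f : S) (a b : 'I_n) : S :=
  e a (e b f) - \sum_c K c a b * e c f.

Definition trH (H : 'M[S]_n) (T : 'I_n -> 'I_n -> S) : S := \sum_a \sum_b H a b * T a b.

Definition gsq (e : 'I_n -> S -> S) (H : 'M[S]_n) (f k : S) : S :=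
  \sum_a \sum_b H a b * e a f * e b k.

(** In the application the ideal consists of the functions whose u-jet of a given order vanishes
    along u = 0, so that congruence is equality of jets. *)
Record is_ideal (J : S -> Prop) : Prop := IsIdeal {
  ideal0 : J 0;
  idealD : forall x y, J x -> J y -> J (x + y);
  idealM : forall x y, J y -> J (x * y)
}.

Section Congruence.
Variables (J : S -> Prop) (hJ : is_ideal J).

Definition eqm x y := J (x - y).

Lemma idealN x : J x -> J (- x).
Proof. by move=> Jx; rewrite -mulN1r; exact: idealM. Qed.
Lemma ideal_sum (I : Type) (r : seq I) (F : I -> S) :
  (forall i, J (F i)) -> J (\sum_(i <- r) F i).
Proof. by move=> JF; elim/big_ind: _ => //; [exact: ideal0|exact: idealD]. Qed.
Lemma eqm_refl x : eqm x x.
Proof. by rewrite /eqm subrr; exact: ideal0. Qed.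
Lemma eqm_eq x y : x = y -> eqm x y.
Proof. by move->; exact: eqm_refl. Qed.
Lemma eqm_sym x y : eqm x y -> eqm y x.
Proof. by rewrite /eqm => /idealN; rewrite opprB. Qed.
Lemma eqm_trans y x z : eqm x y -> eqm y z -> eqm x z.
Proof. by move=> xy yz; have := idealD hJ xy yz; rewrite addrA subrK. Qed.
Lemma eqmD x x' y y' : eqm x x' -> eqm y y' -> eqm (x + y) (x' + y').
Proof. by move=> xx yy; rewrite /eqm opprD addrACA; exact: idealD. Qed.
Lemma eqmN x x' : eqm x x' -> eqm (- x) (- x').
Proof. by move=> xx; rewrite /eqm -opprD; exact: idealN. Qed.
Lemma eqmM x x' y y' : eqm x x' -> eqm y y' -> eqm (x * y) (x' * y').
Proof.
move=> xx yy; rewrite /eqm.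
have -> : x * y - x' * y' = y * (x - x') + x' * (y - y') by ring.
by apply: idealD => //; apply: idealM.
Qed.
Lemma eqm_sum (I : Type) (r : seq I) (F F' : I -> S) :
  (forall i, eqm (F i) (F' i)) -> eqm (\sum_(i <- r) F i) (\sum_(i <- r) F' i).
Proof. by move=> FF; rewrite /eqm -sumrB; exact: ideal_sum. Qed.
Lemma eqm_deriv (d : S -> S) x y : derivation d -> (forall z, J z -> J (d z)) ->
  eqm x y -> eqm (d x) (d y).
Proof. by move=> hd Jd xy; rewrite /eqm -derivB//; exact: Jd. Qed.

End Congruence.

Section Naturality.
Variables (hf : S) (e : 'I_n -> S -> S) (G H : 'M[S]_n).
Hypotheses (hf2 : 2 * hf = 1) (he : forall a, derivation (e a)).
Hypothesis eC : forall a b x, e a (e b x) = e b (e a x).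
Hypotheses (Gsym : G^T = G) (Hsym : H^T = H) (HG : H *m G = 1%:M) (GH : G *m H = 1%:M).
Variables (J : S -> Prop) (hJ : is_ideal J).
Hypothesis Je : forall a x, J x -> J (e a x).
(* [D] plays the part of [d_t - X^c e_c] and [B a c] that of [e_a X^c]; in these
   terms [d_t G = L_X G] reads [D G = B G + G B^T]. *)
Variables (D : S -> S) (hD : derivation D) (B : 'M[S]_n).
Hypothesis DeC : forall a x, D (e a x) = e a (D x) + \sum_c B a c * e c x.
Hypothesis eB : forall a b c, e a (B b c) = e b (B a c).
Hypothesis DG : forall a b, eqm J (D (G a b)) ((B *m G + G *m B^T) a b).

Notation "x === y" := (eqm J x y) (at level 70).
Local Notation K := (christ hf e G H).

Let Gs a b : G a b = G b a. Proof. by rewrite -{1}Gsym mxE. Qed.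
Let Hs a b : H a b = H b a. Proof. by rewrite -{1}Hsym mxE. Qed.

(** The part of the Lie derivative along X in which X itself is differentiated; the transport term
    X^c e_c is contained in [D]. *)
Definition lie (T : 'I_n -> 'I_n -> S) a b := \sum_c (B a c * T c b + B b c * T a c).

Let DGlie a b : D (G a b) === lie (fun i j => G i j) a b.
Proof.
apply: eqm_trans (DG a b) _ => //; apply: eqm_eq => //.
rewrite !mxE -big_split /=; apply: eq_bigr => c _.
by rewrite mxE [G a c * _]mulrC.
Qed.

Let eqmmx p q r (A A' : 'M[S]_(p, q)) (C C' : 'M[S]_(q, r)) :
  (forall i j, A i j === A' i j) -> (forall i j, C i j === C' i j) ->
  forall i j, (A *m C) i j === (A' *m C') i j.
Proof.
by move=> AA CC i j; rewrite !mxE; apply: eqm_sum => // k; apply: eqmM.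
Qed.

(** Obtained by differentiating H G = 1. *)
Lemma eqm_DH a b : D (H a b) === - \sum_c (H a c * B c b + B c a * H c b).
Proof.
have E : map_mx D H = - (H *m map_mx D G *m H).
  have := deriv_mulmx hD H G; rewrite HG.
  have -> : map_mx D 1%:M = 0 :> 'M[S]_n.
    by apply/matrixP => i j; rewrite !mxE deriv_natr.
  move/(congr1 (fun M => M *m H)); rewrite mul0mx mulmxDl -!mulmxA GH mulmx1.
  by move/esym/eqP; rewrite addr_eq0 => /eqP.
have -> : D (H a b) = - (H *m map_mx D G *m H) a b.
  by have /matrixP/(_ a b) := E; rewrite !mxE.
apply: eqmN => //.
apply: eqm_trans (_ : (H *m (B *m G + G *m B^T) *m H) a b === _) => //.
  apply: eqmmx => [i j|i j]; last exact: eqm_refl.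
  by apply: eqmmx => [k l|k l]; [exact: eqm_refl|rewrite mxE; exact: DG].
apply: eqm_eq => //.
rewrite mulmxDr mulmxDl -!mulmxA GH mulmx1 [H *m (G *m _)]mulmxA HG mul1mx.
by rewrite !mxE -big_split; apply: eq_bigr => c _; rewrite mxE.
Qed.

Local Notation T a b d := (e a (G b d) + e b (G a d) - e d (G a b)).

(** Up to the factor 1/2 these are the Christoffel symbols with lowered index. They transform as a
    tensor except for second derivatives of X; by the symmetry [eB] two of these agree and the other
    four cancel in pairs. *)
Let DT a b d : D (T a b d) ===
  \sum_c (B a c * T c b d + B b c * T a c d + B d c * T a b c + 2 * (e a (B b c) * G c d)).
Proof.
have X a' b' d' : D (e a' (G b' d')) === \sum_c (e a' (B b' c) * G c d' + B b' c * e a' (G c d')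
    + (e a' (B d' c) * G b' c + B d' c * e a' (G b' c)) + B a' c * e c (G b' d')).
  rewrite DeC; apply: (eqm_trans hJ) (eqmD hJ (eqm_deriv (he a') (Je a') (DGlie b' d')) (eqm_refl hJ _)) _.
  apply: eqm_eq => //; rewrite /lie (deriv_sum (he a')) -big_split /=; apply: eq_bigr => c _.
  by rewrite (derivD (he a')) !(derivM (he a')).
rewrite (derivB hD) (derivD hD).
apply: (eqm_trans hJ) (eqmD hJ (eqmD hJ (X _ _ _) (X _ _ _)) (eqmN hJ (X _ _ _))) _.
apply: eqm_eq => //; rewrite -big_split -sumrB /=; apply: eq_bigr => c _.
rewrite [G b c]Gs [G a c]Gs [e b (B a c)]eB [e d (B a c)]eB [e d (B b c)]eB.
ring.
Qed.

(** The Lie derivative of a connection: tensorial in its three indices, plus the second derivatives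
    of the vector field. *)
Lemma eqm_DK c a b : D (K c a b) ===
  \sum_d (B a d * K c d b + B b d * K c a d - B d c * K d a b) + e a (B b c).
Proof.
have h0 := deriv_half hD hf2.
rewrite /christ (deriv_mulr_cst hD)// (deriv_sum hD).
have X d : D (H c d * T a b d) === (- \sum_k (H c k * B k d + B k c * H k d)) * T a b d
   + H c d * \sum_k (B a k * T k b d + B b k * T a k d + B d k * T a b k + 2 * (e a (B b k) * G k d)).
  rewrite (derivM hD); exact: (eqmD hJ (eqmM hJ (eqm_DH _ _) (eqm_refl hJ _)) (eqmM hJ (eqm_refl hJ _) (DT _ _ _))).
apply: (eqm_trans hJ) (eqmM hJ (eqm_refl hJ _) (eqm_sum hJ _ X)) _.
apply: eqm_eq => //.
(* The contracted index contributes once through [D H] and once through [D T], with opposite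
   signs. *)
have C : \sum_d \sum_k H c k * B k d * T a b d = \sum_d \sum_k H c d * (B d k * T a b k).
  by rewrite exchange_big /=; apply: eq_bigr => d _; apply: eq_bigr => k _; rewrite mulrA.
have L : e a (B b c) = \sum_d \sum_k H c d * (e a (B b k) * G k d).
  rewrite exchange_big /=; transitivity (\sum_k e a (B b k) * (1%:M : 'M[S]_n) c k).
    rewrite (bigD1 c)//= big1 ?addr0; first by rewrite mxE eqxx mulr1.
    by move=> k kc; rewrite mxE eq_sym (negbTE kc) mulr0.
  apply: eq_bigr => k _; rewrite -HG mxE mulr_sumr; apply: eq_bigr => d _; rewrite [G k d]Gs; ring.
pose S1 := \sum_d \sum_k hf * (H c d * B a k * T k b d + H c d * B b k * T a k d
  - B k c * H k d * T a b d).
pose S2 := hf * (\sum_d \sum_k H c d * (B d k * T a b k) - \sum_d \sum_k H c k * B k d * T a b d).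
transitivity (S1 + S2 + hf * 2 * \sum_d \sum_k H c d * (e a (B b k) * G k d)).
  have -> : S2 = \sum_d \sum_k hf * (H c d * (B d k * T a b k) - H c k * B k d * T a b d).
    rewrite /S2 -sumrB mulr_sumr; apply: eq_bigr => d _.
    by rewrite -sumrB mulr_sumr.
  have -> : hf * 2 * \sum_d \sum_k H c d * (e a (B b k) * G k d) =
     \sum_d \sum_k hf * 2 * (H c d * (e a (B b k) * G k d)).
    by rewrite mulr_sumr; apply: eq_bigr => d _; rewrite mulr_sumr.
  rewrite /S1 mulr_sumr -!big_split /=; apply: eq_bigr => d _.
  rewrite -!big_split /= mulNr mulr_suml mulr_sumr -sumrN -big_split mulr_sumr /=.
  apply: eq_bigr => k _; ring.
rewrite /S2 C subrr mulr0 addr0 -L [hf * 2]mulrC hf2 mul1r; congr (_ + _).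
rewrite /S1 exchange_big /=; apply: eq_bigr => d _; rewrite !mulr_sumr -big_split -sumrB /=.
by apply: eq_bigr => k _; ring.
Qed.

Local Notation Km := (fun a => \matrix_(b, c) K c a b).

Let Ksym c a b : K c a b = K c b a.
Proof.
rewrite /christ; congr (_ * _); apply: eq_bigr => d _; rewrite [G b a]Gs; ring.
Qed.

(* [curv c b] is the curvature matrix [R_cb] of the connection matrices [Km]. *)
Let curv c b : 'M[S]_n := map_mx (e c) (Km b) - map_mx (e b) (Km c)
  + (Km b *m Km c - Km c *m Km b).

Let ricE a b : ricc e K a b = \sum_c curv c b a c.
Proof.
rewrite /ricc -big_split /=; apply: eq_bigr => c _.
rewrite !mxE [K c b a]Ksym [K c c a]Ksym; congr (_ + _).
rewrite sumrB; congr (_ - _); apply: eq_bigr => d _; rewrite !mxE; first by rewrite mulrC Ksym.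
by rewrite mulrC [K d c a]Ksym.
Qed.

Let DKm a i j : map_mx D (Km a) i j ===
  (\sum_d B a d *: Km d + (B *m Km a - Km a *m B) + map_mx (e a) B) i j.
Proof.
rewrite !mxE summxE; apply: (eqm_trans hJ) (eqm_DK _ _ _) _; apply: eqm_eq => //.
congr (_ + _); rewrite sumrB big_split /= -addrA; congr (_ + (_ - _));
  by apply: eq_bigr => d _; rewrite !mxE // mulrC.
Qed.

Let map_mxD (d : S -> S) (hd : derivation d) p q (A A' : 'M[S]_(p, q)) :
  map_mx d (A + A') = map_mx d A + map_mx d A'.
Proof. by apply/matrixP => i j; rewrite !mxE derivD. Qed.

Let map_mxN (d : S -> S) (hd : derivation d) p q (A : 'M[S]_(p, q)) :
  map_mx d (- A) = - map_mx d A.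
Proof. by apply/matrixP => i j; rewrite !mxE derivN. Qed.

Let DeKm c b : map_mx D (map_mx (e c) (Km b)) =
  map_mx (e c) (map_mx D (Km b)) + \sum_k B c k *: map_mx (e k) (Km b).
Proof.
apply/matrixP => i j; rewrite !mxE DeC summxE; congr (_ + _).
by apply: eq_bigr => k _; rewrite !mxE.
Qed.

Let LK a := \sum_d B a d *: Km d + (B *m Km a - Km a *m B) + map_mx (e a) B.

Let eLK c b : map_mx (e c) (LK b) = \sum_d e c (B b d) *: Km d + \sum_d B b d *: map_mx (e c) (Km d)
  + (map_mx (e c) B *m Km b + B *m map_mx (e c) (Km b) -
     (map_mx (e c) (Km b) *m B + Km b *m map_mx (e c) B)) + map_mx (e c) (map_mx (e b) B).
Proof.
rewrite /LK !map_mxD// map_mxN// !deriv_mulmx//; congr (_ + _ + _).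
apply/matrixP => i j; rewrite !mxE !summxE (deriv_sum (he c)) -big_split /=.
by apply: eq_bigr => d _; rewrite !mxE derivM.
Qed.

(** The second derivatives of X in the variation of the connection drop out: their antisymmetrised
    derivative vanishes because the [e a] commute, and their commutators with the connection cancel
    those produced by differentiating the tensorial terms. *)
Let Dcurv c b i j : D (curv c b i j) ===
  (\sum_k B c k *: curv k b + \sum_k B b k *: curv c k + (B *m curv c b - curv c b *m B)) i j.
Proof.
have -> : D (curv c b i j) = map_mx D (curv c b) i j by rewrite [RHS]mxE.
rewrite /curv !map_mxD// !map_mxN// !deriv_mulmx// !DeKm.
have me (m : 'I_n) (M M' : 'M[S]_n) : (forall i j, M i j === M' i j) ->
    forall i j, map_mx (e m) M i j === map_mx (e m) M' i j.
  by move=> MM i' j'; rewrite !mxE; exact: (eqm_deriv (he m) (Je m)).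
apply: (eqm_trans hJ (y := (map_mx (e c) (LK b) + \sum_k B c k *: map_mx (e k) (Km b)
  - (map_mx (e b) (LK c) + \sum_k B b k *: map_mx (e k) (Km c))
  + (LK b *m Km c + Km b *m LK c - (LK c *m Km b + Km c *m LK b))) i j)).
  have mD (M M' N N' : 'M[S]_n) : (forall i j, M i j === M' i j) -> (forall i j, N i j === N' i j) ->
      forall i j, (M + N) i j === (M' + N') i j.
    by move=> MM NN i' j'; rewrite !mxE; apply: eqmD.
  have mN (M M' : 'M[S]_n) : (forall i j, M i j === M' i j) ->
      forall i j, (- M) i j === (- M') i j.
    by move=> MM i' j'; rewrite !mxE; apply: eqmN.
  have mr (M : 'M[S]_n) i' j' : M i' j' === M i' j' by exact: eqm_refl.
  exact: (mD _ _ _ _ (mD _ _ _ _ (mD _ _ _ _ (me c _ _ (DKm b)) (mr _))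
      (mN _ _ (mD _ _ _ _ (me b _ _ (DKm c)) (mr _))))
    (mD _ _ _ _ (mD _ _ _ _ (eqmmx (DKm b) (mr _)) (eqmmx (mr _) (DKm c)))
      (mN _ _ (mD _ _ _ _ (eqmmx (DKm c) (mr _)) (eqmmx (mr _) (DKm b))))) i j).
apply: eqm_eq => //; congr (fun_of_matrix _ i j).
have E1 : \sum_d e c (B b d) *: Km d = \sum_d e b (B c d) *: Km d.
  by apply: eq_bigr => d _; rewrite eB.
have E2 : map_mx (e c) (map_mx (e b) B) = map_mx (e b) (map_mx (e c) B).
  by apply/matrixP => k l; rewrite !mxE eC.
have S1 : \sum_k B c k *: curv k b = \sum_k B c k *: map_mx (e k) (Km b)
   - \sum_k B c k *: map_mx (e b) (Km k) + (Km b *m (\sum_k B c k *: Km k) - (\sum_k B c k *: Km k) *m Km b).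
  rewrite mulmx_sumr mulmx_suml -!sumrB -big_split; apply: eq_bigr => k _ /=.
  by rewrite -scalemxAl -scalemxAr /curv !scalerDr !scalerN.
have S2 : \sum_k B b k *: curv c k = \sum_k B b k *: map_mx (e c) (Km k)
   - \sum_k B b k *: map_mx (e k) (Km c) + ((\sum_k B b k *: Km k) *m Km c - Km c *m (\sum_k B b k *: Km k)).
  rewrite mulmx_sumr mulmx_suml -!sumrB -big_split; apply: eq_bigr => k _ /=.
  by rewrite -scalemxAl -scalemxAr /curv !scalerDr !scalerN.
rewrite S1 S2 !eLK E1 E2 {S1 S2 E1 E2} /LK /curv.
have ecB : map_mx (e c) B = map_mx (e c) B by [].
set sc := \sum_k B c k *: Km k; set sb := \sum_k B b k *: Km k.
set t1 := \sum_k _ *: map_mx (e _) (Km b); set t2 := \sum_k _ *: map_mx (e _) (Km c).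
set t3 := \sum_k B c k *: map_mx (e b) (Km k); set t4 := \sum_k B b k *: map_mx (e c) (Km k).
set t5 := \sum_d e b (B c d) *: Km d.
move: (map_mx (e c) B) (map_mx (e b) B) (map_mx (e b) (map_mx _ B)) (map_mx (e c) (Km b)) (map_mx (e b) (Km c)) (Km b) (Km c).
clear.
move: sc sb t1 t2 t3 t4 t5 => sc sb t1 t2 t3 t4 t5 cB bB cbB ec eb kb kc.
(* Once everything is distributed, each matrix product is treated as an opaque symbol and the
   identity is linear in these symbols. *)
rewrite !(mulmxDl, mulmxDr, mulNmx, mulmxN, mulmxA).
apply/matrixP => i j.
repeat match goal with |- context[@mulmx ?a ?b ?c ?d ?M ?N] => move: (@mulmx a b c d M N) => ? end.
rewrite !mxE; ring.
Qed.

Lemma eqm_Dricc a b : D (ricc e K a b) === lie (ricc e K) a b.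
Proof.
rewrite ricE (deriv_sum hD).
apply: (eqm_trans hJ) (eqm_sum hJ _ (fun c => Dcurv c b a c)) _; apply: eqm_eq => //.
have addE (M N : 'M[S]_n) i j : (M + N) i j = M i j + N i j by rewrite mxE.
under eq_bigr do rewrite !addE; rewrite !big_split /=.
have X1 : \sum_c (\sum_k B c k *: curv k b) a c = \sum_c \sum_k B c k * curv k b a c.
  by apply: eq_bigr => c _; rewrite summxE; apply: eq_bigr => k _; rewrite [LHS]mxE.
have X2 : \sum_c (\sum_k B b k *: curv c k) a c = \sum_k \sum_c B b k * curv c k a c.
  rewrite exchange_big; apply: eq_bigr => c _; rewrite summxE; apply: eq_bigr => k _.
  by rewrite [LHS]mxE.
have X3 : \sum_c (B *m curv c b) a c = \sum_k \sum_c B a k * curv c b k c.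
  by rewrite exchange_big; apply: eq_bigr => c _; rewrite [LHS]mxE.
have X4 : \sum_c (- (curv c b *m B)) a c = - \sum_c \sum_k B c k * curv k b a c.
  rewrite exchange_big -sumrN; apply: eq_bigr => c _; rewrite [LHS]mxE [X in - X]mxE.
  by congr (- _); apply: eq_bigr => k _; rewrite mulrC.
rewrite X1 X2 X3 X4 /lie; under [RHS]eq_bigr do rewrite !ricE !mulr_sumr.
by rewrite big_split /=; ring.
Qed.

Section Scalar.
Variables (f w : S).
Hypothesis Df : eqm J (D f) w.

Let Deb b : D (e b f) === e b w + \sum_c B b c * e c f.
Proof. by rewrite DeC; apply: eqmD => //; [exact: (eqm_deriv (he b) (Je b))|exact: eqm_refl]. Qed.

(** The second derivatives of X coming from the Christoffel symbols cancel those produced by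
    commuting [D] past two derivatives of [f]. *)
Lemma eqm_Dhess a b : D (hess e K f a b) === lie (hess e K f) a b + hess e K w a b.
Proof.
rewrite /hess (derivB hD) DeC (deriv_sum hD).
have X c : D (K c a b * e c f) ===
   (\sum_d (B a d * K c d b + B b d * K c a d - B d c * K d a b) + e a (B b c)) * e c f
   + K c a b * (e c w + \sum_d B c d * e d f).
  rewrite (derivM hD).
  exact: (eqmD hJ (eqmM hJ (eqm_DK _ _ _) (eqm_refl hJ _)) (eqmM hJ (eqm_refl hJ _) (Deb _))).
apply: (eqm_trans hJ) (eqmD hJ (eqmD hJ (eqm_deriv (he a) (Je a) (Deb b)) (eqm_refl hJ _))
  (eqmN hJ (eqm_sum hJ _ X))) _.
apply: eqm_eq => //; rewrite (derivD (he a)) (deriv_sum (he a)).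
have Y1 : \sum_c e a (B b c * e c f) = \sum_c e a (B b c) * e c f + \sum_c B b c * e a (e c f).
  by rewrite -big_split; apply: eq_bigr => c _; rewrite (derivM (he a)).
rewrite {}Y1.
have Y2 : \sum_c ((\sum_d (B a d * K c d b + B b d * K c a d - B d c * K d a b) + e a (B b c)) * e c f
    + K c a b * (e c w + \sum_d B c d * e d f)) =
   \sum_c \sum_d B a c * (K d c b * e d f) + \sum_c \sum_d B b c * (K d a c * e d f)
   + \sum_c e a (B b c) * e c f + \sum_c K c a b * e c w.
  rewrite [X in X + _ + _ + _]exchange_big [X in _ + X + _ + _]exchange_big /=.
  transitivity (\sum_c (\sum_d B a d * (K c d b * e c f) + \sum_d B b d * (K c a d * e c f)
     - \sum_d B d c * K d a b * e c f + e a (B b c) * e c f + K c a b * e c w +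
     \sum_d K c a b * B c d * e d f)).
    apply: eq_bigr => c _; rewrite mulrDr mulrDl sumrB big_split /= !mulrBl !mulrDl.
    rewrite !mulr_suml mulr_sumr -!addrA; congr (_ + (_ + (_ + (_ + (_ + _))))).
    - by apply: eq_bigr => d _; rewrite mulrA.
    - by apply: eq_bigr => d _; rewrite mulrA.
    - by apply: eq_bigr => d _; rewrite mulrA.
  rewrite !big_split /= sumrN [X in _ + X]exchange_big /=.
  have -> : \sum_c \sum_d K d a b * B d c * e c f = \sum_c \sum_d B d c * K d a b * e c f.
    by apply: eq_bigr => c _; apply: eq_bigr => d _; rewrite [K d a b * _]mulrC.
  ring.
rewrite {}Y2 /lie.
have Y3 : \sum_c (B a c * (e c (e b f) - \sum_d K d c b * e d f) +
     B b c * (e a (e c f) - \sum_d K d a c * e d f)) =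
  \sum_c B a c * e c (e b f) - \sum_c \sum_d B a c * (K d c b * e d f) +
  (\sum_c B b c * e a (e c f) - \sum_c \sum_d B b c * (K d a c * e d f)).
  rewrite -!sumrB -big_split; apply: eq_bigr => c _ /=.
  by rewrite !mulrBr !mulr_sumr.
rewrite {}Y3; ring.
Qed.

(** The variation of [H] cancels the Lie terms, so that a trace sees only the inhomogeneous part
    [U']. *)
Lemma eqm_DtrH (U U' : 'I_n -> 'I_n -> S) :
  (forall a b, D (U a b) === lie U a b + U' a b) -> D (trH H U) === trH H U'.
Proof.
move=> DU; rewrite /trH (deriv_sum hD).
have X a : D (\sum_b H a b * U a b) === \sum_b
   ((- \sum_c (H a c * B c b + B c a * H c b)) * U a b + H a b * (lie U a b + U' a b)).
  rewrite (deriv_sum hD); apply: eqm_sum => // b; rewrite (derivM hD).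
  apply: eqmD => //; last by apply: eqmM => //; exact: eqm_refl.
  by apply: eqmM => //; [exact: eqm_DH|exact: eqm_refl].
apply: (eqm_trans hJ) (eqm_sum hJ _ X) _; apply: eqm_eq => //.
transitivity (\sum_a \sum_b H a b * U' a b +
  (\sum_a \sum_b \sum_c H a b * B a c * U c b + \sum_a \sum_b \sum_c H a b * B b c * U a c
   - \sum_a \sum_b \sum_c H a c * B c b * U a b - \sum_a \sum_b \sum_c B c a * H c b * U a b)).
  rewrite -big_split -sumrB -sumrB -big_split /=; apply: eq_bigr => a _.
  rewrite -big_split -sumrB -sumrB -big_split /=; apply: eq_bigr => b _.
  rewrite mulrDr addrA [RHS]addrC; congr (_ + _).
  rewrite /lie mulr_sumr mulNr mulr_suml -sumrN -big_split -big_split -sumrB -sumrB /=.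
  by apply: eq_bigr => c _; ring.
have -> : \sum_a \sum_b \sum_c H a c * B c b * U a b = \sum_a \sum_b \sum_c H a b * B b c * U a c.
  by apply: eq_bigr => a _; rewrite exchange_big.
have -> : \sum_a \sum_b \sum_c B c a * H c b * U a b = \sum_a \sum_b \sum_c H a b * B a c * U c b.
  transitivity (\sum_a \sum_c \sum_b B c a * H c b * U a b).
    by apply: eq_bigr => a _; rewrite exchange_big.
  rewrite exchange_big; apply: eq_bigr => a _; rewrite exchange_big; apply: eq_bigr => b _.
  by apply: eq_bigr => c _; rewrite [B a c * _]mulrC.
ring.
Qed.

Lemma eqm_Dgsq : D (gsq e H f f) === 2 * gsq e H f w.
Proof.
have -> : gsq e H f f = trH H (fun a b => e a f * e b f).
  by rewrite /gsq /trH; apply: eq_bigr => a _; apply: eq_bigr => b _; rewrite mulrA.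
apply: (eqm_trans hJ) (eqm_DtrH (U' := fun a b => e a w * e b f + e a f * e b w) _) _.
  move=> a b; rewrite (derivM hD).
  apply: (eqm_trans hJ) (eqmD hJ (eqmM hJ (Deb a) (eqm_refl hJ _)) (eqmM hJ (eqm_refl hJ _) (Deb b))) _.
  apply: eqm_eq => //; rewrite /lie big_split /= mulrDl mulrDr mulr_suml mulr_sumr.
  rewrite addrACA addrC; congr (_ + _ + _); apply: eq_bigr => c _; ring.
apply: eqm_eq => //; rewrite /trH /gsq mulr_sumr.
transitivity (\sum_a \sum_b H a b * e a w * e b f + \sum_a \sum_b H a b * e a f * e b w).
  rewrite -big_split; apply: eq_bigr => a _; rewrite -big_split; apply: eq_bigr => b _ /=; ring.
have -> : \sum_a \sum_b H a b * e a w * e b f = \sum_a \sum_b H a b * e a f * e b w.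
  rewrite exchange_big; apply: eq_bigr => a _; apply: eq_bigr => b _; rewrite [H b a]Hs; ring.
by rewrite -big_split; apply: eq_bigr => a _ /=; rewrite mulr_sumr -big_split; apply: eq_bigr => b _ /=; ring.
Qed.

End Scalar.

End Naturality.
End DifferentialRing.

(** * Variation of metric, potential and volume along the flow *)

Section Evolution.
Context {S : comNzRingType} {n : nat}.
Variables (hf lam s om f V : S) (e : 'I_n -> S -> S) (dt du : S -> S).
Variables (G H : 'M[S]_n) (X : 'I_n -> S).
Hypotheses (hf2 : 2 * hf = 1) (he : forall a, derivation (e a)).
Hypotheses (hdt : derivation dt) (hdu : derivation du).
Hypothesis eC : forall a b x, e a (e b x) = e b (e a x).
Hypothesis dteC : forall a x, dt (e a x) = e a (dt x).
Hypothesis dueC : forall a x, du (e a x) = e a (du x).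
Hypothesis dudtC : forall x, du (dt x) = dt (du x).
Hypotheses (Gsym : G^T = G) (Hsym : H^T = H) (HG : H *m G = 1%:M) (GH : G *m H = 1%:M).
Variables (J : S -> Prop) (hJ : is_ideal J).
Hypothesis Je : forall a x, J x -> J (e a x).
Hypothesis Jdt : forall x, J x -> J (dt x).
Hypotheses (dulam : du lam = 0) (dtlam : dt lam = 0) (elam : forall a, e a lam = 0).
Hypotheses (dus : du s = - lam) (dts : dt s = 0) (es : forall a, e a s = 0).
Hypothesis duom : du om = 0.

Notation "x === y" := (eqm J x y) (at level 70).
Local Notation K := (christ hf e G H).

Definition Pdr (a b : 'I_n) : S := ricc e K a b + hess e K f a b - lam * G a b.
Definition Fdr : S := trH H (hess e K f) - gsq e H f f + 2 * lam * f - n%:R * lam.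
Definition Qdr : S := trH H Pdr - Fdr.

Definition Bdr : 'M[S]_n := \matrix_(a, c) e a (X c).
Definition Ddr (x : S) : S := dt x - \sum_c X c * e c x.

Hypothesis hE1 : forall a b, s * du (G a b) === 2 * Pdr a b.
Hypothesis hE2 : 2 * s * du f === Qdr.
Hypothesis hX : forall c, du (X c) === \sum_b H c b * e b om.
Hypothesis hDG : forall a b, Ddr (G a b) === (Bdr *m G + G *m Bdr^T) a b.
Hypothesis hDf : Ddr f === s * om.

Local Notation D := Ddr.
Local Notation B := Bdr.
Let Y c := \sum_b H c b * e b om.

Let Gs a b : G a b = G b a. Proof. by rewrite -{1}Gsym mxE. Qed.
Let Hs a b : H a b = H b a. Proof. by rewrite -{1}Hsym mxE. Qed.

Let hD : derivation D.
Proof.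
split=> x y; rewrite /Ddr ?(derivD hdt) ?(derivM hdt).
  rewrite addrACA -opprD -big_split; congr (_ - _); apply: eq_bigr => c _ /=.
  by rewrite (derivD (he c)) mulrDr.
have -> : \sum_c X c * e c (x * y) = (\sum_c X c * e c x) * y + x * \sum_c X c * e c y.
  rewrite mulr_suml mulr_sumr -big_split; apply: eq_bigr => c _ /=.
  rewrite (derivM (he c)); ring.
ring.
Qed.

Let DeC a x : D (e a x) = e a (D x) + \sum_c B a c * e c x.
Proof.
rewrite /Ddr dteC (derivB (he a)) (deriv_sum (he a)) -addrA; congr (_ + _).
rewrite -sumrN -sumrN -big_split; apply: eq_bigr => c _ /=.
rewrite (derivM (he a)) mxE eC; ring.
Qed.

Let eB a b c : e a (B b c) = e b (B a c).
Proof. by rewrite !mxE eC. Qed.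

Let JD x : J x -> J (D x).
Proof.
move=> Jx; apply: idealD => //; first exact: Jdt.
by apply: idealN => //; apply: ideal_sum => // c; apply: idealM => //; exact: Je.
Qed.

Let duD x : du (D x) = D (du x) - \sum_c du (X c) * e c x.
Proof.
rewrite /Ddr (derivB hdu) dudtC (deriv_sum hdu) -addrA; congr (_ + _).
rewrite -opprD -big_split; congr (- _); apply: eq_bigr => c _ /=.
by rewrite (derivM hdu) dueC addrC.
Qed.

Let Ds : D s = 0.
Proof. by rewrite /Ddr dts big1 ?subr0// => c _; rewrite es mulr0. Qed.

Let Dlam : D lam = 0.
Proof. by rewrite /Ddr dtlam big1 ?subr0// => c _; rewrite elam mulr0. Qed.

Let rf x : x === x. Proof. exact: eqm_refl. Qed.

Let DlieG a b : D (G a b) === lie B (fun i j => G i j) a b.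
Proof.
apply: (eqm_trans hJ) (hDG a b) _; apply: eqm_eq => //.
rewrite !mxE -big_split /=; apply: eq_bigr => c _.
by rewrite !mxE [G a c * _]mulrC.
Qed.

Let hess_som a b : hess e K (s * om) a b = s * hess e K om a b.
Proof.
rewrite /hess !(deriv_mulr_cst (he _)) ?es// mulrBr mulr_sumr; congr (_ - _).
by apply: eq_bigr => c _; rewrite (deriv_mulr_cst (he c))// mulrCA.
Qed.

Let DP a b : D (Pdr a b) === lie B Pdr a b + s * hess e K om a b.
Proof.
rewrite /Pdr (derivB hD) (derivD hD) (deriv_mulr_cst hD)//.
have DR := eqm_Dricc hf2 he eC Gsym HG GH hJ Je hD DeC eB hDG a b.
have DH := eqm_Dhess hf2 he Gsym HG GH hJ Je hD DeC eB hDG hDf a b.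
apply: (eqm_trans hJ) (eqmD hJ (eqmD hJ DR DH) (eqmN hJ (eqmM hJ (rf lam) (DlieG a b)))) _.
apply: eqm_eq => //; rewrite hess_som /lie.
transitivity (\sum_c (B a c * ricc e K c b + B b c * ricc e K a c) +
   \sum_c (B a c * hess e K f c b + B b c * hess e K f a c) -
   \sum_c lam * (B a c * G c b + B b c * G a c) + s * hess e K om a b).
  by rewrite -mulr_sumr; ring.
by congr (_ + _); rewrite -big_split -sumrB; apply: eq_bigr => c _ /=; ring.
Qed.

(** Twice the Hessian of [om] is the Lie derivative of the metric along the gradient [Y]. This
    matches the inhomogeneous part of [DP] with the u-derivative of the Lie term of the metric. *)
Let hess_omE a b : 2 * hess e K om a b =
  \sum_c (Y c * e c (G a b) + e a (Y c) * G c b + e b (Y c) * G a c).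
Proof.
have E a' b' : \sum_c e a' (Y c) * G c b' = e a' (e b' om) - \sum_c Y c * e a' (G c b').
  have -> : e b' om = \sum_c Y c * G c b'.
    transitivity (\sum_d (1%:M : 'M[S]_n) b' d * e d om).
      rewrite (bigD1 b')//= mxE eqxx mul1r big1 ?addr0// => d db.
      by rewrite mxE eq_sym (negbTE db) mul0r.
    rewrite -GH; under eq_bigr do rewrite mxE mulr_suml.
    rewrite exchange_big; apply: eq_bigr => c _ /=; rewrite mulr_suml.
    by apply: eq_bigr => d _; rewrite [G b' c]Gs; ring.
  rewrite (deriv_sum (he a')) -sumrB; apply: eq_bigr => c _.
  rewrite (derivM (he a')); ring.
have E2 : \sum_c K c a b * e c om = hf * \sum_d Y d * (e a (G b d) + e b (G a d) - e d (G a b)).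
  rewrite mulr_sumr; under eq_bigr do rewrite /christ mulr_sumr mulr_suml.
  rewrite exchange_big; apply: eq_bigr => d _ /=; rewrite /Y mulr_suml mulr_sumr.
  by apply: eq_bigr => c _; rewrite [H c d]Hs; ring.
rewrite !big_split /= E; under [X in _ + X]eq_bigr do rewrite [G a _]Gs.
rewrite E /hess E2 mulrBr mulrA hf2 mul1r [e b (e a om)]eC.
have -> : \sum_d Y d * (e a (G b d) + e b (G a d) - e d (G a b)) =
  \sum_c Y c * e a (G c b) + \sum_c Y c * e b (G c a) - \sum_c Y c * e c (G a b).
  rewrite -big_split -sumrB; apply: eq_bigr => c _ /=.
  by rewrite [G b c]Gs [G a c]Gs; ring.
ring.
Qed.

(** The inductive step on the order of jets: if the defects of metric and potential lie in [J], so
    does [s] times the u-derivative of the first. With [s] invertible and the defect zero at u = 0,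
    one order is gained. *)
Lemma evolution_metric a b : J (s * du (D (G a b) - (B *m G + G *m B^T) a b)).
Proof.
have -> : (B *m G + G *m B^T) a b = lie B (fun i j => G i j) a b.
  rewrite !mxE -big_split /=; apply: eq_bigr => c _.
  by rewrite !mxE [G a c * _]mulrC.
rewrite (derivB hdu) mulrBr -/(eqm J _ _).
apply: (eqm_trans hJ (y := 2 * (lie B Pdr a b + s * hess e K om a b) - s * \sum_c Y c * e c (G a b))).
  rewrite duD mulrBr; apply: eqmD => //.
    have -> : s * D (du (G a b)) = D (s * du (G a b)) by rewrite (derivM hD) Ds mul0r add0r.
    apply: (eqm_trans hJ) (eqm_deriv hD JD (hE1 a b)) _.
    rewrite (deriv_mulr_cst hD) ?(deriv_natr hD)//.
    exact: eqmM (rf _) (DP a b).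
  by apply: eqmN => //; apply: eqmM => //; apply: eqm_sum => // c; apply: eqmM => //; exact: hX.
apply: (eqm_trans hJ (y := \sum_c (s * e a (Y c) * G c b + B a c * (2 * Pdr c b)
   + (s * e b (Y c) * G a c + B b c * (2 * Pdr a c))))); last first.
  apply: eqm_sym => //; rewrite /lie (deriv_sum hdu) mulr_sumr; apply: eqm_sum => // c.
  rewrite (derivD hdu) !(derivM hdu) [s * (_ + _)]mulrDr [s * (_ * _ + _)]mulrDr.
  rewrite [s * (du (B b c) * _ + _)]mulrDr.
  have Z a' b' c' d' : s * (du (B a' c') * G b' d') === s * e a' (Y c') * G b' d'.
    rewrite mulrA; apply: eqmM => //; apply: eqmM => //; rewrite mxE dueC.
    exact: (eqm_deriv (he a') (Je a')) (hX c').
  have Z2 a' b' c' d' : s * (B a' c' * du (G b' d')) === B a' c' * (2 * Pdr b' d').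
    by rewrite mulrCA; apply: eqmM => //; exact: hE1.
  exact: (eqmD hJ (eqmD hJ (Z _ _ _ _) (Z2 _ _ _ _)) (eqmD hJ (Z _ _ _ _) (Z2 _ _ _ _))).
apply: eqm_eq => //; rewrite mulrDr mulrCA hess_omE /lie !mulr_sumr -big_split -sumrB.
by apply: eq_bigr => c _ /=; ring.
Qed.

Lemma evolution_potential : J (s * du (D f - s * om)).
Proof.
have J2 x : J (2 * x) -> J x.
  by move=> /(idealM hJ hf); rewrite mulrA [hf * 2]mulrC hf2 mul1r.
apply: J2; rewrite mulrA (derivB hdu) mulrBr -/(eqm J _ _).
have DtrP : D (trH H Pdr) === trH H (fun a b => s * hess e K om a b).
  exact: (eqm_DtrH HG GH hJ hD hDG DP).
have Dlap : D (trH H (hess e K f)) === trH H (fun a b => s * hess e K om a b).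
  apply: (eqm_DtrH HG GH hJ hD hDG) => a b; rewrite -hess_som.
  exact: (eqm_Dhess hf2 he Gsym HG GH hJ Je hD DeC eB hDG hDf a b).
have Dg : D (gsq e H f f) === 2 * gsq e H f (s * om).
  exact: (eqm_Dgsq he Hsym HG GH hJ Je hD DeC hDG hDf).
have DQ : D Qdr === 2 * gsq e H f (s * om) - 2 * lam * (s * om).
  rewrite /Qdr /Fdr (derivB hD) (derivB hD) (derivD hD) (derivB hD).
  rewrite [D (n%:R * lam)](deriv_mulr_cst hD) ?(deriv_natr hD)// Dlam mulr0 subr0.
  have -> : D (2 * lam * f) = 2 * lam * D f.
    by rewrite (deriv_mulr_cst hD)// (deriv_mulr_cst hD) ?(deriv_natr hD)// Dlam mulr0.
  apply: (eqm_trans hJ) (eqmD hJ DtrP (eqmN hJ (eqmD hJ (eqmD hJ Dlap (eqmN hJ Dg)) (eqmM hJ (rf _) hDf)))) _.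
  by apply: eqm_eq => //; ring.
have gs : gsq e H f (s * om) = s * \sum_c Y c * e c f.
  rewrite /gsq mulr_sumr; apply: eq_bigr => a _; rewrite /Y mulr_suml mulr_sumr.
  apply: eq_bigr => b _; rewrite (deriv_mulr_cst (he b))//; ring.
rewrite (derivM hdu) dus duom mulr0 addr0.
apply: (eqm_trans hJ (y := D Qdr - 2 * s * \sum_c Y c * e c f)).
  rewrite duD mulrBr; apply: eqmD => //.
    have -> : 2 * s * D (du f) = D (2 * s * du f).
      by rewrite (deriv_mulr_cst hD)// (deriv_mulr_cst hD) ?(deriv_natr hD)// Ds mulr0.
    exact: eqm_deriv.
  by apply: eqmN => //; apply: eqmM => //; apply: eqm_sum => // c; apply: eqmM => //; exact: hX.
apply: (eqm_trans hJ) (eqmD hJ DQ (rf _)) _; apply: eqm_eq => //; rewrite gs; ring.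
Qed.

Hypothesis dtV : dt V = V * (hf * \sum_a \sum_b H a b * dt (G a b) - dt f).
Hypothesis eV : forall c, e c V = V * (hf * \sum_a \sum_b H a b * e c (G a b) - e c f).

(** Under [D] the logarithm of [V] varies by half the trace of the metric variation, which is the
    trace of [B], minus the variation of [f]. Adding back the transport term X^c e_c V completes the
    first part to a divergence. *)
Lemma evolution_volume : dt V === \sum_a e a (V * X a) - s * om * V.
Proof.
have DV : D V = V * (hf * \sum_a \sum_b H a b * D (G a b) - D f).
  rewrite /Ddr dtV.
  have -> : \sum_c X c * e c V = V * (hf * \sum_a \sum_b H a b * (\sum_c X c * e c (G a b))
     - \sum_c X c * e c f).
    have -> : \sum_a \sum_b H a b * (\sum_c X c * e c (G a b)) =
       \sum_c X c * \sum_a \sum_b H a b * e c (G a b).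
      rewrite exchange_big /=; under [RHS]eq_bigr do rewrite mulr_sumr.
      rewrite [RHS]exchange_big [LHS]exchange_big /=; apply: eq_bigr => a _.
      under [RHS]eq_bigr do rewrite mulr_sumr.
      rewrite [RHS]exchange_big /=; apply: eq_bigr => b _; rewrite mulr_sumr.
      by apply: eq_bigr => c _; ring.
    rewrite mulr_sumr -sumrB mulr_sumr; apply: eq_bigr => c _; rewrite eV; ring.
  have -> : \sum_a \sum_b H a b * (dt (G a b) - \sum_c X c * e c (G a b)) =
    \sum_a \sum_b H a b * dt (G a b) - \sum_a \sum_b H a b * (\sum_c X c * e c (G a b)).
    rewrite -sumrB; apply: eq_bigr => a _; rewrite -sumrB; apply: eq_bigr => b _; ring.
  ring.
have DV2 : D V === V * (\sum_a B a a - s * om).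
  rewrite DV; apply: eqmM => //; apply: eqmD => //; last exact: eqmN.
  have Z : \sum_a \sum_b H a b * D (G a b) === \sum_a \sum_b H a b * lie B (fun i j => G i j) a b.
    by apply: eqm_sum => // a; apply: eqm_sum => // b; apply: eqmM => //; exact: DlieG.
  apply: (eqm_trans hJ) (eqmM hJ (rf hf) Z) _; apply: eqm_eq => //.
  have -> : \sum_a \sum_b H a b * lie B (fun i j => G i j) a b = 2 * \sum_a B a a.
    transitivity (\sum_a \sum_c B a c * (G *m H) c a + \sum_b \sum_c B b c * (G *m H) c b).
      have -> : \sum_a \sum_b H a b * lie B (fun i j => G i j) a b =
        \sum_a \sum_b \sum_c B a c * (G c b * H b a) + \sum_a \sum_b \sum_c B b c * (G c a * H a b).
        rewrite -big_split; apply: eq_bigr => a _; rewrite -big_split; apply: eq_bigr => b _ /=.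
        rewrite /lie mulr_sumr -big_split; apply: eq_bigr => c _ /=.
        by rewrite [H b a]Hs [G c a]Gs; ring.
      congr (_ + _).
        apply: eq_bigr => a _; rewrite exchange_big; apply: eq_bigr => c _.
        by rewrite [(G *m H) _ _]mxE mulr_sumr.
      rewrite exchange_big; apply: eq_bigr => b _; rewrite exchange_big; apply: eq_bigr => c _.
      by rewrite [(G *m H) _ _]mxE mulr_sumr.
    have idE i j : (1%:M : 'M[S]_n) i j = (i == j)%:R by rewrite mxE.
    have E : \sum_a \sum_c B a c * (G *m H) c a = \sum_a B a a.
      apply: eq_bigr => a _; rewrite GH (bigD1 a)//= idE eqxx mulr1 big1 ?addr0// => c ca.
      by rewrite idE (negbTE ca) mulr0.
    by rewrite E -mulr2n -[LHS]mulr_natl.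
  by rewrite mulrA [hf * 2]mulrC hf2 mul1r.
have -> : dt V = D V + \sum_c X c * e c V by rewrite /Ddr subrK.
apply: (eqm_trans hJ) (eqmD hJ DV2 (rf _)) _; apply: eqm_eq => //.
rewrite mulrBr mulr_sumr addrAC -big_split /=; congr (_ - _); last ring.
by apply: eq_bigr => a _; rewrite mxE (derivM (he a)); ring.
Qed.

End Evolution.

(** * Derivative of a determinant *)

Section Jacobi.
Context {S : comNzRingType} (d : S -> S) (hd : derivation d).

Lemma deriv_prod (I : eqType) (r : seq I) (F : I -> S) : uniq r ->
  d (\prod_(i <- r) F i) = \sum_(i <- r) d (F i) * \prod_(k <- r | k != i) F k.
Proof.
elim: r => [|i r IH] /=; first by rewrite !big_nil deriv1.
case/andP=> ir ur; rewrite !big_cons derivM// eqxx IH// mulr_sumr.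
have E k : k \in r -> (k != i) by move=> kr; apply: contraNneq ir => <-.
congr (_ * _ + _).
  by rewrite big_seq_cond [RHS]big_seq_cond; apply: eq_bigl => k; case: (boolP (k \in r)) => // /E ->.
apply: eq_big_seq => k kr; rewrite big_cons eq_sym (E k kr).
by rewrite mulrCA.
Qed.

(** Differentiating the Leibniz formula replaces one row at a time by its derivative; each of the
    resulting determinants is expanded along that row. *)
Lemma deriv_det n (A : 'M[S]_n) :
  d (\det A) = \sum_i \sum_j d (A i j) * cofactor A i j.
Proof.
pose A' i := \matrix_(k, l) (if k == i then d (A k l) else A k l).
transitivity (\sum_i \det (A' i)).
  rewrite /determinant (deriv_sum hd) exchange_big; apply: eq_bigr => s _ /=.
  rewrite (deriv_mulr_cst hd) ?deriv_prod ?index_enum_uniq// ?mulr_sumr; last first.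
    by case: (perm.odd_perm s); rewrite ?expr1 ?expr0 ?derivN// deriv1// oppr0.
  apply: eq_bigr => i _; congr (_ * _); rewrite [RHS](bigD1 i)//= mxE eqxx; congr (_ * _).
  by apply: eq_bigr => k /negbTE ki; rewrite mxE ki.
apply: eq_bigr => i _; rewrite (expand_det_row _ i); apply: eq_bigr => j _.
rewrite mxE eqxx; congr (_ * _); rewrite /cofactor; congr (_ * \det _).
apply/matrixP => k l; rewrite !mxE ifN//.
by apply/eqP => /eqP; rewrite eq_sym (negbTE (neq_lift _ _)).
Qed.

Lemma jacobi n (G H : 'M[S]_n) (Dinv : S) : Dinv * \det G = 1 -> H = Dinv *: \adj G ->
  d (\det G) = \det G * \sum_a \sum_b H a b * d (G b a).
Proof.
move=> DG HE; rewrite deriv_det mulr_sumr exchange_big; apply: eq_bigr => a _ /=.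
rewrite mulr_sumr; apply: eq_bigr => b _; rewrite HE !mxE.
by rewrite -[LHS]mul1r -DG; ring.
Qed.

End Jacobi.

(** * The ring of smooth functions and jets along u = 0 *)

Section SmoothRing.
Context {R : realType} {V : normedModType R}.

(** The base point ensures that 1 differs from 0 in the ring of functions built below. *)
Record domain := Domain {
  dset :> V -> Prop; dset_open : open (dset : set V); dpt : V; dptP : dset dpt }.

Variable O : domain.

(* The functions are normalised to vanish outside [O], so that equality is
   equality on [O]; the unit of the ring is the indicator function of [O]. *)
Record smf := Smf {
  smfun :> V -> R;
  smf_smooth : smooth_on O smfun;
  smf_out : forall x, ~ O x -> smfun x = 0 }.

HB.instance Definition _ := gen_eqMixin smf.
HB.instance Definition _ := gen_choiceMixin smf.

Lemma smf_eq (f g : smf) : (forall x, O x -> f x = g x) -> f = g.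
Proof.
case: f g => [f sf of_] [g sg og] /= fg.
have E : f = g.
  apply/funext => x; have [/fg//|nx] := pselect (O x).
  by rewrite of_// og.
by case: _ / E in sg og fg *; congr Smf; exact: Prop_irrelevance.
Qed.

Definition mask (f : V -> R) (x : V) : R := if x \in (O : set V) then f x else 0.

Lemma maskE f x : O x -> mask f x = f x.
Proof. by move=> Ox; rewrite /mask mem_set. Qed.

Let mask_out f x : ~ O x -> mask f x = 0.
Proof. by move=> Ox; rewrite /mask memNset. Qed.

Let mask_smooth f : smooth_on O f -> smooth_on O (mask f).
Proof.
by move=> sf k; apply: (eq_Ck_on (dset_open O)) (sf k) => x /set_mem Ox; rewrite maskE.
Qed.

Definition mksmf f (sf : smooth_on O f) : smf := Smf (mask_smooth sf) (@mask_out f).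

Lemma mksmfE f sf x : O x -> @mksmf f sf x = f x.
Proof. exact: maskE. Qed.

Let cst_smooth (c : R) : smooth_on O (fun _ : V => c).
Proof. by move=> k; exact: Ck_on_cst. Qed.
Let add_smooth (f g : smf) : smooth_on O (fun x => f x + g x).
Proof. by move=> k; apply: Ck_onD; [exact: dset_open|exact: smf_smooth..]. Qed.
Let opp_smooth (f : smf) : smooth_on O (fun x => - f x).
Proof. by move=> k; apply: Ck_onN; [exact: dset_open|exact: smf_smooth]. Qed.
Let mul_smooth (f g : smf) : smooth_on O (fun x => f x * g x).
Proof. by move=> k; apply: Ck_onM; [exact: dset_open|exact: smf_smooth..]. Qed.

Definition smf_cst (c : R) : smf := mksmf (cst_smooth c).
Definition smf_add (f g : smf) : smf := mksmf (add_smooth f g).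
Definition smf_opp (f : smf) : smf := mksmf (opp_smooth f).
Definition smf_mul (f g : smf) : smf := mksmf (mul_smooth f g).

Let smf_addA : associative smf_add.
Proof. by move=> f g h; apply: smf_eq => x Ox; rewrite !(mksmfE _ Ox) addrA. Qed.
Let smf_addC : commutative smf_add.
Proof. by move=> f g; apply: smf_eq => x Ox; rewrite !(mksmfE _ Ox) addrC. Qed.
Let smf_add0 : left_id (smf_cst 0) smf_add.
Proof. by move=> f; apply: smf_eq => x Ox; rewrite !(mksmfE _ Ox) add0r. Qed.
Let smf_addN : left_inverse (smf_cst 0) smf_opp smf_add.
Proof. by move=> f; apply: smf_eq => x Ox; rewrite !(mksmfE _ Ox) addNr. Qed.

HB.instance Definition _ := GRing.isZmodule.Build smf smf_addA smf_addC smf_add0 smf_addN.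

Let smf_mulA : associative smf_mul.
Proof. by move=> f g h; apply: smf_eq => x Ox; rewrite !(mksmfE _ Ox) mulrA. Qed.
Let smf_mulC : commutative smf_mul.
Proof. by move=> f g; apply: smf_eq => x Ox; rewrite !(mksmfE _ Ox) mulrC. Qed.
Let smf_mul1 : left_id (smf_cst 1) smf_mul.
Proof. by move=> f; apply: smf_eq => x Ox; rewrite !(mksmfE _ Ox) mul1r. Qed.
Let smf_mulDl : left_distributive smf_mul smf_add.
Proof. by move=> f g h; apply: smf_eq => x Ox; rewrite !(mksmfE _ Ox) mulrDl. Qed.
Let smf_1neq0 : smf_cst 1 != 0.
Proof.
apply/eqP => /(congr1 (fun f : smf => f (dpt O))); rewrite !mksmfE; try exact: dptP.
by move/eqP; rewrite oner_eq0.
Qed.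

HB.instance Definition _ :=
  GRing.Zmodule_isComNzRing.Build smf smf_mulA smf_mulC smf_mul1 smf_mulDl smf_1neq0.

Section Evaluation.
Variables (x : V) (Ox : O x).

Lemma ev0 : (0 : smf) x = 0. Proof. exact: mksmfE. Qed.
Lemma ev1 : (1 : smf) x = 1. Proof. exact: mksmfE. Qed.
Lemma evD (f g : smf) : (f + g) x = f x + g x. Proof. exact: mksmfE. Qed.
Lemma evN (f : smf) : (- f) x = - f x. Proof. exact: mksmfE. Qed.
Lemma evB (f g : smf) : (f - g) x = f x - g x. Proof. by rewrite evD evN. Qed.
Lemma evM (f g : smf) : (f * g) x = f x * g x. Proof. exact: mksmfE. Qed.
Lemma ev_cst c : smf_cst c x = c. Proof. exact: mksmfE. Qed.
Lemma ev_sum (I : Type) (r : seq I) (P : pred I) (F : I -> smf) :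
  (\sum_(i <- r | P i) F i) x = \sum_(i <- r | P i) F i x.
Proof. exact: (big_morph (fun f : smf => f x) evD ev0). Qed.
Lemma ev_prod (I : Type) (r : seq I) (P : pred I) (F : I -> smf) :
  (\prod_(i <- r | P i) F i) x = \prod_(i <- r | P i) F i x.
Proof. exact: (big_morph (fun f : smf => f x) evM ev1). Qed.
Lemma ev_natr m : (m%:R : smf) x = m%:R.
Proof. by elim: m => [|m IH]; [rewrite ev0|rewrite -addn1 !natrD evD IH ev1]. Qed.

Lemma ev_det n (A : 'M[smf]_n) : (\det A) x = \det (map_mx (fun f : smf => f x) A).
Proof.
rewrite /determinant ev_sum; apply: eq_bigr => s _; rewrite evM ev_prod; congr (_ * _).
  by case: (perm.odd_perm s); rewrite ?expr1 ?expr0 ?evN ev1.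
by apply: eq_bigr => i _; rewrite mxE.
Qed.

Lemma ev_mulmx n (A B : 'M[smf]_n) :
  map_mx (fun f : smf => f x) (A *m B) =
  map_mx (fun f : smf => f x) A *m map_mx (fun f : smf => f x) B.
Proof.
apply/matrixP => i j; rewrite !mxE ev_sum; apply: eq_bigr => k _.
by rewrite !mxE evM.
Qed.

Lemma ev_id n : map_mx (fun f : smf => f x) 1%:M = 1%:M :> 'M[R]_n.
Proof. by apply/matrixP => i j; rewrite !mxE ev_natr. Qed.

End Evaluation.

Let deriv_smooth (w : V) (f : smf) : smooth_on O ('D_w f).
Proof. by move=> k; have [_ /(_ w) []] := smf_smooth f k.+1. Qed.

Lemma smf_derivable (f : smf) x w : O x -> derivable f x w.
Proof. by move=> Ox; have [_ /(_ w) [d _]] := smf_smooth f 1; exact: d. Qed.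

Lemma smf_continuous (f : smf) x : O x -> {for x, continuous f}.
Proof. by have [c _] := smf_smooth f 0; exact: c. Qed.

Definition dd (w : V) (f : smf) : smf := mksmf (deriv_smooth w f).

Lemma near_dom x : O x -> \forall y \near x, O y.
Proof. by move=> Ox; apply: open_nbhs_nbhs; split=> //; exact: dset_open. Qed.

Lemma ddE w (f : smf) x : O x -> dd w f x = 'D_w f x.
Proof. exact: mksmfE. Qed.

Lemma dd_eq w (f : smf) (g : V -> R) x : O x -> (forall y, O y -> f y = g y) ->
  dd w f x = 'D_w g x.
Proof.
move=> Ox fg; rewrite ddE//; apply: near_eq_derive; apply: filterS (near_dom Ox) => y Oy.
exact: fg.
Qed.

Lemma dd_derivation w : derivation (dd w).
Proof.
split=> f g; apply: smf_eq => x Ox.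
  rewrite evD// (dd_eq w (g := f \+ g) Ox); last by move=> y Oy; rewrite evD.
  by rewrite deriveD ?ddE//; exact: smf_derivable.
rewrite evD// !evM// (dd_eq w (g := f \* g) Ox); last by move=> y Oy; rewrite evM.
rewrite deriveM ?ddE//; try exact: smf_derivable.
by rewrite /GRing.scale /= addrC mulrC.
Qed.

Lemma dd_cst w c : dd w (smf_cst c) = 0.
Proof.
apply: smf_eq => x Ox; rewrite ev0// (dd_eq w (g := cst c) Ox) ?derive_cst// => y Oy.
by rewrite ev_cst.
Qed.

Lemma ddC w z (f : smf) : dd w (dd z f) = dd z (dd w f).
Proof.
apply: smf_eq => x Ox.
apply: etrans (dd_eq w (f := dd z f) (g := 'D_z f) Ox (fun y Oy => ddE z f Oy)) _.
apply: etrans _ (esym (dd_eq z (f := dd w f) (g := 'D_w f) Ox (fun y Oy => ddE w f Oy))).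
by apply: (schwarz _ _ (dset_open O) Ox); exact: smf_smooth.
Qed.

Let inv_smooth (f : smf) : (forall x, O x -> f x != 0) -> smooth_on O (fun x => (f x)^-1).
Proof. by move=> f0 k; apply: Ck_onV => //; [exact: dset_open|exact: smf_smooth]. Qed.
Definition smf_inv (f : smf) (f0 : forall x, O x -> f x != 0) : smf := mksmf (inv_smooth f0).
Lemma smf_mulV f f0 : @smf_inv f f0 * f = 1.
Proof. by apply: smf_eq => x Ox; rewrite evM// mksmfE// ev1// mulVf// f0. Qed.

Let exp_smooth (f : smf) : smooth_on O (fun x => expR (f x)).
Proof. by move=> k; apply: Ck_on_exp; [exact: dset_open|exact: smf_smooth]. Qed.
Definition smf_exp f : smf := mksmf (exp_smooth f).
Lemma dd_exp w f : dd w (smf_exp f) = smf_exp f * dd w f.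
Proof.
apply: smf_eq => x Ox; rewrite evM// (dd_eq w (g := expR \o f) Ox); last first.
  by move=> y Oy; rewrite mksmfE.
rewrite mksmfE// ddE//.
have D := is_derive_comp1 (is_derive_expR (f x)) (derivableP (smf_derivable Ox)).
by have [_ ->] := D w.
Qed.

Let sqrt_smooth (f : smf) : (forall x, O x -> 0 < f x) -> smooth_on O (fun x => Num.sqrt (f x)).
Proof. by move=> f0 k; apply: Ck_on_sqrt => //; [exact: dset_open|exact: smf_smooth]. Qed.
Definition smf_sqrt (f : smf) (f0 : forall x, O x -> 0 < f x) : smf := mksmf (sqrt_smooth f0).
Lemma smf_sqrtK f f0 : @smf_sqrt f f0 * @smf_sqrt f f0 = f.
Proof.
apply: smf_eq => x Ox; rewrite evM// mksmfE// -expr2 sqr_sqrtr//.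
by rewrite ltW// f0.
Qed.

Lemma smf_half : 2 * smf_cst 2^-1 = 1.
Proof.
by apply: smf_eq => x Ox; rewrite evM// ev_natr// ev_cst// ev1// divff// pnatr_eq0.
Qed.

End SmoothRing.

Section Jets.
Context {R : realType} {V : normedModType R} (O : domain (V := V)).
(* [u] is a linear coordinate and [wu] the corresponding direction; [Jn N] is the
   ideal of functions whose [u]-jet of order [N] vanishes along [u = 0]. *)
Variables (u : V -> R) (wu : V).

Fixpoint Jn (N : nat) (f : smf O) : Prop :=
  (forall z, O z -> u z = 0 -> f z = 0) /\
  match N with 0 => True | N'.+1 => Jn N' (dd wu f) end.

Lemma Jn_S N f : Jn N.+1 f -> Jn N f.
Proof. by elim: N f => [|N IH] f [f0 J]; split=> //; apply: IH. Qed.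

Lemma Jn_le N N' f : (N <= N')%N -> Jn N' f -> Jn N f.
Proof. by move=> /subnK <-; elim: (N' - N)%N => // m IH /Jn_S. Qed.

Lemma Jn_ideal N : is_ideal (Jn N).
Proof.
elim: N => [|N [J0 JD JM]].
  split; first by split=> // z Oz _; rewrite ev0.
    by move=> f g [f0 _] [g0 _]; split=> // z Oz uz; rewrite evD// f0// g0// addr0.
  by move=> f g [g0 _]; split=> // z Oz uz; rewrite evM// g0// mulr0.
have hd := dd_derivation O wu.
split.
- by split; [move=> z Oz _; rewrite ev0|rewrite (deriv0 hd)].
- move=> f g [f0 f1] [g0 g1]; split; last by rewrite (derivD hd); exact: JD.
  by move=> z Oz uz; rewrite evD// f0// g0// addr0.
- move=> f g Jg; have [g0 g1] := Jg; split.
    by move=> z Oz uz; rewrite evM// g0// mulr0.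
  rewrite (derivM hd); apply: JD; [exact/JM/Jn_S|exact: JM].
Qed.

(** A direction tangent to u = 0 preserves vanishing on that set, and the derivative along it
    commutes with the one along [wu]. *)
Lemma Jn_deriv (w : V) : (forall (h : R) z, u z = 0 -> u (h *: w + z) = 0) ->
  forall N f, Jn N f -> Jn N (dd w f).
Proof.
move=> uw; have H (f : smf O) : (forall z, O z -> u z = 0 -> f z = 0) ->
   (forall z, O z -> u z = 0 -> dd w f z = 0).
  move=> f0 z Oz uz; rewrite ddE// /derive; apply/cvg_lim => //.
  have c : (fun h : R => h *: w + z) @ 0 --> z.
    rewrite -[X in _ --> X]add0r -(scale0r w); apply: cvgD; last exact: cvg_cst.
    by apply: cvgZr_tmp; exact: cvg_id.
  apply: cvg_near_cst; near=> h.
  have Oh : O (h *: w + z) by near: h; exact: nbhs_dnbhs (c _ (near_dom Oz)).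
  by rewrite /= f0 ?uw// f0// subrr scaler0.
elim=> [|N IH] f; first by case=> f0 _; split=> //; exact: H.
by case=> f0 f1; split; [exact: H|rewrite ddC; exact: IH].
Unshelve. all: by end_near.
Qed.

Lemma Jn_iter N f : Jn N f <->
  (forall j, (j <= N)%N -> forall z, O z -> u z = 0 -> iter j (dd wu) f z = 0).
Proof.
elim: N f => [|N IH] f; split.
- by case=> f0 _ [|//] _; exact: f0.
- by move=> f0; split=> //; exact: (f0 0%N).
- case=> f0 /IH f1 [|j] jN; first exact: f0.
  by rewrite iterSr; exact: f1.
- move=> f0; split; first exact: (f0 0%N).
  by apply/IH => j jN z Oz uz; rewrite -iterSr; exact: f0.
Qed.

End Jets.

(** * The ambient equations as a flow *)

Section AmbientBlocks.
Context {n : nat}.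

Definition iv : 'I_(1 + n + 1) := lshift 1 (lshift n ord0).
Definition ix (a : 'I_n) : 'I_(1 + n + 1) := lshift 1 (rshift 1 a).
Definition iu : 'I_(1 + n + 1) := rshift (1 + n) ord0.

Lemma big_ambient {T : nmodType} (F : 'I_(1 + n + 1) -> T) :
  \sum_c F c = F iv + \sum_a F (ix a) + F iu.
Proof. by rewrite big_split_ord big_split_ord !big_ord1. Qed.

Lemma ambient_ind (P : 'I_(1 + n + 1) -> Prop) :
  P iv -> (forall a, P (ix a)) -> P iu -> forall c, P c.
Proof.
move=> Pv Px Pu c; case: (split_ordP c) => [d ->|d ->]; last by rewrite (ord1 d).
case: (split_ordP d) => [k ->|k ->]; last exact: Px.
by rewrite (ord1 k).
Qed.

Definition amb_mx {S : pzSemiRingType} (G : 'M[S]_n) : 'M[S]_(1 + n + 1) :=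
  block_mx (block_mx 0 0 0 G) (col_mx 1%:M 0) (row_mx 1%:M 0) 0.

Context {S : comNzRingType}.
Implicit Types G : 'M[S]_n.

Lemma amb_vv G : amb_mx G iv iv = 0.
Proof. by rewrite block_mxEul block_mxEul mxE. Qed.
Lemma amb_vx G a : amb_mx G iv (ix a) = 0.
Proof. by rewrite block_mxEul block_mxEur mxE. Qed.
Lemma amb_xv G a : amb_mx G (ix a) iv = 0.
Proof. by rewrite block_mxEul block_mxEdl mxE. Qed.
Lemma amb_xx G a b : amb_mx G (ix a) (ix b) = G a b.
Proof. by rewrite block_mxEul block_mxEdr. Qed.
Lemma amb_vu G : amb_mx G iv iu = 1.
Proof. by rewrite block_mxEur col_mxEu mxE eqxx. Qed.
Lemma amb_uv G : amb_mx G iu iv = 1.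
Proof. by rewrite block_mxEdl row_mxEl mxE eqxx. Qed.
Lemma amb_xu G a : amb_mx G (ix a) iu = 0.
Proof. by rewrite block_mxEur col_mxEd mxE. Qed.
Lemma amb_ux G a : amb_mx G iu (ix a) = 0.
Proof. by rewrite block_mxEdl row_mxEr mxE. Qed.
Lemma amb_uu G : amb_mx G iu iu = 0.
Proof. by rewrite block_mxEdr mxE. Qed.
Definition ambE := (amb_vv, amb_vx, amb_xv, amb_xx, amb_vu, amb_uv, amb_xu, amb_ux, amb_uu).

(** The (v, u) block is its own inverse, so inversion acts on the middle block only. *)
Lemma amb_mxK G H : G *m H = 1%:M -> amb_mx G *m amb_mx H = 1%:M.
Proof.
move=> /matrixP GH; apply/matrixP => c d; rewrite [LHS]mxE [RHS]mxE big_ambient.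
have xE (a b : 'I_n) : (ix a == ix b) = (a == b) by rewrite !eq_lshift eq_rshift.
have vx (a : 'I_n) : (iv == ix a) = false by rewrite eq_lshift eq_lrshift.
have vu : (iv == iu) = false by rewrite eq_lrshift.
have xu (a : 'I_n) : (ix a == iu) = false by rewrite eq_lrshift.
elim/ambient_ind: c => [|a|]; elim/ambient_ind: d => [|b|]; rewrite ?ambE;
  rewrite ?xE ?eqxx ?vx ?vu ?xu 1?[ix _ == iv]eq_sym 1?[iu == _]eq_sym ?vx ?vu ?xu;
  under eq_bigr do rewrite ?ambE ?mul0r ?mulr0;
  rewrite ?big1_eq ?(mul0r, mulr0, mul1r, mulr1, add0r, addr0)//.
by have := GH a b; rewrite !mxE.
Qed.

Variables (hf lam vv uu f : S) (e' : 'I_(1 + n + 1) -> S -> S).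
Hypotheses (hf2 : 2 * hf = 1) (he : forall a, derivation (e' a)).
Hypothesis eC : forall a b x, e' a (e' b x) = e' b (e' a x).
Variables (G H : 'M[S]_n).
Hypotheses (Gsym : G^T = G) (HG : H *m G = 1%:M) (GH : G *m H = 1%:M).
Hypotheses (evG : forall a b, e' iv (G a b) = 0) (evf : e' iv f = 0).
Hypotheses (evv : e' iv vv = 1) (exv : forall a, e' (ix a) vv = 0) (euv : e' iu vv = 0).
Hypotheses (evu : e' iv uu = 0) (exu : forall a, e' (ix a) uu = 0) (euu : e' iu uu = 1).
Hypotheses (elam : forall c, e' c lam = 0).

Local Notation e := (fun a => e' (ix a)).
Local Notation du := (e' iu).
Local Notation K' := (christ hf e' (amb_mx G) (amb_mx H)).
Local Notation K := (christ hf e G H).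
Local Notation s := (1 - lam * uu).
Definition amb_pot : S := f - vv + lam * uu * vv.

Let e0 c : e' c 0 = 0. Proof. exact: deriv0. Qed.
Let e1 c : e' c 1 = 0. Proof. exact: deriv1. Qed.
Let Gs a b : G a b = G b a. Proof. by rewrite -{1}Gsym mxE. Qed.

Let evA c d : e' iv (amb_mx G c d) = 0.
Proof.
by elim/ambient_ind: c => [|a|]; elim/ambient_ind: d => [|b|]; rewrite !ambE ?e0 ?e1.
Qed.

Let exA c d : e' c (amb_mx G d iv) = 0.
Proof. by elim/ambient_ind: d => [|a|]; rewrite !ambE ?e0 ?e1. Qed.

Let exA' c d : e' c (amb_mx G d iu) = 0.
Proof. by elim/ambient_ind: d => [|a|]; rewrite !ambE ?e0 ?e1. Qed.

Let Asym c d : amb_mx G c d = amb_mx G d c.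
Proof. by elim/ambient_ind: c => [|a|]; elim/ambient_ind: d => [|b|]; rewrite !ambE. Qed.

(** The field d/dv is null and parallel. Symbols with upper index u vanish because raising to u uses
    the constant row v of the metric; those with a lower index v vanish as well, the metric being
    independent of v. *)
Let K'u a b : K' iu a b = 0.
Proof.
rewrite /christ big_ambient !ambE big1 => [|d _]; last by rewrite ambE mul0r.
by rewrite mul1r mul0r !addr0 !exA evA; ring.
Qed.

Let K'v a b : K' iv a b = - hf * du (amb_mx G a b).
Proof.
rewrite /christ big_ambient !ambE big1 => [|d _]; last by rewrite ambE mul0r.
by rewrite mul1r mul0r !exA'; ring.
Qed.

Let K'x k a b : K' (ix k) a b = hf * \sum_d H k d *
  (e' a (amb_mx G b (ix d)) + e' b (amb_mx G a (ix d)) - e d (amb_mx G a b)).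
Proof.
rewrite /christ big_ambient !ambE !mul0r add0r addr0; congr (_ * _).
by apply: eq_bigr => d _; rewrite ambE.
Qed.

Let K'v_ k a : K' k iv a = 0.
Proof.
elim/ambient_ind: k => [|k|].
- by rewrite K'v Asym exA mulr0.
- rewrite K'x big1 ?mulr0// => d _; rewrite evA !ambE e0 [amb_mx G iv a]Asym exA; ring.
- exact: K'u.
Qed.

Let K'_v k a : K' k a iv = 0.
Proof.
elim/ambient_ind: k => [|k|].
- by rewrite K'v exA mulr0.
- rewrite K'x big1 ?mulr0// => d _; rewrite evA !ambE e0 exA; ring.
- exact: K'u.
Qed.

Let K'xxx k a b : K' (ix k) (ix a) (ix b) = K k a b.
Proof. by rewrite K'x; congr (_ * _); apply: eq_bigr => d _; rewrite !ambE. Qed.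

Let K'uv a b : K' iv (ix a) (ix b) = - hf * du (G a b).
Proof. by rewrite K'v ambE. Qed.

(** The u-derivatives of the metric occur in symbols with upper index v or a lower index u. In these
    components each of them either meets a vanishing symbol or is differentiated in v. *)
Lemma ricc_ambient a b : ricc e' K' (ix a) (ix b) = ricc e K a b.
Proof.
rewrite /ricc; congr (_ + _).
  rewrite big_ambient !K'u K'_v K'uv !e0.
  rewrite (derivM (he iv)) (derivN (he iv)) (deriv_half (he iv) hf2) oppr0 mul0r eC evG e0 mulr0.
  rewrite !(subrr, addr0, add0r, subr0); apply: eq_bigr => c _.
  by rewrite !K'xxx.
rewrite big_ambient [X in X + _ + _]big1 ?add0r; last first.
  move=> d _; rewrite K'v_ mul0r sub0r K'_v; ring.
rewrite [X in _ + X]big1 ?addr0; last by move=> d _; rewrite !K'u; ring.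
apply: eq_bigr => c _; rewrite big_ambient K'_v mul0r K'_v mul0r subr0 add0r.
rewrite !K'u !mulr0 subr0 addr0; apply: eq_bigr => d _.
by rewrite !K'xxx.
Qed.

Let exf a : e a amb_pot = e a f.
Proof.
rewrite /amb_pot (derivD (he _)) (derivB (he _)) (derivM (he _)) (derivM (he _)).
by rewrite elam exv exu; ring.
Qed.

Let ev_pot : e' iv amb_pot = - s.
Proof.
rewrite /amb_pot (derivD (he _)) (derivB (he _)) (derivM (he _)) (derivM (he _)).
by rewrite elam evv evu evf; ring.
Qed.

Let eu_pot : du amb_pot = du f + lam * vv.
Proof.
rewrite /amb_pot (derivD (he _)) (derivB (he _)) (derivM (he _)) (derivM (he _)).
by rewrite elam euv euu; ring.
Qed.

(** The source of the flow: the symbol with upper index v is minus half the u-derivative of the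
    metric, and it is paired with the v-derivative of the potential, which is minus [s]. *)
Lemma hess_ambient a b :
  hess e' K' amb_pot (ix a) (ix b) = hess e K f a b - hf * s * du (G a b).
Proof.
rewrite /hess big_ambient K'uv K'u ev_pot !exf.
under eq_bigr do rewrite K'xxx exf.
ring.
Qed.

Let hess_vu : hess e' K' amb_pot iv iu = lam.
Proof.
rewrite /hess big1 ?subr0 => [|c _]; last by rewrite K'v_ mul0r.
rewrite eu_pot (derivD (he _)) (derivM (he _)) eC evf e0 elam evv; ring.
Qed.

Let hess_uv : hess e' K' amb_pot iu iv = lam.
Proof.
rewrite /hess big1 ?subr0 => [|c _]; last by rewrite K'_v mul0r.
by rewrite -eC; have := hess_vu; rewrite /hess big1 ?subr0 => [|c _]; last by rewrite K'v_ mul0r.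
Qed.

Let trH_ambient T : trH (amb_mx H) T =
  T iv iu + T iu iv + trH H (fun a b => T (ix a) (ix b)).
Proof.
have rv : \sum_b amb_mx H iv b * T iv b = T iv iu.
  rewrite big_ambient !ambE big1 => [|d _]; last by rewrite ambE mul0r.
  by rewrite mul0r mul1r !add0r.
have ru : \sum_b amb_mx H iu b * T iu b = T iu iv.
  rewrite big_ambient !ambE big1 => [|d _]; last by rewrite ambE mul0r.
  by rewrite mul0r mul1r !addr0.
have rx a : \sum_b amb_mx H (ix a) b * T (ix a) b = \sum_b H a b * T (ix a) (ix b).
  rewrite big_ambient !ambE !mul0r add0r addr0.
  by apply: eq_bigr => b _; rewrite ambE.
rewrite /trH big_ambient rv ru addrAC; congr (_ + _).
by apply: eq_bigr => a _; exact: rx.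
Qed.

Lemma Pdr_ambient a b : Pdr hf lam amb_pot e' (amb_mx G) (amb_mx H) (ix a) (ix b) =
  Pdr hf lam f e G H a b - hf * s * du (G a b).
Proof. by rewrite /Pdr ricc_ambient hess_ambient ambE; ring. Qed.

(** The terms in [vv] cancel between the gradient and the potential, and the two mixed Hessian
    entries, each equal to [lam], make up for the dimension n + 2 in place of n. *)
Lemma Fdr_ambient : Fdr hf lam amb_pot e' (amb_mx G) (amb_mx H) =
  Fdr hf lam f e G H + 2 * s * du f - hf * s * trH H (fun a b => du (G a b)).
Proof.
have gE : gsq e' (amb_mx H) amb_pot amb_pot = 2 * - s * (du f + lam * vv) + gsq e H f f.
  have -> : gsq e' (amb_mx H) amb_pot amb_pot = trH (amb_mx H) (fun a b => e' a amb_pot * e' b amb_pot).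
    by rewrite /gsq /trH; apply: eq_bigr => a _; apply: eq_bigr => b _; rewrite mulrA.
  rewrite trH_ambient ev_pot eu_pot; congr (_ + _); first ring.
  rewrite /gsq /trH; apply: eq_bigr => a _; apply: eq_bigr => b _.
  by rewrite !exf mulrA.
rewrite /Fdr gE trH_ambient hess_vu hess_uv.
have -> : trH H (fun a b => hess e' K' amb_pot (ix a) (ix b)) =
   trH H (hess e K f) - hf * s * trH H (fun a b => du (G a b)).
  rewrite /trH mulr_sumr -sumrB; apply: eq_bigr => a _.
  rewrite mulr_sumr -sumrB; apply: eq_bigr => b _; rewrite hess_ambient; ring.
rewrite !natrD /amb_pot; ring.
Qed.

(** Exact, with the ambient tensor kept as an error term; its flatness along u = 0 enters later. *)
Lemma metric_flow a b : s * du (G a b) = 2 * Pdr hf lam f e G H a b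
  - 2 * Pdr hf lam amb_pot e' (amb_mx G) (amb_mx H) (ix a) (ix b).
Proof.
transitivity (2 * hf * (s * du (G a b))); first by rewrite hf2 mul1r.
rewrite Pdr_ambient; ring.
Qed.

Lemma potential_flow : 2 * s * du f = Qdr hf lam f e G H
  + Fdr hf lam amb_pot e' (amb_mx G) (amb_mx H)
  - trH H (fun a b => Pdr hf lam amb_pot e' (amb_mx G) (amb_mx H) (ix a) (ix b)).
Proof.
rewrite Fdr_ambient /Qdr.
have -> : trH H (fun a b => Pdr hf lam amb_pot e' (amb_mx G) (amb_mx H) (ix a) (ix b)) =
   trH H (Pdr hf lam f e G H) - hf * s * trH H (fun a b => du (G a b)).
  rewrite /trH mulr_sumr -sumrB; apply: eq_bigr => a _.
  rewrite mulr_sumr -sumrB; apply: eq_bigr => b _; rewrite Pdr_ambient; ring.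
ring.
Qed.

End AmbientBlocks.

(** * Pull-back of smooth functions along affine maps *)

Section Restriction.
Context {R : realType} {V V' : normedModType R}.
Variables (O : domain (V := V)) (O' : domain (V := V')) (A L : V' -> V).
Hypothesis AL : forall (h : R) w x, A (h *: w + x) = h *: L w + A x.
Hypothesis cA : continuous A.
Hypothesis AO : forall x, O' x -> O (A x).

Let res_smooth (f : smf O) : smooth_on O' (f \o A).
Proof. by move=> k; apply: (Ck_on_affine AL cA) (smf_smooth f k) => x; exact: AO. Qed.

(** Serves both for inclusions of domains and for the embeddings of the slices at a fixed time. *)
Definition res (f : smf O) : smf O' := mksmf (res_smooth f).

Lemma resE f x : O' x -> res f x = f (A x). Proof. exact: mksmfE. Qed.
Lemma res0 : res 0 = 0.
Proof. by apply: smf_eq => x Ox; rewrite resE// !ev0//; exact: AO. Qed.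
Lemma res1 : res 1 = 1.
Proof. by apply: smf_eq => x Ox; rewrite resE// !ev1//; exact: AO. Qed.
Lemma resD f g : res (f + g) = res f + res g.
Proof. by apply: smf_eq => x Ox; rewrite evD// !resE// evD//; exact: AO. Qed.
Lemma resN f : res (- f) = - res f.
Proof. by apply: smf_eq => x Ox; rewrite evN// !resE// evN//; exact: AO. Qed.
Lemma resB f g : res (f - g) = res f - res g.
Proof. by rewrite resD resN. Qed.
Lemma resM f g : res (f * g) = res f * res g.
Proof. by apply: smf_eq => x Ox; rewrite evM// !resE// evM//; exact: AO. Qed.
Lemma res_cst c : res (smf_cst O c) = smf_cst O' c.
Proof. by apply: smf_eq => x Ox; rewrite resE// !ev_cst//; exact: AO. Qed.
Lemma res_sum (I : Type) (r : seq I) (P : pred I) (F : I -> smf O) :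
  res (\sum_(i <- r | P i) F i) = \sum_(i <- r | P i) res (F i).
Proof. exact: (big_morph res resD res0). Qed.
Lemma res_natr m : res m%:R = m%:R.
Proof. by elim: m => [|m IH]; rewrite ?res0// -addn1 !natrD resD IH res1. Qed.

Lemma res_mulmx p q r (M : 'M[smf O]_(p, q)) (N : 'M[smf O]_(q, r)) :
  map_mx res (M *m N) = map_mx res M *m map_mx res N.
Proof.
apply/matrixP => i j; rewrite !mxE res_sum; apply: eq_bigr => k _.
by rewrite !mxE resM.
Qed.
Lemma res_id p : map_mx res 1%:M = 1%:M :> 'M[smf O']_p.
Proof. by apply/matrixP => i j; rewrite !mxE res_natr. Qed.

Lemma res_dd w f : dd w (res f) = res (dd (L w) f).
Proof.
apply: smf_eq => x Ox; rewrite resE//.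
apply: etrans (dd_eq w (f := res f) (g := f \o A) Ox (fun y Oy => resE f Oy)) _.
rewrite (derive_affine f (fun h => AL h w x)) ddE//; exact: AO.
Qed.

Section Formulas.
Variables (n : nat) (e : 'I_n -> V') (hf lam f : smf O) (G H : 'M[smf O]_n).
Local Notation E := (fun a => dd (L (e a)) : smf O -> smf O).
Local Notation E' := (fun a => dd (e a) : smf O' -> smf O').

Lemma res_christ c a b : res (christ hf E G H c a b) =
  christ (res hf) E' (map_mx res G) (map_mx res H) c a b.
Proof.
rewrite /christ resM res_sum; congr (_ * _); apply: eq_bigr => d _.
by rewrite resM resB resD !mxE !res_dd.
Qed.

Lemma res_ricc a b : res (ricc E (christ hf E G H) a b) =
  ricc E' (christ (res hf) E' (map_mx res G) (map_mx res H)) a b.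
Proof.
rewrite /ricc resD !res_sum; congr (_ + _); apply: eq_bigr => c _.
  by rewrite resB -!res_christ !res_dd.
rewrite res_sum; apply: eq_bigr => d _.
apply: etrans (resB _ _) _; congr (_ - _);
  by apply: etrans (resM _ _) _; congr (_ * _); exact: res_christ.
Qed.

Lemma res_hess a b : res (hess E (christ hf E G H) f a b) =
  hess E' (christ (res hf) E' (map_mx res G) (map_mx res H)) (res f) a b.
Proof.
rewrite /hess resB res_sum !res_dd; congr (_ - _); apply: eq_bigr => c _.
by rewrite resM res_christ res_dd.
Qed.

Lemma res_Pdr a b : res (Pdr hf lam f E G H a b) =
  Pdr (res hf) (res lam) (res f) E' (map_mx res G) (map_mx res H) a b.
Proof. by rewrite /Pdr resB resD resM res_ricc res_hess mxE. Qed.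

Lemma res_Fdr : res (Fdr hf lam f E G H) =
  Fdr (res hf) (res lam) (res f) E' (map_mx res G) (map_mx res H).
Proof.
rewrite /Fdr resB resD resB !resM !res_natr; congr (_ - _ + _ - _).
  rewrite /trH res_sum; apply: eq_bigr => a _; rewrite res_sum; apply: eq_bigr => b _.
  by rewrite resM res_hess mxE.
rewrite /gsq res_sum; apply: eq_bigr => a _; rewrite res_sum; apply: eq_bigr => b _.
by rewrite !resM !res_dd mxE.
Qed.

Lemma res_Qdr : res (Qdr hf lam f E G H) =
  Qdr (res hf) (res lam) (res f) E' (map_mx res G) (map_mx res H).
Proof.
rewrite /Qdr resB res_Fdr; congr (_ - _).
rewrite /trH res_sum; apply: eq_bigr => a _; rewrite res_sum; apply: eq_bigr => b _.
by rewrite resM res_Pdr mxE.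
Qed.

Lemma res_logder (v : smf O) w : res (v * (hf * \sum_a \sum_b H a b * dd (L w) (G a b) - dd (L w) f)) =
  res v * (res hf * \sum_a \sum_b map_mx res H a b * dd w (map_mx res G a b) - dd w (res f)).
Proof.
rewrite resM resB resM -res_dd res_sum; congr (_ * (_ * _ - _)); apply: eq_bigr => a _.
by rewrite res_sum; apply: eq_bigr => b _; rewrite resM -res_dd !mxE.
Qed.

End Formulas.

Section RestrictJets.
Variables (u : V -> R) (w' : V').

Lemma res_iter k f : iter k (dd w') (res f) = res (iter k (dd (L w')) f).
Proof. by elim: k => //= k ->; rewrite res_dd. Qed.

Lemma Jn_res N f : Jn u (L w') N f -> Jn (u \o A) w' N (res f).
Proof.
move=> /Jn_iter J; apply/Jn_iter => j jN z Oz uz.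
by rewrite res_iter resE// J//; exact: AO.
Qed.

End RestrictJets.

End Restriction.

(** * Congruent metrics and potentials have congruent curvature quantities *)

Section MetricCongruence.
Context {S : comNzRingType} {n : nat} (J : S -> Prop) (hJ : is_ideal J).
Variables (e : 'I_n -> S -> S).
Hypotheses (he : forall a, derivation (e a)) (Je : forall a x, J x -> J (e a x)).
Variables (hf lam f1 f2 : S) (G1 H1 G2 H2 : 'M[S]_n).
Hypotheses (HG1 : H1 *m G1 = 1%:M) (GH2 : G2 *m H2 = 1%:M).
Hypothesis GG : forall a b, eqm J (G1 a b) (G2 a b).
Notation "x === y" := (eqm J x y) (at level 70).
Let rf x : x === x. Proof. exact: eqm_refl. Qed.

(** Because H1 - H2 = H1 (G2 - G1) H2. *)
Lemma eqm_inverse a b : H1 a b === H2 a b.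
Proof.
have -> : H1 a b = H2 a b + (H1 *m (G2 - G1) *m H2) a b.
  have -> : H1 *m (G2 - G1) *m H2 = H1 - H2.
    by rewrite mulmxBr mulmxBl HG1 -mulmxA GH2 mulmx1 mul1mx.
  by rewrite !mxE addrCA subrr addr0.
rewrite /eqm addrAC subrr add0r mxE; apply: ideal_sum => // c.
rewrite mulrC mxE; apply: idealM => //; apply: ideal_sum => // d.
apply: idealM => //; rewrite !mxE.
exact: eqm_sym (GG _ _).
Qed.

Let ed a x y : x === y -> e a x === e a y.
Proof. exact: (eqm_deriv (he a) (Je a)). Qed.

Lemma eqm_christ c a b : christ hf e G1 H1 c a b === christ hf e G2 H2 c a b.
Proof.
apply: eqmM => //; apply: eqm_sum => // d; apply: eqmM => //; first exact: eqm_inverse.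
apply: eqmD => //; last by apply: eqmN => //; exact: ed.
by apply: eqmD => //; exact: ed.
Qed.

Lemma eqm_ricc a b : ricc e (christ hf e G1 H1) a b === ricc e (christ hf e G2 H2) a b.
Proof.
apply: eqmD => //; apply: eqm_sum => // c.
  apply: eqmD => //; last apply: eqmN => //; apply: ed; exact: eqm_christ.
apply: eqm_sum => // d; apply: eqmD => //; last apply: eqmN => //;
  by apply: eqmM => //; exact: eqm_christ.
Qed.

Hypothesis ff : f1 === f2.

Lemma eqm_hess a b : hess e (christ hf e G1 H1) f1 a b === hess e (christ hf e G2 H2) f2 a b.
Proof.
apply: eqmD => //; first by apply: ed; exact: ed.
apply: eqmN => //; apply: eqm_sum => // c; apply: eqmM => //; first exact: eqm_christ.
exact: ed.
Qed.

Lemma eqm_Pdr a b : Pdr hf lam f1 e G1 H1 a b === Pdr hf lam f2 e G2 H2 a b.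
Proof.
apply: eqmD => //; first by apply: eqmD => //; [exact: eqm_ricc|exact: eqm_hess].
by apply: eqmN => //; apply: eqmM.
Qed.

Let eqm_trH (T1 T2 : 'I_n -> 'I_n -> S) :
  (forall a b, T1 a b === T2 a b) -> trH H1 T1 === trH H2 T2.
Proof.
move=> TT; apply: eqm_sum => // a; apply: eqm_sum => // b; apply: eqmM => //.
exact: eqm_inverse.
Qed.

Lemma eqm_Qdr : Qdr hf lam f1 e G1 H1 === Qdr hf lam f2 e G2 H2.
Proof.
apply: eqmD => //; first by apply: eqm_trH => a b; exact: eqm_Pdr.
apply: eqmN => //; apply: eqmD => //; apply: eqmD => //; last exact: eqmM.
apply: eqmD => //; first by apply: eqm_trH => a b; exact: eqm_hess.
apply: eqmN => //; apply: eqm_sum => // a; apply: eqm_sum => // b.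
by apply: eqmM => //; [apply: eqmM => //; [exact: eqm_inverse|exact: ed]|exact: ed].
Qed.

End MetricCongruence.

(** * From O(u^oo) to vanishing jets *)

Section FlatJets.
Context {R : realType} {V : normedModType R} (O : domain (V := V)).
Variables (u : V -> R) (wu : V).
Hypothesis uL : forall (h : R) w x, u (h *: w + x) = h * u w + u x.
Hypothesis uwu : u wu = 1.

Lemma is_derive_smf_line (f : smf O) z w (h : R) : O (h *: w + z) ->
  is_derive h 1 (fun h => f (h *: w + z)) (dd w f (h *: w + z)).
Proof.
by move=> Oh; rewrite ddE//; apply: is_derive_line; exact: smf_derivable.
Qed.

(** A Taylor lower bound: the difference of the two sides vanishes at 0 and, by the induction
    hypothesis for the derivative of [f], has a nonnegative derivative. *)
Let lower (c : R) (j : nat) (f : smf O) z (d : R) :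
  (forall h, 0 <= h <= d -> O (h *: wu + z)) ->
  (forall i, (i < j)%N -> iter i (dd wu) f z = 0) ->
  (forall h, 0 <= h <= d -> c <= iter j (dd wu) f (h *: wu + z)) ->
  forall h, 0 <= h <= d -> c * h ^+ j / j`!%:R <= f (h *: wu + z).
Proof.
elim: j f => [|j IH] f Oh f0 fc h hd.
  by rewrite expr0 mulr1 fact0 divr1; exact: fc.
have F0 : f z = 0 by exact: (f0 0%N).
have IH' := IH (dd wu f) Oh (fun i ij => etrans (esym (congr1 (fun g : smf O => g z) (iterSr i (dd wu) f))) (f0 i.+1 ij)) _.
have {IH'} D h' : 0 <= h' <= d -> c * h' ^+ j / j`!%:R <= dd wu f (h' *: wu + z).
  by apply: IH' => k kd; rewrite -iterSr; exact: fc.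
case/andP: hd => h0 hd; move: h0; rewrite le_eqVlt => /orP[/eqP <-|h0].
  by rewrite scale0r add0r F0 expr0n /= mulr0 mul0r.
pose phi h := f (h *: wu + z) - c * h ^+ j.+1 / j.+1`!%:R.
have dphi k : 0 <= k <= d -> is_derive k 1 phi (dd wu f (k *: wu + z) - c * k ^+ j / j`!%:R).
  move=> kd; apply: is_deriveB; first by apply: is_derive_smf_line; exact: Oh.
  have -> : (fun h : R => c * h ^+ j.+1 / j.+1`!%:R) = (c / j.+1`!%:R) \*o (fun h => h ^+ j.+1).
    by apply/funext => k' /=; rewrite mulrAC.
  apply: DeriveDef; first by apply: derivableM; [exact: derivable_cst|exact: exprn_derivable].
  rewrite deriveMl; last exact: exprn_derivable.
  rewrite exp_derive /GRing.scale /= mulr1 factS natrM invfM.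
  have j1 : j.+1%:R != 0 :> R by rewrite pnatr_eq0.
  have j2 : j`!%:R != 0 :> R by rewrite pnatr_eq0 -lt0n fact_gt0.
  by move: (j.+1%:R : R) j1 (j`!%:R : R) j2 => p p0 q q0; field; rewrite p0 q0.
have hin k : k \in `[0, h] -> 0 <= k <= d.
  by rewrite in_itv /= => /andP[k0 kh]; rewrite k0 (le_trans kh).
have hin' k : k \in `]0, h[ -> 0 <= k <= d.
  by rewrite in_itv /= => /andP[k0 kh]; rewrite ltW//= (le_trans (ltW kh)).
have cphi : {within `[0, h], continuous phi}.
  by apply: derivable_within_continuous => k /hin/dphi [].
have [k /hin' kd E] := MVT h0 (fun k kh => dphi k (hin' k kh)) cphi.
have : 0 <= phi h - phi 0.
  by rewrite E subr0; apply: mulr_ge0; [rewrite subr_ge0 D|exact: ltW].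
rewrite /phi scale0r add0r F0 expr0n /= mulr0 mul0r !subr0.
by rewrite subr_ge0.
Qed.

(** If the first nonzero u-derivative at a point had order j, the function would grow at least like
    a multiple of h^j along [wu], against the bound by h^(j+1). *)
Lemma flat_jets (f : smf O) :
  (forall z N, O z -> u z = 0 -> exists C : R, \forall q \near z, `|f q| <= C * `|u q| ^+ N) ->
  forall N, Jn u wu N f.
Proof.
(* It suffices to exclude a positive derivative; the opposite sign follows from the same statement
   for the negative of [f]. *)
suff H (f' : smf O) z : O z -> u z = 0 ->
  (forall N, exists C : R, \forall q \near z, `|f' q| <= C * `|u q| ^+ N) ->
  forall j, (forall i, (i < j)%N -> iter i (dd wu) f' z = 0) -> iter j (dd wu) f' z <= 0.
  move=> hf N; apply/Jn_iter => j _ z Oz uz.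
  elim/ltn_ind: j => j IH; apply/eqP; rewrite eq_le; apply/andP; split.
    by apply: H => // N'; exact: hf.
  have iN i : iter i (dd wu) (- f) = - iter i (dd wu) f.
    by elim: i => //= i ->; rewrite (derivN (dd_derivation _ _)).
  have := @H (- f) z Oz uz _ j _; rewrite iN evN// oppr_le0; apply.
    move=> N'; have [C fC] := hf z N' Oz uz; exists C.
    near=> q; rewrite evN ?normrN; first by near: q.
    by near: q; exact: near_dom.
  by move=> i ij; rewrite iN evN// IH// oppr0.
move=> Oz uz fO j f0; rewrite leNgt; apply/negP => cj.
set c := iter j (dd wu) f' z in cj.
have c2 : 0 < c / 2 by rewrite divr_gt0.
have [C fC] := fO j.+1.
have : \forall q \near z, [/\ O q, c / 2 <= iter j (dd wu) f' q & `|f' q| <= C * `|u q| ^+ j.+1].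
  have A := (cvgrPdist_le _ _).1 (@smf_continuous _ _ O (iter j (dd wu) f') z Oz) _ c2.
  near=> q; split; [by near: q; exact: near_dom| |by near: q].
  have : `|c - iter j (dd wu) f' q| <= c / 2 by near: q; exact: A.
  by rewrite ler_norml => /andP[_]; lra.
move=> /nbhs_ballP[r /= r0 B].
pose d := r / (`|wu| + 1) / 2.
have w1 : 0 < `|wu| + 1 by rewrite ltr_wpDl.
have d0 : 0 < d by rewrite !divr_gt0.
have Bh h : 0 <= h <= d -> ball z r (h *: wu + z).
  move=> /andP[h0 hd]; rewrite -ball_normE /ball_ /= opprD addrCA subrr addr0 normrN.
  rewrite normrZ ger0_norm//; apply: le_lt_trans (_ : d * (`|wu| + 1) < _).
    by apply: ler_pM => //; rewrite lerDl.
  by rewrite /d mulrAC divfK ?lt0r_neq0// ltr_pdivrMr// ltr_pMr// ltr1n.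
have Oh h : 0 <= h <= d -> O (h *: wu + z) by move=> /Bh /B [].
have fc h : 0 <= h <= d -> c / 2 <= iter j (dd wu) f' (h *: wu + z) by move=> /Bh /B [].
have low := lower Oh f0 fc.
pose K := c / 2 / j`!%:R.
have K0 : 0 < K by rewrite divr_gt0// ltr0n fact_gt0.
have up h : 0 < h <= d -> K <= `|C| * h.
  move=> /andP[h0 hd]; have hd' : 0 <= h <= d by rewrite ltW.
  have [_ _] := B _ (Bh h hd'); rewrite uL uwu uz addr0 mulr1 => fu.
  rewrite -(ler_pM2r (exprn_gt0 j h0)) /K mulrAC.
  apply: le_trans (low h hd') _; apply: le_trans (ler_norm _) _; apply: le_trans fu _.
  rewrite -mulrA -exprS (gtr0_norm h0) ler_wpM2r ?ler_norm// exprn_ge0// ltW//.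
(* Small enough that |C| h < K, contradicting [up]. *)
pose h := Num.min d (K / (`|C| + 1) / 2).
have C1 : 0 < `|C| + 1 by rewrite ltr_wpDl.
have h0 : 0 < h by rewrite lt_min d0 !divr_gt0.
have := up h; rewrite h0 ge_min lexx => /(_ isT); apply/negP; rewrite -ltNge.
apply: le_lt_trans (_ : (`|C| + 1) * (K / (`|C| + 1) / 2) < K).
  apply: ler_pM; [by []|exact: ltW|by rewrite lerDl|by rewrite ge_min lexx orbT].
by rewrite mulrA mulrCA divff ?lt0r_neq0// mulr1 ltr_pdivrMr// ltr_pMr// ltr1n.
Unshelve. all: by end_near.
Qed.

End FlatJets.

Section PosDef.
Context {R : realType}.

(** On the segment from the identity to [A] all matrices are positive definite, so the determinant,
    equal to 1 at the start, has no zero on it. *)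
Lemma posdef_det_gt0 n (A : 'M[R]_n) : A^T = A ->
  (forall w : 'rV[R]_n, w != 0 -> 0 < (w *m A *m w^T) 0 0) -> 0 < \det A.
Proof.
move=> As Apos.
have ww (w : 'rV[R]_n) : w != 0 -> 0 < (w *m w^T) 0 0.
  move=> w0; rewrite mxE; have /rV0Pn [j wj] := w0.
  rewrite (bigD1 j)//= ltr_pwDl//; first by rewrite mxE -expr2 exprn_even_gt0.
  by apply: sumr_ge0 => k _; rewrite mxE -expr2 sqr_ge0.
pose B (t : R) := (1 - t) *: 1%:M + t *: A.
have Bpos t : 0 <= t <= 1 -> forall w : 'rV[R]_n, w != 0 -> 0 < (w *m B t *m w^T) 0 0.
  move=> /andP[t0 t1] w w0; rewrite /B mulmxDr mulmxDl -!scalemxAr mulmx1 -!scalemxAl.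
  rewrite 2!mxE [X in _ + X]mxE.
  move: t0; rewrite le_eqVlt => /orP[/eqP <-|t0].
    by rewrite subr0 mul1r mul0r addr0 ww.
  by rewrite ltr_wpDl ?mulr_gt0 ?Apos// mulr_ge0 ?subr_ge0// ltW// ww.
have Bdet t : 0 <= t <= 1 -> \det (B t) != 0.
  move=> tt; apply/negP => /det0P [w w0 wB]; have := Bpos t tt w w0.
  by rewrite wB mul0mx mxE ltxx.
(* The determinant along the segment, as a polynomial, so that the intermediate value theorem for
   polynomials applies. *)
pose p : {poly R} := \det ((1 - 'X) *: 1%:M + 'X *: map_mx polyC A).
have pE t : p.[t] = \det (B t).
  rewrite /p -horner_evalE -det_map_mx; congr (\det _).
  apply/matrixP => i j; rewrite !mxE /= horner_evalE !hornerE /=.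
  by case: (i == j); rewrite /= ?mulr1n ?mulr0n !hornerE.
have p0 : 0 < p.[0] by rewrite pE /B subr0 scale0r addr0 scale1r det1.
have p1 : p.[1] = \det A by rewrite pE /B subrr scale0r add0r scale1r.
rewrite -p1 ltNge; apply/negP => p1n.
have [|t /andP[t0 t1]] := @poly_ivt R (- p) 0 1 ler01.
  by rewrite !hornerN oppr_le0 oppr_ge0 ltW.
move=> /rootP; rewrite hornerN => /eqP; rewrite oppr_eq0 pE.
by apply/negP; rewrite Bdet// t0.
Qed.

End PosDef.

(** * Taylor polynomials in u and equality of jets *)

Section TaylorPolynomial.
Context {R : realType} {V : normedModType R} (O : domain (V := V)).
Variables (u : V -> R) (wu : V) (us : smf O).
Hypotheses (usE : forall x, O x -> us x = u x) (dus : dd wu us = 1).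

(** Divided powers: differentiation along [wu] shifts the index without a numerical factor. *)
Definition dpow (j : nat) : smf O := us ^+ j * smf_cst O (j`!%:R^-1).

Lemma dpow0 : dpow 0 = 1.
Proof. by rewrite /dpow expr0 mul1r fact0 invr1. Qed.

Lemma dd_dpow j : dd wu (dpow j.+1) = dpow j.
Proof.
have hd := dd_derivation O wu.
have D k : dd wu (us ^+ k.+1) = k.+1%:R * us ^+ k.
  elim: k => [|k IH]; first by rewrite expr1 expr0 dus mulr1.
  rewrite exprS (derivM hd) IH dus mul1r [k.+2%:R]mulrS mulrDl mul1r exprS; ring.
rewrite /dpow (derivM hd) dd_cst mulr0 addr0 D mulrAC mulrC; congr (_ * _).
apply: smf_eq => x Ox; rewrite evM// ev_natr// !ev_cst// factS natrM invfM.
by rewrite mulrA divff ?mul1r// pnatr_eq0.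
Qed.

Lemma Jn_dpow j : Jn u wu 0 (dpow j.+1).
Proof.
split=> // z Oz uz; rewrite evM// exprS evM// usE// uz !mul0r//.
Qed.

Definition taylor (N : nat) (c : nat -> smf O) : smf O := \sum_(j < N.+1) c j * dpow j.

Lemma taylor_at0 N c z : O z -> u z = 0 -> taylor N c z = c 0%N z.
Proof.
move=> Oz uz; have -> : taylor N c = c 0%N + \sum_(j < N) c j.+1 * dpow j.+1.
  by rewrite /taylor big_ord_recl /= dpow0 mulr1.
rewrite evD// ev_sum// big1 ?addr0// => j _.
by rewrite evM//; have [-> //] := Jn_dpow j; rewrite mulr0.
Qed.

Lemma dd_taylor N c : (forall j, dd wu (c j) = 0) ->
  dd wu (taylor N.+1 c) = taylor N (fun j => c j.+1).
Proof.
have hd := dd_derivation O wu => dc.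
rewrite /taylor (deriv_sum hd) big_ord_recl /= dpow0 mulr1 dc add0r.
by apply: eq_bigr => j _; rewrite (deriv_mulr_cst hd) ?dc// dd_dpow.
Qed.

Lemma taylor_jet N c k z : (forall j, dd wu (c j) = 0) -> (k <= N)%N -> O z -> u z = 0 ->
  iter k (dd wu) (taylor N c) z = c k z.
Proof.
move=> dc kN Oz uz; elim: N k c dc kN => [|N IH] [|k] c dc kN //; try exact: taylor_at0.
by rewrite iterSr dd_taylor// IH.
Qed.

End TaylorPolynomial.

Section JetEquality.
Context {R : realType} {V : normedModType R} (O : domain (V := V)).
Variables (u : V -> R) (wu : V).

Lemma eqm_jet N (x y : smf O) : eqm (Jn u wu N) x y ->
  forall j, (j <= N)%N -> forall z, O z -> u z = 0 -> iter j (dd wu) x z = iter j (dd wu) y z.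
Proof.
move=> /Jn_iter xy j jN z Oz uz; apply/eqP; rewrite -subr_eq0; apply/eqP.
have it : iter j (dd wu) (x - y) = iter j (dd wu) x - iter j (dd wu) y.
  by elim: j {jN} => //= j ->; rewrite (derivB (dd_derivation _ _)).
by rewrite -(xy j jN z Oz uz) it evB.
Qed.

Lemma jet_eqm N (x y : smf O) :
  (forall j, (j <= N)%N -> forall z, O z -> u z = 0 -> iter j (dd wu) x z = iter j (dd wu) y z) ->
  eqm (Jn u wu N) x y.
Proof.
move=> xy; apply/Jn_iter => j jN z Oz uz.
have it : iter j (dd wu) (x - y) = iter j (dd wu) x - iter j (dd wu) y.
  by elim: j {jN} => //= j ->; rewrite (derivB (dd_derivation _ _)).
by rewrite it evB// xy// subrr.
Qed.

Lemma dd_linear (h : V -> R) (sh : smooth_on O h) :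
  (forall k w q, h (k *: w + q) = k * h w + h q) ->
  forall w, dd w (mksmf sh) = smf_cst O (h w).
Proof.
move=> hL w; apply: smf_eq => q Dq; rewrite ev_cst//.
apply: etrans (dd_eq w (g := h) Dq (fun y Dy => mksmfE sh Dy)) _.
rewrite /derive; apply/cvg_lim => //; apply: cvg_near_cst; rewrite near_withinE.
by near=> k => k0; rewrite /= hL addrK /GRing.scale /= mulKf.
Unshelve. all: by end_near.
Qed.

Lemma dd_invariant (h : V -> R) (sh : smooth_on O h) (w : V) :
  (forall p k, h (k *: w + p) = h p) -> dd w (mksmf sh) = 0.
Proof.
move=> hc; apply: smf_eq => p Op; rewrite ev0//.
apply: etrans (dd_eq w (g := h) Op (fun y Oy => mksmfE sh Oy)) _.
rewrite /derive; apply/cvg_lim => //; apply: cvg_near_cst; near=> k.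
by rewrite /= hc subrr scaler0.
Unshelve. all: by end_near.
Qed.

Lemma iter_ddC w k (x : smf O) : dd w (iter k (dd wu) x) = iter k (dd wu) (dd w x).
Proof. by elim: k => //= k <-; rewrite ddC. Qed.

Lemma iter_ddM_cst k (c x : smf O) : dd wu c = 0 ->
  iter k (dd wu) (c * x) = c * iter k (dd wu) x.
Proof. by move=> dc; elim: k => //= k ->; rewrite (deriv_mulr_cst (dd_derivation _ _)). Qed.

Lemma iter_ddD k (x y : smf O) :
  iter k (dd wu) (x + y) = iter k (dd wu) x + iter k (dd wu) y.
Proof. by elim: k => //= k ->; rewrite (derivD (dd_derivation _ _)). Qed.

Lemma iter_ddN k (x : smf O) : iter k (dd wu) (- x) = - iter k (dd wu) x.
Proof. by elim: k => //= k ->; rewrite (derivN (dd_derivation _ _)). Qed.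

Lemma iter_dd_sum k (I : Type) (r : seq I) (F : I -> smf O) :
  iter k (dd wu) (\sum_(i <- r) F i) = \sum_(i <- r) iter k (dd wu) (F i).
Proof. by elim: k => //= k ->; rewrite (deriv_sum (dd_derivation _ _)). Qed.

(** In the Leibniz rule only two terms survive, [s] being of degree one along [wu]. The second one
    is the origin of the coefficient of index k - 1; for [k = 0] its factor vanishes, so the
    predecessor does no harm. *)
Lemma iter_dd_affine k (s c x : smf O) : dd wu s = - c -> dd wu c = 0 ->
  iter k (dd wu) (s * x) = s * iter k (dd wu) x - k%:R * c * iter k.-1 (dd wu) x.
Proof.
have hd := dd_derivation O wu => ds dc.
elim: k => [|[|k] IH]; first by rewrite /= !mul0r subr0.
  by rewrite /= (derivM hd) ds; ring.
rewrite iterS IH (derivB hd) (derivM hd s) ds.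
have dk : dd wu (k.+1%:R * c) = 0.
  by rewrite (deriv_mulr_cst hd) ?(deriv_natr hd)// dc mulr0.
rewrite (deriv_mulr_cst hd _ dk).
by rewrite /= -!iterS [k.+2%:R]mulrS; ring.
Qed.

End JetEquality.

Section VolumeCongruence.
Context {R : realType} {V : normedModType R} (O : domain (V := V)).
Variables (u : V -> R) (wu : V).
Variables (n : nat) (hf f1 f2 V1 V2 : smf O) (G1 G2 H1 H2 : 'M[smf O]_n).
Local Notation du := (dd wu : smf O -> smf O).
Local Notation J := (Jn u wu).
Hypotheses (HG1 : H1 *m G1 = 1%:M) (GH2 : G2 *m H2 = 1%:M).
Hypothesis dV1 : du V1 = V1 * (hf * \sum_a \sum_b H1 a b * du (G1 a b) - du f1).
Hypothesis dV2 : du V2 = V2 * (hf * \sum_a \sum_b H2 a b * du (G2 a b) - du f2).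

Lemma eqm_Jn_du N (x y : smf O) : eqm (J N.+1) x y -> eqm (J N) (du x) (du y).
Proof. by rewrite /eqm -(derivB (dd_derivation O wu)) => -[]. Qed.

Lemma eqm_Jn_S N (x y : smf O) : eqm (J 0) x y -> eqm (J N) (du x) (du y) -> eqm (J N.+1) x y.
Proof. by rewrite /eqm -(derivB (dd_derivation O wu)) => -[x0 _] xy; split. Qed.

(** The equations [dV1] and [dV2] are linear in the volume and of first order in u, so agreement at
    u = 0 propagates from each order to the next. *)
Lemma eqm_volume N : (forall a b, eqm (J N) (G1 a b) (G2 a b)) -> eqm (J N) f1 f2 ->
  eqm (J 0) V1 V2 -> eqm (J N) V1 V2.
Proof.
elim: N => [//|N IH] GG ff V0.
have GG' a b := eqm_Jn_du (GG a b).
have low (x y : smf O) : eqm (J N.+1) x y -> eqm (J N) x y by exact: Jn_S.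
have V12 := IH (fun a b => low _ _ (GG a b)) (low _ _ ff) V0.
have hJ := Jn_ideal O u wu N.
apply: eqm_Jn_S => //; rewrite dV1 dV2; apply: eqmM => //.
apply: eqmD => //; last by apply: eqmN => //; exact: eqm_Jn_du.
apply: eqmM => //; first exact: eqm_refl.
apply: eqm_sum => // a; apply: eqm_sum => // b; apply: eqmM => //.
by apply: (eqm_inverse hJ HG1 GH2) => c d; exact: low.
Qed.

End VolumeCongruence.

(** * The coordinate formulas as values of those in the ring *)

Section Bridge.
Context {R : realType} {m : nat} (O : domain (V := 'rV[R]_m)).
Variables (G : 'rV[R]_m -> 'M[R]_m) (f : 'rV[R]_m -> R) (lambda : R).
Variables (Gs Hs : 'M[smf O]_m) (fs : smf O).
Hypothesis GE : forall x, O x -> forall a b, G x a b = Gs a b x.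
Hypothesis fE : forall x, O x -> f x = fs x.
Hypothesis GH : Gs *m Hs = 1%:M.

Local Notation e := (fun a : 'I_m => dd 'e_a : smf O -> smf O).
Local Notation hf := (smf_cst O 2^-1).
Local Notation K := (christ hf e Gs Hs).

Let partialE (h : 'rV[R]_m -> R) (hs : smf O) a x : O x -> (forall y, O y -> h y = hs y) ->
  partial a h x = dd 'e_a hs x.
Proof. by move=> Ox hE; rewrite /partial; apply/esym/dd_eq => // y Oy; rewrite hE. Qed.

Let invE x : O x -> forall a b, invmx (G x) a b = Hs a b x.
Proof.
move=> Ox; have Gx : G x = map_mx (fun h : smf O => h x) Gs.
  by apply/matrixP => a b; rewrite mxE GE.
have H1 : G x *m map_mx (fun h : smf O => h x) Hs = 1%:M.
  by rewrite Gx -ev_mulmx// GH ev_id.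
have [Gu _] := mulmx1_unit H1.
have -> : invmx (G x) = map_mx (fun h : smf O => h x) Hs.
  by rewrite -[LHS]mulmx1 -H1 mulmxA mulVmx// mul1mx.
by move=> a b; rewrite mxE.
Qed.

Lemma christoffelE x c a b : O x -> christoffel G c a b x = K c a b x.
Proof.
move=> Ox; rewrite /christoffel /christ evM// ev_cst// ev_sum//; congr (_ * _).
apply: eq_bigr => d _; rewrite evM// evB// evD// invE//; congr (_ * (_ + _ - _)).
- by apply: partialE => // y Oy; exact: GE.
- by apply: partialE => // y Oy; exact: GE.
- by apply: partialE => // y Oy; exact: GE.
Qed.

Lemma ricciE x a b : O x -> ricci G x a b = ricc e K a b x.
Proof.
move=> Ox; rewrite mxE /ricc evD// !ev_sum//; congr (_ + _); apply: eq_bigr => c _.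
  rewrite evB//; congr (_ - _); apply: partialE => // y Oy; exact: christoffelE.
rewrite ev_sum//; apply: eq_bigr => d _; rewrite evB// !christoffelE//.
by congr (_ - _); exact: esym (evM Ox _ _).
Qed.

Lemma hessianE x a b : O x -> hessian G f x a b = hess e K fs a b x.
Proof.
move=> Ox; rewrite mxE /hess evB// ev_sum//; congr (_ - _).
  by apply: partialE => // y Oy; apply: partialE.
apply: eq_bigr => c _; rewrite evM// christoffelE//; congr (_ * _).
exact: partialE.
Qed.

Lemma PtensorE x a b : O x -> Ptensor lambda G f x a b =
  Pdr hf (smf_cst O lambda) fs e Gs Hs a b x.
Proof.
move=> Ox; rewrite /Ptensor /Pdr evB// evD// evM// ev_cst//.
by rewrite -ricciE// -hessianE// -GE// !mxE.
Qed.

Lemma FscalarE x : O x -> Fscalar lambda G f x =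
  Fdr hf (smf_cst O lambda) fs e Gs Hs x.
Proof.
move=> Ox; rewrite /Fscalar /Fdr evB// evD// evB// !evM// !ev_natr// !ev_cst// fE//.
congr (_ - _ + _ - _).
  rewrite /laplacian /trH ev_sum//; apply: eq_bigr => a _; rewrite ev_sum//.
  by apply: eq_bigr => b _; rewrite evM// hessianE// invE.
rewrite /grad_sqnorm /gsq ev_sum//; apply: eq_bigr => a _; rewrite ev_sum//.
apply: eq_bigr => b _; rewrite !evM// invE//; congr (_ * _ * _); exact: partialE.
Qed.

End Bridge.

Lemma pair_continuous {T U V : topologicalType} (f : T -> U) (g : T -> V) x :
  {for x, continuous f} -> {for x, continuous g} -> {for x, continuous (fun y => (f y, g y))}.
Proof. by move=> cf cg; exact: (cvg_pair cf cg). Qed.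

Lemma fst_continuous {U V : topologicalType} : continuous (@fst U V).
Proof. by move=> x; exact: (@cvg_fst _ _ (nbhs x.1) (nbhs x.2)). Qed.

Lemma snd_continuous {U V : topologicalType} : continuous (@snd U V).
Proof. by move=> x; exact: (@cvg_snd _ _ (nbhs x.1) (nbhs x.2)). Qed.

(** * Coordinates (v, x, u) of the ambient space *)

Section AmbientCoordinates.
Context {R : realType} {n : nat}.
Local Notation Q := 'rV[R]_(1 + n + 1).

Lemma v_ofE (q : Q) : v_of q = q 0 iv. Proof. by rewrite /v_of !mxE. Qed.
Lemma u_ofE (q : Q) : u_of q = q 0 iu. Proof. by rewrite /u_of !mxE. Qed.
Lemma x_ofE (q : Q) a : x_of q 0 a = q 0 (ix a). Proof. by rewrite /x_of !mxE. Qed.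

Lemma u_ofL (h : R) (w q : Q) : u_of (h *: w + q) = h * u_of w + u_of q.
Proof. by rewrite !u_ofE !mxE. Qed.
Lemma v_ofL (h : R) (w q : Q) : v_of (h *: w + q) = h * v_of w + v_of q.
Proof. by rewrite !v_ofE !mxE. Qed.
Lemma x_ofL (h : R) (w q : Q) : x_of (h *: w + q) = h *: x_of w + x_of q.
Proof. by apply/rowP => a; rewrite !(x_ofE, mxE). Qed.

Lemma u_of_continuous : continuous (@u_of R n).
Proof.
have -> : @u_of R n = (fun q : Q => q 0 iu) by apply/funext => q; rewrite u_ofE.
exact: coord_continuous.
Qed.
Lemma v_of_continuous : continuous (@v_of R n).
Proof.
have -> : @v_of R n = (fun q : Q => q 0 iv) by apply/funext => q; rewrite v_ofE.
exact: coord_continuous.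
Qed.

Lemma mx_continuous {T : topologicalType} (p q : nat) (f : T -> 'M[R]_(p, q)) (x : T) :
  (forall i j, {for x, continuous (fun y => f y i j)}) -> {for x, continuous f}.
Proof.
move=> cf; apply/cvgrPdist_le => /= e e0; near=> y.
rewrite /Num.Def.normr/= mx_normrE (bigmax_le _ (ltW e0))//= => i _.
rewrite !mxE/=; move: i; near: y; apply: filter_forall => /= i.
exact: ((cvgrPdist_le _ _).1 (cf i.1 i.2) e e0).
Unshelve. all: by end_near.
Qed.

Lemma x_of_continuous : continuous (@x_of R n).
Proof.
move=> q; apply: mx_continuous => i a; rewrite (ord1 i).
have -> : (fun y : Q => x_of y 0 a) = (fun y => y 0 (ix a)) by apply/funext => y; rewrite x_ofE.
exact: coord_continuous.
Qed.

Lemma ambient_pointE v (x : 'rV[R]_n) u :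
  [/\ v_of (ambient_point v x u) = v, x_of (ambient_point v x u) = x & u_of (ambient_point v x u) = u].
Proof.
by rewrite /v_of /x_of /u_of /ambient_point row_mxKl row_mxKl row_mxKr row_mxKr !mxE eqxx.
Qed.

Lemma v_ap v (x : 'rV[R]_n) u : v_of (ambient_point v x u) = v.
Proof. by have [] := ambient_pointE v x u. Qed.
Lemma x_ap v (x : 'rV[R]_n) u : x_of (ambient_point v x u) = x.
Proof. by have [] := ambient_pointE v x u. Qed.
Lemma u_ap v (x : 'rV[R]_n) u : u_of (ambient_point v x u) = u.
Proof. by have [] := ambient_pointE v x u. Qed.

Lemma row_ext (q q' : Q) : v_of q = v_of q' -> x_of q = x_of q' -> u_of q = u_of q' -> q = q'.
Proof.
rewrite !v_ofE !u_ofE => qv /rowP qx qu; apply/rowP => c.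
by elim/(@ambient_ind n): c => [//|a|//]; have := qx a; rewrite !x_ofE.
Qed.

Lemma ambient_point_eta (q : Q) : ambient_point (v_of q) (x_of q) (u_of q) = q.
Proof. by have [a b c] := ambient_pointE (v_of q) (x_of q) (u_of q); apply: row_ext. Qed.

Lemma ambient_pointL (h : R) (w y : 'rV[R]_n) :
  ambient_point 0 (h *: w + y) 0 = h *: ambient_point 0 w 0 + ambient_point 0 y 0.
Proof.
by apply: row_ext; rewrite ?v_ofL ?x_ofL ?u_ofL ?v_ap ?x_ap ?u_ap ?mulr0 ?addr0.
Qed.

Let xi_neq (a b : 'I_n) : (ix a == ix b) = (a == b).
Proof. by rewrite !eq_lshift eq_rshift. Qed.

Lemma u_of_eu : u_of ('e_iu : Q) = 1. Proof. by rewrite u_ofE mxE !eqxx. Qed.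
Lemma x_of_eu : x_of ('e_iu : Q) = 0.
Proof. by apply/rowP => a; rewrite x_ofE !mxE eqxx /= ?eq_lrshift. Qed.
Lemma v_of_eu : v_of ('e_iu : Q) = 0. Proof. by rewrite v_ofE mxE eqxx /= ?eq_lrshift. Qed.
Lemma u_of_ex a : u_of ('e_(ix a) : Q) = 0.
Proof. by rewrite u_ofE mxE eqxx /= ?[iu == _]eq_sym ?eq_lrshift. Qed.
Lemma v_of_ex a : v_of ('e_(ix a) : Q) = 0.
Proof. by rewrite v_ofE mxE eqxx /= ?eq_lshift ?eq_lrshift. Qed.
Lemma x_of_ex a : x_of ('e_(ix a) : Q) = 'e_a.
Proof. by apply/rowP => b; rewrite x_ofE !mxE eqxx /= xi_neq. Qed.
Lemma u_of_ev : u_of ('e_iv : Q) = 0.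
Proof. by rewrite u_ofE mxE eqxx /= ?[iu == _]eq_sym ?eq_lrshift. Qed.
Lemma v_of_ev : v_of ('e_iv : Q) = 1. Proof. by rewrite v_ofE mxE !eqxx. Qed.
Lemma x_of_ev : x_of ('e_iv : Q) = 0.
Proof. by apply/rowP => a; rewrite x_ofE !mxE eqxx /= ?eq_lshift 1?eq_sym ?eq_lrshift. Qed.

Lemma ambient_point_ex a : ambient_point 0 'e_a 0 = 'e_(ix a) :> Q.
Proof.
have [p1 p2 p3] := ambient_pointE 0 ('e_a : 'rV[R]_n) 0.
by apply: row_ext; rewrite ?p1 ?p2 ?p3 ?v_of_ex ?x_of_ex ?u_of_ex.
Qed.

Definition slice (q : Q) : Q := ambient_point (v_of q) (x_of q) 0.

Lemma sliceL (h : R) (w q : Q) : slice (h *: w + q) = h *: slice w + slice q.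
Proof.
by apply: row_ext; rewrite ?v_ofL ?x_ofL ?u_ofL ?v_ap ?x_ap ?u_ap ?v_ofL ?x_ofL ?mulr0 ?addr0.
Qed.

Lemma x_of_slice q : x_of (slice q) = x_of q.
Proof. by have [_ ->] := ambient_pointE (v_of q) (x_of q) 0. Qed.
Lemma u_of_slice q : u_of (slice q) = 0.
Proof. by have [_ _ ->] := ambient_pointE (v_of q) (x_of q) 0. Qed.
Lemma slice_id q : u_of q = 0 -> slice q = q.
Proof. by move=> uq; rewrite /slice -{3}(ambient_point_eta q) uq. Qed.

Lemma slice_continuous : continuous slice.
Proof.
move=> q; apply: mx_continuous => i c; rewrite (ord1 i).
elim/(@ambient_ind n): c => [|a|].
- have -> : (fun y => slice y 0 iv) = @v_of R n.
    by apply/funext => y; rewrite -v_ofE; have [->] := ambient_pointE (v_of y) (x_of y) 0.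
  exact: v_of_continuous.
- have -> : (fun y => slice y 0 (ix a)) = (fun y => y 0 (ix a)).
    by apply/funext => y; rewrite -!x_ofE x_of_slice.
  exact: coord_continuous.
- have -> : (fun y => slice y 0 iu) = cst 0 by apply/funext => y; rewrite -u_ofE u_of_slice.
  exact: cst_continuous.
Qed.

Lemma ambient_point_continuous : continuous (fun x : 'rV[R]_n => ambient_point 0 x 0).
Proof.
move=> x; apply: mx_continuous => i c; rewrite (ord1 i).
elim/(@ambient_ind n): c => [|a|].
- have -> : (fun y : 'rV[R]_n => ambient_point 0 y 0 0 iv) = cst 0.
    by apply/funext => y; rewrite -v_ofE; have [->] := ambient_pointE 0 y 0.
  exact: cst_continuous.
- have -> : (fun y : 'rV[R]_n => ambient_point 0 y 0 0 (ix a)) = (fun y => y 0 a).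
    by apply/funext => y; rewrite -x_ofE; have [_ ->] := ambient_pointE 0 y 0.
  exact: coord_continuous.
- have -> : (fun y : 'rV[R]_n => ambient_point 0 y 0 0 iu) = cst 0.
    by apply/funext => y; rewrite -u_ofE; have [_ _ ->] := ambient_pointE 0 y 0.
  exact: cst_continuous.
Qed.

End AmbientCoordinates.

(** * Inverse metric and weighted volume density *)

Section MetricData.
Context {R : realType} {V : normedModType R} (D : domain (V := V)) {n : nat}.
Variables (G : 'M[smf D]_n) (f : smf D).
Hypotheses (Gsym : G^T = G) (Gpos : forall x, D x -> 0 < (\det G) x).

Let det_neq0 x : D x -> (\det G) x != 0.
Proof. by move=> Dx; rewrite lt0r_neq0// Gpos. Qed.

(** The adjugate formula keeps the inverse inside the ring of smooth functions. *)
Definition metric_inv : 'M[smf D]_n := smf_inv det_neq0 *: \adj G.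
Definition volume_density : smf D := smf_exp (- f) * smf_sqrt Gpos.

Let detV : smf_inv det_neq0 * \det G = 1. Proof. exact: smf_mulV. Qed.

Lemma metric_invl : metric_inv *m G = 1%:M.
Proof. by rewrite /metric_inv -scalemxAl mul_adj_mx scale_scalar_mx detV. Qed.
Lemma metric_invr : G *m metric_inv = 1%:M.
Proof. by rewrite /metric_inv -scalemxAr mul_mx_adj scale_scalar_mx detV. Qed.
Lemma metric_inv_sym : metric_inv^T = metric_inv.
Proof.
rewrite -[LHS]mulmx1 -metric_invr mulmxA -{1}Gsym -trmx_mul metric_invr.
by rewrite trmx1 mul1mx.
Qed.

Lemma dd_volume_density w : dd w volume_density =
  volume_density * (smf_cst D 2^-1 * \sum_a \sum_b metric_inv a b * dd w (G a b) - dd w f).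
Proof.
have hd := dd_derivation D w; set r := smf_sqrt Gpos.
have rK : r * r = \det G by exact: smf_sqrtK.
have r0 : smf_inv det_neq0 * r * r = 1 by rewrite -mulrA rK detV.
have jac := jacobi hd detV (erefl metric_inv).
have jac2 : dd w (\det G) = \det G * \sum_a \sum_b metric_inv a b * dd w (G a b).
  rewrite jac; congr (_ * _); apply: eq_bigr => a _; apply: eq_bigr => b _.
  by congr (_ * dd w _); rewrite -[in LHS]Gsym mxE.
(* The square root is differentiated through [r * r = \det G]; the factor 2 r is then removed with
   the help of [r0] and of 1/2. *)
have dr : dd w r = r * (smf_cst D 2^-1 * \sum_a \sum_b metric_inv a b * dd w (G a b)).
  move: jac2; rewrite -rK (derivM hd) => E.
  have E2 : 2 * (r * dd w r) = r * r * \sum_a \sum_b metric_inv a b * dd w (G a b).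
    by rewrite -E; ring.
  have h2 := smf_half D; rewrite -[LHS]mul1r -r0.
  transitivity (smf_inv det_neq0 * r * (2 * smf_cst D 2^-1) * (r * dd w r)).
    by rewrite h2; ring.
  transitivity (smf_inv det_neq0 * r * smf_cst D 2^-1 * (2 * (r * dd w r))); first ring.
  rewrite E2; transitivity ((smf_inv det_neq0 * r * r) * (r * smf_cst D 2^-1 *
     \sum_a \sum_b metric_inv a b * dd w (G a b))); first ring.
  by rewrite r0; ring.
rewrite /volume_density -/r (derivM hd) dd_exp (derivN hd) dr; ring.
Qed.

Lemma volume_densityE x : D x -> volume_density x = expR (- f x) * Num.sqrt ((\det G) x).
Proof. by move=> Dx; rewrite evM// !mksmfE// evN. Qed.

End MetricData.

(** * A single ambient metric over a chart *)

Section SingleTime.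
Context {R : realType} {n : nat} {M : ptopologicalType} {A : atlas R n M}.
Variables (g : components A) (lambda : R) (phi : M -> R) (F : wfamily A).
Hypothesis hF : normal_ambient g lambda phi F.
Variables (i : chart_index A) (x0 : 'rV[R]_n) (Ox0 : chart_img i x0).
Local Notation Q := 'rV[R]_(1 + n + 1).

Let sf : smooth_family F g phi. Proof. by case: hF. Qed.
Let U : set (R * M) := projT1 (cid sf).
Let US := projT2 (cid sf).

Let chart_pair_open :
  open [set q : R * 'rV[R]_n | chart_img i q.2 /\ U (q.1, chart_param i q.2)].
Proof.
have [[oU _] _ _ _ _] := US.
rewrite openE => q [Oq Uq].
have o1 : \forall q' \near q, chart_img i q'.2.
  apply: (snd_continuous (x := q)).
  by apply: open_nbhs_nbhs; split=> //; exact: img_open.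
have o2 : \forall q' \near q, U (q'.1, chart_param i q'.2).
  have c : (fun q' : R * 'rV[R]_n => (q'.1, chart_param i q'.2)) @ q --> (q.1, chart_param i q.2).
    apply: pair_continuous; first exact: fst_continuous.
    apply: (@continuous_comp _ _ _ snd (chart_param i)); first exact: snd_continuous.
    exact: param_continuous.
  by apply: c; apply: open_nbhs_nbhs.
by rewrite /interior; apply: filterI.
Qed.

Let Dset (q : Q) : Prop := [/\ chart_img i (x_of q), U (u_of q, chart_param i (x_of q)) &
  1 - lambda * u_of q != 0].

Let pr_continuous : continuous (fun q : Q => (u_of q, x_of q)).
Proof. by move=> q; apply: pair_continuous; [exact: u_of_continuous|exact: x_of_continuous]. Qed.

Let Dopen : open (Dset : set Q).
Proof.
have -> : (Dset : set Q) = ((fun q : Q => (u_of q, x_of q)) @^-1`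
     [set q | chart_img i q.2 /\ U (q.1, chart_param i q.2)]) `&`
     ((fun q : Q => 1 - lambda * u_of q) @^-1` [set y | y != 0]).
  by apply/seteqP; split=> q; [case|case=> [[]]].
apply: openI; first by apply: open_comp => // q _; exact: pr_continuous.
have cu : continuous (fun q : Q => 1 - lambda * u_of q).
  suff : continuous (cst 1 - cst lambda * @u_of R n : Q -> R) by [].
  move=> q; apply: continuousB; first exact: cst_continuous.
  by apply: continuousM; [exact: cst_continuous|exact: u_of_continuous].
by apply: open_comp; [move=> q _; exact: cu|exact: open_neq].
Qed.

Let Dpt : Dset (ambient_point 0 x0 0).
Proof.
rewrite /Dset x_ap u_ap.
by split=> //; [have [[_ h] _ _ _ _] := US; exact: h|rewrite mulr0 subr0 oner_neq0].
Qed.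

Definition time_domain : domain := Domain Dopen Dpt.
Local Notation D := time_domain.

Lemma time_domain_slice q : chart_img i (x_of q) -> D (slice q).
Proof.
move=> Oq; split; rewrite ?x_of_slice ?u_of_slice ?mulr0 ?subr0 ?oner_neq0//.
by have [[_ h] _ _ _ _] := US; exact: h.
Qed.

Lemma time_domain_img q : D q -> chart_img i (x_of q). Proof. by case. Qed.

Let prL (h : R) (w q : Q) : (u_of (h *: w + q), x_of (h *: w + q)) =
  h *: (u_of w, x_of w) + (u_of q, x_of q).
Proof. by rewrite u_ofL x_ofL. Qed.

Let G_smooth a b : smooth_on D (fun q : Q => metric_at F (u_of q) i (x_of q) a b).
Proof.
have [_ sG _ _ _] := US => k.
apply: (@Ck_on_affine _ _ _ _ _ _ _ (fun q => metric_at F q.1 i q.2 a b) _ _ prL pr_continuous).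
  2: exact: (Ck_on_mx _ _ chart_pair_open).1 (sG i k) a b.
by move=> q [].
Qed.

Let f_smooth : smooth_on D (fun q : Q => fun_at F (u_of q) (chart_param i (x_of q))).
Proof.
have [_ _ s_ _ _] := US => k.
apply: (@Ck_on_affine _ _ _ _ _ _ _ (fun q => fun_at F q.1 (chart_param i q.2)) _ _ prL pr_continuous).
  2: exact: s_.
by move=> q [].
Qed.

Let u_smooth (O : domain (V := Q)) : smooth_on O (@u_of R n).
Proof. by move=> k; apply: Ck_on_linear; [exact: u_ofL|exact: u_of_continuous]. Qed.
Let v_smooth (O : domain (V := Q)) : smooth_on O (@v_of R n).
Proof. by move=> k; apply: Ck_on_linear; [exact: v_ofL|exact: v_of_continuous]. Qed.

Definition time_metric : 'M[smf D]_n := \matrix_(a, b) mksmf (G_smooth a b).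
Definition time_pot : smf D := mksmf f_smooth.
Let us : smf D := mksmf (u_smooth D).
Let vs : smf D := mksmf (v_smooth D).
Local Notation G := time_metric.
Local Notation f := time_pot.

Lemma time_metricE q a b : D q -> G a b q = metric_at F (u_of q) i (x_of q) a b.
Proof. by move=> Dq; rewrite mxE mksmfE. Qed.
Lemma time_potE q : D q -> f q = fun_at F (u_of q) (chart_param i (x_of q)).
Proof. exact: mksmfE. Qed.

Let pd u : tensor_on [set p | U (u, p)] (metric_at F u) /\ posdef_on [set p | U (u, p)] (metric_at F u).
Proof. by have [_ _ _ h _] := US. Qed.

Lemma time_metric_sym : G^T = G.
Proof.
apply/matrixP => a b; rewrite mxE; apply: smf_eq => q Dq; rewrite !time_metricE//.
have [Oq Uq _] := Dq; have [_ /(_ i _ Oq Uq) [s_ _]] := pd (u_of q).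
by rewrite -{1}s_ mxE.
Qed.

Lemma time_metric_det q : D q -> (\det G) q = \det (metric_at F (u_of q) i (x_of q)).
Proof.
move=> Dq; rewrite ev_det//; congr (\det _); apply/matrixP => a b.
by rewrite mxE time_metricE.
Qed.

Lemma time_metric_pos q : D q -> 0 < (\det G) q.
Proof.
move=> Dq; rewrite time_metric_det//.
have [Oq Uq _] := Dq; have [_ /(_ i _ Oq Uq) [s_ p_]] := pd (u_of q).
exact: posdef_det_gt0.
Qed.

Lemma time_metric0 q a b : D q -> u_of q = 0 -> G a b q = g i (x_of q) a b.
Proof.
move=> Dq uq; rewrite time_metricE// uq; have [_ _ _ _ [h _]] := US.
by rewrite h//; exact: time_domain_img.
Qed.

Lemma time_pot0 q : D q -> u_of q = 0 -> f q = phi (chart_param i (x_of q)).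
Proof. by move=> Dq uq; rewrite time_potE// uq; have [_ _ _ _ [_ h]] := US. Qed.

Definition time_inv := metric_inv time_metric_pos.
Local Notation H := time_inv.

Local Notation e' := (fun a : 'I_(1 + n + 1) => dd 'e_a : smf D -> smf D).
Local Notation e := (fun a : 'I_n => dd 'e_(ix a) : smf D -> smf D).
Local Notation du := (dd 'e_iu : smf D -> smf D).
Local Notation lam := (smf_cst D lambda).
Local Notation hf := (smf_cst D 2^-1).

Let dd_lin (h : Q -> R) (sh : smooth_on D h) :
  (forall k w q, h (k *: w + q) = k * h w + h q) ->
  forall w, dd w (mksmf sh) = smf_cst D (h w).
Proof.
move=> hL w; apply: smf_eq => q Dq; rewrite ev_cst//.
apply: etrans (dd_eq w (g := h) Dq (fun y Dy => mksmfE sh Dy)) _.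
rewrite /derive; apply/cvg_lim => //; apply: cvg_near_cst; rewrite near_withinE.
by near=> k => k0; rewrite /= hL addrK /GRing.scale /= mulKf.
Unshelve. all: by end_near.
Qed.

Let dus w : dd w us = smf_cst D (u_of w). Proof. exact: dd_lin u_ofL w. Qed.
Let dvs w : dd w vs = smf_cst D (v_of w). Proof. exact: dd_lin v_ofL w. Qed.

Let cst0 : smf_cst D 0 = 0. Proof. by []. Qed.
Let cst1 : smf_cst D 1 = 1. Proof. by []. Qed.

Let dv_zero (h : smf D) (h2 : R * 'rV[R]_n -> R) :
  (forall q, D q -> h q = h2 (u_of q, x_of q)) -> dd 'e_iv h = 0.
Proof.
move=> hE; apply: smf_eq => q Dq; rewrite ev0//.
apply: etrans (dd_eq 'e_iv (g := fun q => h2 (u_of q, x_of q)) Dq hE) _.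
rewrite /derive; apply/cvg_lim => //; apply: cvg_near_cst; near=> k.
by rewrite /= u_ofL x_ofL u_of_ev x_of_ev mulr0 scaler0 !add0r subrr scaler0.
Unshelve. all: by end_near.
Qed.

Let evG a b : dd 'e_iv (G a b) = 0.
Proof. by apply: (@dv_zero _ (fun p => metric_at F p.1 i p.2 a b)) => q Dq; rewrite time_metricE. Qed.
Let evf : dd 'e_iv f = 0.
Proof. by apply: (@dv_zero _ (fun p => fun_at F p.1 (chart_param i p.2))) => q Dq; rewrite time_potE. Qed.

Let sP a b := Pdr hf lam (amb_pot lam vs us f) e' (amb_mx G) (amb_mx H) (ix a) (ix b).
Let sF := Fdr hf lam (amb_pot lam vs us f) e' (amb_mx G) (amb_mx H).

Let ambGE x : D x -> forall a b, ambient_metric F i x a b = amb_mx G a b x.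
Proof.
move=> Dx a b.
have -> : ambient_metric F i x = amb_mx (map_mx (fun h : smf D => h x) G).
  rewrite /ambient_metric /amb_mx; congr (block_mx (block_mx _ _ _ _) _ _ _).
  by apply/matrixP => c d; rewrite mxE time_metricE.
elim/(@ambient_ind n): a => [|a|]; elim/(@ambient_ind n): b => [|b|]; rewrite !ambE ?ev0 ?ev1//.
by rewrite mxE.
Qed.

Let ambfE x : D x -> ambient_fun_chart lambda F i x = amb_pot lam vs us f x.
Proof.
move=> Dx; rewrite /ambient_fun_chart /ambient_fun /amb_pot evD// evB// !evM// ev_cst//.
by rewrite time_potE// !mksmfE.
Qed.

Let GH : G *m H = 1%:M. Proof. exact: metric_invr. Qed.
Let HG : H *m G = 1%:M. Proof. exact: metric_invl. Qed.

Let sP_flat N a b : Jn (@u_of R n) 'e_iu N (sP a b).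
Proof.
apply: flat_jets; [exact: u_ofL|exact: u_of_eu|] => z N' Dz uz.
have [_ hP _] := hF; have := hP i (ix a) (ix b) (v_of z) (x_of z) N' (time_domain_img Dz).
rewrite -{1}uz ambient_point_eta => -[C hC]; exists C.
near=> q; have Dq : D q by near: q; exact: (near_dom Dz).
rewrite -(PtensorE lambda ambGE ambfE (amb_mxK GH))//.
by near: q.
Unshelve. all: by end_near.
Qed.

Let sF_flat N : Jn (@u_of R n) 'e_iu N sF.
Proof.
apply: flat_jets; [exact: u_ofL|exact: u_of_eu|] => z N' Dz uz.
have [_ _ hP] := hF; have := hP i (v_of z) (x_of z) N' (time_domain_img Dz).
rewrite -{1}uz ambient_point_eta => -[C hC]; exists C.
near=> q; have Dq : D q by near: q; exact: (near_dom Dz).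
rewrite -(FscalarE lambda ambGE ambfE (amb_mxK GH))//.
by near: q.
Unshelve. all: by end_near.
Qed.

Definition time_s : smf D := 1 - lam * us.

Let hd c : derivation (e' c). Proof. exact: dd_derivation. Qed.

Let evv : dd 'e_iv vs = 1. Proof. by rewrite dvs v_of_ev. Qed.
Let exv a : dd 'e_(ix a) vs = 0. Proof. by rewrite dvs v_of_ex. Qed.
Let euv : du vs = 0. Proof. by rewrite dvs v_of_eu. Qed.
Let evu : dd 'e_iv us = 0. Proof. by rewrite dus u_of_ev. Qed.
Let exu a : dd 'e_(ix a) us = 0. Proof. by rewrite dus u_of_ex. Qed.
Let euu : du us = 1. Proof. by rewrite dus u_of_eu. Qed.
Let elam c : dd 'e_c lam = 0. Proof. exact: dd_cst. Qed.
Let hC a b (x : smf D) : e' a (e' b x) = e' b (e' a x). Proof. exact: ddC. Qed.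

Lemma time_metric_flow N a b :
  eqm (Jn (@u_of R n) 'e_iu N) (time_s * du (G a b)) (2 * Pdr hf lam f e G H a b).
Proof.
have hJ := Jn_ideal D (@u_of R n) 'e_iu N.
have E := metric_flow (e' := e') (smf_half D) hd hC H time_metric_sym evG evf evv exv evu exu elam a b.
rewrite /eqm {1}/time_s E addrAC subrr add0r; apply: idealN => //.
by apply: idealM => //; exact: sP_flat.
Qed.

Lemma time_pot_flow N : eqm (Jn (@u_of R n) 'e_iu N) (2 * time_s * du f) (Qdr hf lam f e G H).
Proof.
have hJ := Jn_ideal D (@u_of R n) 'e_iu N.
have E := potential_flow (e' := e') (smf_half D) hd hC H time_metric_sym evG evf evv exv euv evu exu euu elam.
have subK (x y z : smf D) : x + y - z - x = y - z by ring.
rewrite /eqm {1}/time_s E subK.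
apply: (idealD hJ (sF_flat N)).
apply: idealN => //; apply: ideal_sum => // a; apply: ideal_sum => // b.
by apply: idealM => //; exact: sP_flat.
Qed.

Lemma time_sE q : D q -> time_s q = 1 - lambda * u_of q.
Proof. by move=> Dq; rewrite /time_s evB// ev1// evM// ev_cst// mksmfE. Qed.

Definition time_volume : smf D := volume_density f time_metric_pos.

(** The u-jets of the inverse metric at u = 0, extended constantly in u, are the Taylor coefficients
    needed below. *)
Let prim_coef (j : nat) (a b : 'I_n) (q : Q) : R := iter j du (H a b) (slice q).
Let prim_smooth j a b : smooth_on D (prim_coef j a b).
Proof.
move=> k; apply: (Ck_on_affine sliceL slice_continuous _ (smf_smooth (iter j du (H a b)) k)).
by move=> q /time_domain_img; exact: time_domain_slice.
Qed.

(* A Taylor polynomial of the primitive [int_0^u g^{ab}]. *)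
Definition time_prim N a b : smf D :=
  taylor us N.+1 (fun j => if j is j'.+1 then mksmf (prim_smooth j' a b) else 0).

Let slice_eu' k q : slice (k *: 'e_iu + q) = slice q :> Q.
Proof.
by apply: row_ext; rewrite ?v_ap ?x_ap ?u_ap ?v_ofL ?x_ofL ?v_of_eu ?x_of_eu ?mulr0 ?scaler0 ?add0r.
Qed.

Lemma time_prim0 N a b q : D q -> u_of q = 0 -> time_prim N a b q = 0.
Proof.
by move=> Dq uq; rewrite (taylor_at0 (u := @u_of R n) 'e_iu)// ?ev0// => x Dx; rewrite mksmfE.
Qed.

(** The coefficients of the primitive are those of the inverse metric shifted by one, so its
    u-derivative is the Taylor polynomial of the inverse metric. *)
Lemma du_time_prim N a b : eqm (Jn (@u_of R n) 'e_iu N) (du (time_prim N a b)) (H a b).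
Proof.
have usE x : D x -> us x = u_of x by move=> Dx; rewrite mksmfE.
have dc j : du (mksmf (prim_smooth j a b)) = 0.
  by apply: dd_invariant => q k; rewrite /prim_coef slice_eu'.
rewrite /time_prim (dd_taylor euu); last first.
  by case=> [|j]; [rewrite (deriv0 (dd_derivation _ _))|exact: dc].
apply: jet_eqm => j jN z Dz uz.
by rewrite (taylor_jet usE euu)// mksmfE// /prim_coef slice_id.
Qed.

End SingleTime.

(** * Ambient metrics along a curve of potentials *)

Section ChartFamily.
Context {R : realType} {n : nat} {M : ptopologicalType} {A : atlas R n M}.
Variables (g : components A) (lambda : R) (Phi : R -> M -> R) (F : R -> wfamily A).
Hypothesis hg : riemannian g.
Hypothesis hF : forall t, normal_ambient g lambda (Phi t) (F t).
Variables (i : chart_index A) (x0 : 'rV[R]_n) (Ox0 : chart_img i x0).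
Hypothesis hPhi : smooth_on [set q : R * 'rV[R]_n | chart_img i q.2]
  (fun q => Phi q.1 (chart_param i q.2)).
Local Notation Q := 'rV[R]_(1 + n + 1).
Local Notation W := (R * 'rV[R]_(1 + n + 1))%type.
Local Notation D t := (time_domain (hF t) Ox0).
Local Notation G t := (time_metric (hF t) Ox0).
Local Notation f t := (time_pot (hF t) Ox0).
Local Notation eu := ((0 : R), ('e_iu : Q)).
Local Notation ex a := ((0 : R), ('e_(ix a) : Q)).
Local Notation et := ((1 : R), (0 : Q)).

Definition uW (p : W) : R := u_of p.2.

Let img_openW : open ([set p : W | chart_img i (x_of p.2)] : set W).
Proof.
apply: (open_comp (f := fun p : W => x_of p.2)); last exact: img_open.
move=> p _; apply: (@continuous_comp _ _ _ snd (@x_of R n)); first exact: snd_continuous.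
exact: x_of_continuous.
Qed.

Definition img_domain : domain :=
  @Domain R W (fun p => chart_img i (x_of p.2)) img_openW (0, ambient_point 0 x0 0)
    (eq_ind_r (chart_img i) Ox0 (x_ap 0 x0 0)).
Local Notation WO := img_domain.

Let uWL (h : R) (w p : W) : uW (h *: w + p) = h * uW w + uW p.
Proof. exact: u_ofL. Qed.

Let uW_continuous : continuous uW.
Proof.
move=> p; apply: (@continuous_comp _ _ _ snd (@u_of R n)); first exact: snd_continuous.
exact: u_of_continuous.
Qed.

Let uW_smooth (O : domain (V := W)) : smooth_on O uW.
Proof. by move=> k; apply: Ck_on_linear; [exact: uWL|exact: uW_continuous]. Qed.

(* The jets in [u] at [u = 0] of the metric and of the potential, as functions of
   [t] and of the point: the flow expresses them through lower ones, which is how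
   they are seen to be smooth in [t]. *)
Definition gam (N : nat) (a b : 'I_n) (p : W) : R :=
  iter N (dd 'e_iu) (G p.1 a b) (slice p.2).
Definition the (N : nat) (p : W) : R := iter N (dd 'e_iu) (f p.1) (slice p.2).

Let gam0E a b p : WO p -> gam 0 a b p = g i (x_of p.2) a b.
Proof.
move=> Op; rewrite /gam /= time_metric0 ?x_of_slice ?u_of_slice//.
exact: time_domain_slice.
Qed.

Let the0E p : WO p -> the 0 p = Phi p.1 (chart_param i (x_of p.2)).
Proof.
move=> Op; transitivity (f p.1 (slice p.2)); first by [].
rewrite time_pot0 ?x_of_slice ?u_of_slice//.
exact: time_domain_slice.
Qed.

Let img_open_ : open (chart_img i). Proof. exact: img_open. Qed.

Let gW_smooth a b : smooth_on WO (fun p : W => g i (x_of p.2) a b).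
Proof.
move=> k; have [sg _ _] := hg.
apply: (@Ck_on_affine _ _ _ _ _ (chart_img i) _ (fun x => g i x a b) (fun p : W => x_of p.2) (fun p => x_of p.2)).
- by move=> h w p; exact: x_ofL.
- move=> p; apply: (@continuous_comp _ _ _ snd (@x_of R n)); first exact: snd_continuous.
  exact: x_of_continuous.
- by [].
- exact: (Ck_on_mx _ _ img_open_).1 (sg i k) a b.
Qed.

Let gam0_smooth a b : smooth_on WO (gam 0 a b).
Proof.
move=> k; apply: (eq_Ck_on (dset_open WO)) (gW_smooth a b k).
by move=> p /set_mem Op; rewrite gam0E.
Qed.

Let prW_continuous : continuous (fun p : W => (p.1, x_of p.2)).
Proof.
move=> p; apply: pair_continuous; first exact: fst_continuous.
apply: (@continuous_comp _ _ _ snd (@x_of R n)); first exact: snd_continuous.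
exact: x_of_continuous.
Qed.

Let prWL (h : R) (w p : W) : ((h *: w + p).1, x_of (h *: w + p).2) =
  h *: (w.1, x_of w.2) + (p.1, x_of p.2) :> R * 'rV[R]_n.
Proof. by rewrite x_ofL. Qed.

Let the0_smooth : smooth_on WO (the 0).
Proof.
move=> k.
apply: (eq_Ck_on (dset_open WO) (f := (fun q : R * 'rV[R]_n => Phi q.1 (chart_param i q.2)) \o
   (fun p : W => (p.1, x_of p.2)))).
  by move=> p /set_mem Op; rewrite the0E.
by apply: (Ck_on_affine prWL prW_continuous _ (hPhi k)) => p.
Qed.

(* Junk value [0] for functions that are not smooth. *)
Definition smf_of (O : domain (V := W)) (h : W -> R) : smf O :=
  match pselect (smooth_on O h) with left s => mksmf s | right _ => 0 end.

Lemma smf_ofE (O : domain (V := W)) h p : smooth_on O h -> O p -> smf_of O h p = h p.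
Proof. by move=> sh Op; rewrite /smf_of; case: pselect => // s; rewrite mksmfE. Qed.

Let uS : smf WO := mksmf (uW_smooth WO).

Let duS : dd eu uS = 1.
Proof.
apply: smf_eq => p Op; rewrite ev1//.
apply: etrans (dd_eq eu (g := uW) Op (fun y Oy => mksmfE _ Oy)) _.
rewrite /derive; apply/cvg_lim => //; apply: cvg_near_cst; rewrite near_withinE.
near=> h => h0; rewrite /= uWL addrK /uW /= u_of_eu mulr1.
by rewrite /GRing.scale /= mulVf.
Unshelve. all: by end_near.
Qed.

Let slice_eu k q : slice (k *: 'e_iu + q) = slice q :> Q.
Proof.
by apply: row_ext; rewrite ?v_ap ?x_ap ?u_ap ?v_ofL ?x_ofL ?v_of_eu ?x_of_eu ?mulr0 ?scaler0 ?add0r.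
Qed.

Let dcoef (h : W -> R) : (forall p, h p = h (p.1, slice p.2)) -> dd eu (smf_of WO h) = 0.
Proof.
move=> hs; apply: smf_eq => p Op; rewrite ev0// /smf_of.
case: pselect => [s|_]; last by rewrite (deriv0 (dd_derivation _ _)) ev0.
apply: etrans (dd_eq eu (g := h) Op (fun y Oy => mksmfE _ Oy)) _.
rewrite /derive; apply/cvg_lim => //; apply: cvg_near_cst; near=> k.
by rewrite /= [h (_ + _)]hs [h p]hs /= slice_eu scaler0 add0r subrr scaler0.
Unshelve. all: by end_near.
Qed.

(* Polynomials in [u] with the first [N] jets of the family; unlike the family
   itself they are smooth in [t]. *)
Let Gh0 N : 'M[smf WO]_n := \matrix_(a, b) taylor uS N (fun j => smf_of WO (gam j a b)).
Let fh0 N : smf WO := taylor uS N (fun j => smf_of WO (the j)).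

Let gam_slice j a b p : gam j a b p = gam j a b (p.1, slice p.2).
Proof. by rewrite /gam /= [slice (slice _)]slice_id ?u_of_slice. Qed.
Let the_slice j p : the j p = the j (p.1, slice p.2).
Proof. by rewrite /the /= [slice (slice _)]slice_id ?u_of_slice. Qed.

Let uSE p : WO p -> uS p = uW p. Proof. exact: mksmfE. Qed.

Let Gh0_at0 N a b p : WO p -> uW p = 0 -> Gh0 N a b p = g i (x_of p.2) a b.
Proof.
move=> Op up; rewrite mxE (taylor_at0 eu uSE)// (smf_ofE (gam0_smooth a b))//.
exact: gam0E.
Qed.

Let Gh0_det0 N p : WO p -> uW p = 0 -> 0 < (\det (Gh0 N)) p.
Proof.
move=> Op up; have [_ _ pg] := hg.
have [gs gp] := pg i (x_of p.2) Op I.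
rewrite ev_det//.
have -> : map_mx (fun h : smf WO => h p) (Gh0 N) = g i (x_of p.2).
  by apply/matrixP => a b; rewrite mxE Gh0_at0.
exact: posdef_det_gt0.
Qed.

(** A Taylor polynomial of a metric is nondegenerate only near u = 0. A positive determinant is what
    the inverse and the square root require, and the last condition makes [s] invertible. *)
Let Om_set N (p : W) : Prop := [/\ WO p, 0 < (\det (Gh0 N)) p & 1 - lambda * uW p != 0].

Let Om_open N : open (Om_set N : set W).
Proof.
rewrite openE => p [Op dp sp]; rewrite /interior.
have cs : continuous (fun p : W => 1 - lambda * uW p).
  suff : continuous (cst 1 - cst lambda * uW : W -> R) by [].
  move=> q; apply: continuousB; first exact: cst_continuous.
  by apply: continuousM; [exact: cst_continuous|exact: uW_continuous].
have n1 := near_dom Op.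
have n2 : \forall q \near p, 0 < (\det (Gh0 N)) q.
  exact: (@smf_continuous _ _ WO (\det (Gh0 N)) p Op _ (lt_nbhsr dp)).
have n3 : \forall q \near p, 1 - lambda * uW q != 0.
  by apply: (cs p [set y | y != 0]); apply: open_nbhs_nbhs; split => //; exact: open_neq.
by near=> q; split; near: q.
Unshelve. all: by end_near.
Qed.

Let Om_slice N (t : R) q : chart_img i (x_of q) -> Om_set N (t, slice q).
Proof.
move=> Oq; have us : uW (t, slice q) = 0 by rewrite /uW u_of_slice.
have Os : WO (t, slice q) by rewrite /= x_of_slice.
by split=> //; [exact: Gh0_det0|rewrite us mulr0 subr0 oner_neq0].
Qed.

Definition Om N : domain := Domain (@Om_open N) (Om_slice N (dpt WO).1 (dptP WO)).

Let idL (V : normedModType R) (h : R) (w x : V) : h *: w + x = h *: w + x. Proof. by []. Qed.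
Let idC (V : normedModType R) : continuous (@id V). Proof. by move=> x; exact: cvg_id. Qed.
Let Om_WO N p : Om N p -> WO p. Proof. by case. Qed.
Let rO N : smf WO -> smf (Om N) := res (idL (V := W)) (@idC W) (@Om_WO N).

Definition Gh N : 'M[smf (Om N)]_n := map_mx (rO N) (Gh0 N).
Definition fh N : smf (Om N) := rO N (fh0 N).

Let Gh_det N p : Om N p -> 0 < (\det (Gh N)) p.
Proof.
move=> Op; have [Wp dp _] := Op; rewrite ev_det//.
have -> : map_mx (fun h : smf (Om N) => h p) (Gh N) = map_mx (fun h : smf WO => h p) (Gh0 N).
  by apply/matrixP => a b; rewrite !mxE resE// mxE.
by rewrite -ev_det.
Qed.

Let Gh_sym N : (Gh N)^T = Gh N.
Proof.
apply/matrixP => a b; rewrite !mxE; congr (rO N (taylor _ _ _)); apply/funext => j.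
congr smf_of; apply/funext => p; rewrite /gam.
by rewrite -[in LHS]time_metric_sym mxE.
Qed.

Definition Hh N := metric_inv (@Gh_det N).

Let Dt_set N t (q : Q) : Prop := D t q /\ Om N (t, q).
Let Dt_open N t : open (Dt_set N t : set Q).
Proof.
apply: openI; first exact: dset_open.
apply: (open_comp (f := fun q : Q => (t, q))); last exact: dset_open.
by move=> q _; apply: pair_continuous; [exact: cst_continuous|exact: idC].
Qed.
Let Dt_slice N t q : chart_img i (x_of q) -> Dt_set N t (slice q).
Proof. by move=> Oq; split; [exact: time_domain_slice|exact: Om_slice]. Qed.
Definition Dt N t : domain :=
  @Domain R Q (Dt_set N t) (@Dt_open N t) (slice (ambient_point 0 x0 0))
    (Dt_slice N t (eq_ind_r (chart_img i) Ox0 (x_ap 0 x0 0))).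

Let tL (t : R) (h : R) (w q : Q) : (t, h *: w + q) = h *: ((0 : R), w) + (t, q) :> W.
Proof. by rewrite -[X in (X, _)]add0r -[X in (X + _, _)](scaler0 _ h). Qed.
Let tC (t : R) : continuous (fun q : Q => (t, q)).
Proof. by move=> q; apply: pair_continuous; [exact: cst_continuous|exact: idC]. Qed.
Let Dt_Om N t q : Dt N t q -> Om N (t, q). Proof. by case. Qed.
Let Dt_D N t q : Dt N t q -> D t q. Proof. by case. Qed.

Unset Implicit Arguments.
(** The polynomial model lives over [Om N], the ambient metric of time [t] over its own domain;
    [rho] and [rD] bring both to the common domain [Dt N t], where jets are compared. *)
Let rho N t : smf (Om N) -> smf (Dt N t) := res (tL t) (@tC t) (@Dt_Om N t).
Let rD N t : smf (D t) -> smf (Dt N t) := res (idL (V := Q)) (@idC Q) (@Dt_D N t).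
Set Implicit Arguments.

Let rhoM N t x y : rho N t (x * y) = rho N t x * rho N t y. Proof. exact: resM. Qed.
Let rDM N t x y : rD N t (x * y) = rD N t x * rD N t y. Proof. exact: resM. Qed.
Let rho_nat N t m : rho N t m%:R = m%:R. Proof. exact: res_natr. Qed.
Let rD_nat N t m : rD N t m%:R = m%:R. Proof. exact: res_natr. Qed.

Definition smooth_upto N := (forall j a b, (j <= N)%N -> smooth_on WO (gam j a b)) /\
  (forall j, (j <= N)%N -> smooth_on WO (the j)).

Local Notation J N := (Jn (@u_of R n) 'e_iu N).

(** The model is built to have these jets; the assumption [smooth_upto N] excludes the default value
    of [smf_of]. *)
Let agreeG N t a b : smooth_upto N -> eqm (J N) (rho N t (Gh N a b)) (rD N t (G t a b)).
Proof.
move=> [sG _]; apply/Jn_iter => j jN z Dz uz.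
have it (x y : smf (Dt N t)) : iter j (dd 'e_iu) (x - y) = iter j (dd 'e_iu) x - iter j (dd 'e_iu) y.
  by elim: j {jN} => //= j ->; rewrite (derivB (dd_derivation _ _)).
rewrite it evB// !res_iter !resE// mxE res_iter resE; last exact: Dt_Om.
rewrite mxE (taylor_jet uSE duS)//; last 2 first.
- by move=> k; apply: dcoef; exact: gam_slice.
- exact: (Om_WO (Dt_Om Dz)).
rewrite smf_ofE; [|exact: sG|exact: (Om_WO (Dt_Om Dz))].
by rewrite /gam /= slice_id// subrr.
Qed.

Let agreef N t : smooth_upto N -> eqm (J N) (rho N t (fh N)) (rD N t (f t)).
Proof.
move=> [_ sf]; apply/Jn_iter => j jN z Dz uz.
have it (x y : smf (Dt N t)) : iter j (dd 'e_iu) (x - y) = iter j (dd 'e_iu) x - iter j (dd 'e_iu) y.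
  by elim: j {jN} => //= j ->; rewrite (derivB (dd_derivation _ _)).
have Oz := Dt_Om Dz; rewrite it evB// /fh !res_iter !resE//.
rewrite (taylor_jet uSE duS)//; last 2 first.
- by move=> k; apply: dcoef; exact: the_slice.
- exact: (Om_WO (Dt_Om Dz)).
rewrite smf_ofE; [|exact: sf|exact: (Om_WO (Dt_Om Dz))].
by rewrite /the /= slice_id// subrr.
Qed.

Let s_neq0 N p : Om N p -> 1 - lambda * uW p != 0. Proof. by case. Qed.
Let uO N : smf (Om N) := mksmf (uW_smooth (Om N)).
Let lamO N := smf_cst (Om N) lambda.
Let hfO N := smf_cst (Om N) 2^-1.
Definition sO N : smf (Om N) := 1 - lamO N * uO N.
Let sOE N p : Om N p -> sO N p = 1 - lambda * uW p.
Proof. by move=> Op; rewrite /sO evB// ev1// evM// ev_cst// mksmfE. Qed.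
Let sO_neq0 N p : Om N p -> sO N p != 0.
Proof. by move=> Op; rewrite sOE// (s_neq0 Op). Qed.
Definition sOV N := smf_inv (@sO_neq0 N).

Local Notation eO N := (fun a : 'I_n => dd (ex a) : smf (Om N) -> smf (Om N)).
Local Notation eD N t := (fun a : 'I_n => dd 'e_(ix a) : smf (Dt N t) -> smf (Dt N t)).

Let PO N a b := Pdr (hfO N) (lamO N) (fh N) (eO N) (Gh N) (Hh N) a b.
Let QO N := Qdr (hfO N) (lamO N) (fh N) (eO N) (Gh N) (Hh N).
Let PT t a b := Pdr (smf_cst (D t) 2^-1) (smf_cst (D t) lambda) (f t)
  (fun a : 'I_n => dd 'e_(ix a)) (G t) (time_inv (hF t) Ox0) a b.
Let QT t := Qdr (smf_cst (D t) 2^-1) (smf_cst (D t) lambda) (f t)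
  (fun a : 'I_n => dd 'e_(ix a)) (G t) (time_inv (hF t) Ox0).

Let rho_s N t : rho N t (sO N) = rD N t (time_s (hF t) Ox0).
Proof.
apply: smf_eq => q Dq; have D1 := Dt_D Dq; have D2 := Dt_Om Dq.
by rewrite !resE// sOE// time_sE.
Qed.

Let Jex N t k a (x : smf (Dt N t)) : J k x -> J k (dd 'e_(ix a) x).
Proof.
by apply: Jn_deriv => h z uz; rewrite u_ofL u_of_ex uz mulr0 addr0.
Qed.

Let GHr N t : map_mx (rho N t) (Hh N) *m map_mx (rho N t) (Gh N) = 1%:M.
Proof. by rewrite -res_mulmx metric_invl res_id. Qed.
Let GHd N t : map_mx (rD N t) (G t) *m map_mx (rD N t) (time_inv (hF t) Ox0) = 1%:M.
Proof. by rewrite -res_mulmx metric_invr res_id. Qed.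

Let agreeP N t a b : smooth_upto N -> eqm (J N) (rho N t (PO N a b)) (rD N t (PT t a b)).
Proof.
move=> sN; rewrite /rho /rD /PO /PT (res_Pdr _ _ _ (fun a : 'I_n => 'e_(ix a))).
rewrite (res_Pdr _ _ _ (fun a : 'I_n => 'e_(ix a))) !res_cst.
have hJ := Jn_ideal (Dt N t) (@u_of R n) 'e_iu N.
have GG c d : eqm (J N) (map_mx (rho N t) (Gh N) c d) (map_mx (rD N t) (G t) c d).
  by rewrite mxE [X in eqm _ _ X]mxE; exact: agreeG.
by apply: (eqm_Pdr hJ _ _ _ _ (GHr N t) (GHd N t) GG (agreef t sN)) => //; [move=> c; exact: dd_derivation|move=> c x; exact: Jex].
Qed.

Let agreeQ N t : smooth_upto N -> eqm (J N) (rho N t (QO N)) (rD N t (QT t)).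
Proof.
move=> sN; rewrite /rho /rD /QO /QT (res_Qdr _ _ _ (fun a : 'I_n => 'e_(ix a))).
rewrite (res_Qdr _ _ _ (fun a : 'I_n => 'e_(ix a))) !res_cst.
have hJ := Jn_ideal (Dt N t) (@u_of R n) 'e_iu N.
have GG c d : eqm (J N) (map_mx (rho N t) (Gh N) c d) (map_mx (rD N t) (G t) c d).
  by rewrite mxE [X in eqm _ _ X]mxE; exact: agreeG.
by apply: (eqm_Qdr hJ _ _ _ _ (GHr N t) (GHd N t) GG (agreef t sN)) => //; [move=> c; exact: dd_derivation|move=> c x; exact: Jex].
Qed.

Let AS : W -> W := fun p => (p.1, slice p.2).
Let ASL (h : R) (w p : W) : AS (h *: w + p) = h *: AS w + AS p.
Proof. by rewrite /AS sliceL. Qed.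
Let AS_continuous : continuous AS.
Proof.
move=> p; apply: pair_continuous; first exact: fst_continuous.
apply: (@continuous_comp _ _ _ snd slice); first exact: snd_continuous.
exact: slice_continuous.
Qed.
Let AS_smooth N (x : smf (Om N)) : smooth_on WO (fun p : W => x (AS p)).
Proof.
move=> k; apply: (Ck_on_affine ASL AS_continuous _ (smf_smooth x k)) => p Op.
exact: Om_slice.
Qed.

Let rD_jet N t k (x : smf (D t)) z : Dt N t z ->
  iter k (dd 'e_iu) (rD N t x) z = iter k (dd 'e_iu) x z.
Proof. by move=> Dz; rewrite res_iter resE. Qed.
Let rho_jet N t k (x : smf (Om N)) z : Dt N t z ->
  iter k (dd 'e_iu) (rho N t x) z = iter k (dd eu) x (t, z).
Proof. by move=> Dz; rewrite res_iter resE. Qed.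

Let Jres N t (x : smf (D t)) : (forall k, J k x) -> forall k, J k (rD N t x).
Proof. by move=> Jx k; exact: (Jn_res _ _ _ (u := @u_of R n)). Qed.

Let rhoV N t : rho N t (sOV N) * rD N t (time_s (hF t) Ox0) = 1.
Proof. by rewrite -rho_s -rhoM smf_mulV; exact: res1. Qed.

(** Dividing the flow by [s] expresses the jets of the u-derivative through the model, that is,
    through functions smooth jointly in [t] and the point. *)
Let flowG N t a b : smooth_upto N ->
  eqm (J N) (rD N t (dd 'e_iu (G t a b))) (rho N t (sOV N * (2 * PO N a b))).
Proof.
move=> sN; have hJ := Jn_ideal (Dt N t) (@u_of R n) 'e_iu N.
have : eqm (J N) (rD N t (time_s (hF t) Ox0 * dd 'e_iu (G t a b))) (rD N t (2 * PT t a b)).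
  rewrite /eqm -resB; apply: Jres => k; exact: time_metric_flow.
move=> /(eqmM hJ (eqm_refl hJ (rho N t (sOV N)))); rewrite [rD N t (_ * _)]rDM mulrA rhoV mul1r.
move=> E; apply: (eqm_trans hJ) E _; rewrite rhoM; apply: eqmM => //; first exact: eqm_refl.
rewrite rDM rhoM rho_nat rD_nat; apply: eqmM => //; first exact: eqm_refl.
by apply: eqm_sym => //; exact: agreeP.
Qed.

Let flowf N t : smooth_upto N ->
  eqm (J N) (rD N t (dd 'e_iu (f t))) (rho N t (sOV N * (hfO N * QO N))).
Proof.
move=> sN; have hJ := Jn_ideal (Dt N t) (@u_of R n) 'e_iu N.
have : eqm (J N) (rD N t (2 * time_s (hF t) Ox0 * dd 'e_iu (f t))) (rD N t (QT t)).
  rewrite /eqm -resB; apply: Jres => k; exact: time_pot_flow.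
move=> /(eqmM hJ (eqm_refl hJ (rho N t (sOV N * hfO N)))).
have -> : rho N t (sOV N * hfO N) * rD N t (2 * time_s (hF t) Ox0 * dd 'e_iu (f t)) =
   rD N t (dd 'e_iu (f t)).
  have -> : rho N t (sOV N * hfO N) = rho N t (sOV N) * smf_cst (Dt N t) 2^-1.
    by rewrite rhoM; congr (_ * _); exact: res_cst.
  rewrite rDM rDM rD_nat.
  have h2 : 2 * smf_cst (Dt N t) 2^-1 = 1 by exact: smf_half.
  transitivity ((rho N t (sOV N) * rD N t (time_s (hF t) Ox0)) * (2 * smf_cst (Dt N t) 2^-1)
    * rD N t (dd 'e_iu (f t))); first by ring.
  by rewrite rhoV h2 !mul1r.
move=> E; apply: (eqm_trans hJ) E _; rewrite mulrA [X in eqm _ _ X]rhoM; apply: eqmM => //.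
  exact: eqm_refl.
by apply: eqm_sym => //; exact: agreeQ.
Qed.

(** The jet of order N + 1 is the N-th jet of the u-derivative, for which the flow gives a jointly
    smooth expression. Regularity in [t] is gained here although the ambient metrics are given time
    by time. *)
Let smooth_uptoS N : smooth_upto N -> smooth_upto N.+1.
Proof.
move=> sN; have [sG sf] := sN; split=> j; [move=> a b|]; rewrite leq_eqVlt ltnS => /orP[/eqP ->|];
  try by [exact: sG|exact: sf].
- move=> k; apply: (eq_Ck_on (dset_open WO)) (AS_smooth (iter N (dd eu) (sOV N * (2 * PO N a b))) k).
  move=> p /set_mem Op; have Dz := Dt_slice N p.1 Op.
  by rewrite /gam iterSr -rho_jet// -(rD_jet (N := N))//
    (eqm_jet (flowG p.1 a b sN) (leqnn N))// u_of_slice.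
- move=> k; apply: (eq_Ck_on (dset_open WO)) (AS_smooth (iter N (dd eu) (sOV N * (hfO N * QO N))) k).
  move=> p /set_mem Op; have Dz := Dt_slice N p.1 Op.
  by rewrite /the iterSr -rho_jet// -(rD_jet (N := N))//
    (eqm_jet (flowf p.1 sN) (leqnn N))// u_of_slice.
Qed.

Lemma smooth_all N : smooth_upto N.
Proof.
elim: N => [|N IH]; last exact: smooth_uptoS.
by split=> j; [move=> a b|]; rewrite leqn0 => /eqP ->; [exact: gam0_smooth|exact: the0_smooth].
Qed.

Section FixedOrder.
Variable N : nat.
Local Notation O' := (Om N.+1).
Local Notation JO k := (Jn uW eu k).
Local Notation du := (dd eu : smf O' -> smf O').
Local Notation dt := (dd et : smf O' -> smf O').
Local Notation e := (fun a : 'I_n => dd (ex a) : smf O' -> smf O').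
Local Notation GG := (Gh N.+1).
Local Notation HH := (Hh N.+1).
Local Notation ff := (fh N.+1).
Local Notation s := (sO N.+1).

Let hJO k : is_ideal (JO k : smf O' -> Prop). Proof. exact: Jn_ideal. Qed.

(** Membership in the ideal involves u-derivatives only, so a congruence may be checked at each
    fixed time. *)
Let J_slices k (x y : smf O') : (forall t, eqm (J k) (rho N.+1 t x) (rho N.+1 t y)) -> eqm (JO k) x y.
Proof.
move=> xy; apply: jet_eqm => j jk [t z] Oz uz.
have Dz : Dt N.+1 t z.
  have uz' : u_of z = 0 by [].
  by rewrite -(slice_id uz'); apply: Dt_slice; exact: (Om_WO Oz).
by rewrite -!rho_jet//; exact: (eqm_jet (xy t) jk).
Qed.

Let dduO w : dd w (uO N.+1) = smf_cst O' (uW w).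
Proof. exact: dd_linear uWL w. Qed.

Let uW_ex a : uW (ex a) = 0. Proof. exact: u_of_ex. Qed.
Let uW_eu : uW eu = 1. Proof. exact: u_of_eu. Qed.
Let uW_et : uW et = 0. Proof. by rewrite /uW /= u_ofE mxE. Qed.

Let dds w : dd w s = - (lamO N.+1 * smf_cst O' (uW w)).
Proof.
rewrite /sO (derivB (dd_derivation _ _)) (deriv1 (dd_derivation _ _)) sub0r.
by rewrite (deriv_mulr_cst (dd_derivation _ _)) ?dd_cst// dduO.
Qed.

Let Jtan (w : W) : uW w = 0 -> forall k (x : smf O'), JO k x -> JO k (dd w x).
Proof. by move=> uw k x; apply: Jn_deriv => h z uz; rewrite uWL uw mulr0 add0r. Qed.

(** One order is lost: the u-derivative of the model of order N + 1 has the right jets up to order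
    N. *)
Let evG a b : eqm (JO N) (s * du (GG a b)) (2 * PO N.+1 a b).
Proof.
have sN := smooth_all N.+1.
apply: J_slices => t; have hJ := Jn_ideal (Dt N.+1 t) (@u_of R n) 'e_iu N.
have E1 : eqm (J N) (rho N.+1 t (du (GG a b))) (rD N.+1 t (dd 'e_iu (G t a b))).
  by rewrite /rho /rD -!res_dd; apply: eqm_Jn_du; exact: agreeG.
have E2 : eqm (J N) (rD N.+1 t (dd 'e_iu (G t a b))) (rho N.+1 t (sOV N.+1 * (2 * PO N.+1 a b))).
  by exact: (Jn_S (flowG t a b sN)).
have := eqmM hJ (eqm_refl hJ (rho N.+1 t s)) (eqm_trans hJ E1 E2).
rewrite -!rhoM => E; apply: (eqm_trans hJ) E _; apply: eqm_eq => //; congr (rho _ _ _).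
by rewrite mulrA [s * _]mulrC smf_mulV mul1r.
Qed.

Let evf : eqm (JO N) (2 * s * du ff) (QO N.+1).
Proof.
have sN := smooth_all N.+1.
apply: J_slices => t; have hJ := Jn_ideal (Dt N.+1 t) (@u_of R n) 'e_iu N.
have E1 : eqm (J N) (rho N.+1 t (du ff)) (rD N.+1 t (dd 'e_iu (f t))).
  by rewrite /rho /rD -!res_dd; apply: eqm_Jn_du; exact: agreef.
have E2 : eqm (J N) (rD N.+1 t (dd 'e_iu (f t))) (rho N.+1 t (sOV N.+1 * (hfO N.+1 * QO N.+1))).
  by exact: (Jn_S (flowf t sN)).
have := eqmM hJ (eqm_refl hJ (rho N.+1 t (2 * s))) (eqm_trans hJ E1 E2).
rewrite -!rhoM => E; apply: (eqm_trans hJ) E _; apply: eqm_eq => //; congr (rho _ _ _).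
have h2 : 2 * hfO N.+1 = 1 by exact: smf_half.
transitivity ((sOV N.+1 * s) * (2 * hfO N.+1) * QO N.+1); first by ring.
by rewrite smf_mulV h2 !mul1r.
Qed.

(** The potential at u = 0, extended constantly in u, so that its velocity [om] has no
    u-derivative. *)
Definition ph : smf O' := rO N.+1 (smf_of WO (the 0)).
Definition om : smf O' := dt ph.

Let phE p : O' p -> ph p = Phi p.1 (chart_param i (x_of p.2)).
Proof.
move=> Op; have Wp := Om_WO Op; rewrite resE// (smf_ofE the0_smooth)//.
exact: the0E.
Qed.

Let du_ph : du ph = 0.
Proof. by rewrite /ph /rO res_dd dcoef ?res0//; exact: the_slice. Qed.

Let du_om : du om = 0. Proof. by rewrite /om ddC du_ph (deriv0 (dd_derivation _ _)). Qed.

Let eta j a b (p : W) : R := iter j du (HH a b) (AS p).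
Let eta_smooth j a b : smooth_on WO (eta j a b). Proof. exact: AS_smooth. Qed.

(** A counterpart of [time_prim] that is smooth in [t] as well. *)
Definition prim a b : smf O' :=
  rO N.+1 (taylor uS N.+1 (fun j => if j is j'.+1 then mksmf (eta_smooth j' a b) else 0)).

Let deta j a b : dd eu (mksmf (eta_smooth j a b)) = 0.
Proof.
apply: dd_invariant => p k; rewrite /eta /AS /=.
by rewrite slice_eu scaler0 add0r.
Qed.

Let prim0 a b : JO 0 (prim a b).
Proof.
split=> // p Op up; have Wp := Om_WO Op; rewrite resE// (taylor_at0 eu uSE)//.
exact: ev0.
Qed.

Let du_prim a b : eqm (JO N) (du (prim a b)) (HH a b).
Proof.
rewrite /prim /rO res_dd (dd_taylor duS); last first.
  by case=> [|j]; [rewrite (deriv0 (dd_derivation _ _))|exact: deta].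
apply: jet_eqm => j jN z Oz uz; have Wz := Om_WO Oz; rewrite res_iter resE//.
rewrite (taylor_jet uSE duS)//.
rewrite mksmfE//.
by rewrite /eta /AS (slice_id uz) -surjective_pairing.
Qed.

Let X c : smf O' := \sum_b prim c b * e b om.

Let X0 c : JO 0 (X c).
Proof. by apply: ideal_sum => // b; rewrite mulrC; exact: (idealM (hJO 0) _ (prim0 _ _)). Qed.

Let du_X c : eqm (JO N) (du (X c)) (\sum_b HH c b * e b om).
Proof.
rewrite /X (deriv_sum (dd_derivation _ _)); apply: eqm_sum => // b.
rewrite (derivM (dd_derivation _ _)) [du (e b om)]ddC du_om (deriv0 (dd_derivation _ _)) mulr0 addr0.
exact: (eqmM (hJO N) (du_prim c b) (eqm_refl (hJO N) _)).
Qed.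

Definition Vh : smf O' := volume_density ff (@Gh_det N.+1).

Local Notation DD := (Ddr e dt X).
Local Notation BB := (Bdr e X).

Let hd w : derivation (dd w : smf O' -> smf O'). Proof. exact: dd_derivation. Qed.

Let dtG0 a b : JO 0 (dt (GG a b)).
Proof.
(* At u = 0 the metric is [g] at every time. Subtracting it leaves a function that vanishes there,
   and [dt] is tangent to u = 0. *)
have -> : dt (GG a b) = dt (GG a b - rO N.+1 (mksmf (gW_smooth a b))).
  rewrite (derivB (hd _)) [dt (rO _ _)]res_dd dd_invariant ?res0 ?subr0// => p k.
  by rewrite /= scaler0 add0r.
apply: Jtan; first exact: uW_et.
split=> // p Op up; have Wp := Om_WO Op.
by rewrite evB// mxE !resE// Gh0_at0// mksmfE// subrr.
Qed.

Let dtf0 : JO 0 (dt ff - om).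
Proof.
rewrite /om -(derivB (hd _)); apply: Jtan; first exact: uW_et.
split=> // p Op up; have Wp := Om_WO Op.
rewrite evB// phE// resE// (taylor_at0 eu uSE)// (smf_ofE the0_smooth)//.
by rewrite the0E// subrr.
Qed.

Let s1_0 : JO 0 (s - 1).
Proof. by split=> // p Op up; rewrite evB// sOE// ev1// up mulr0 subr0 subrr. Qed.

Let Je k a (x : smf O') : JO k x -> JO k (dd (ex a) x).
Proof. by apply: Jtan; exact: uW_ex. Qed.
Let Jt k (x : smf O') : JO k x -> JO k (dt x).
Proof. by apply: Jtan; exact: uW_et. Qed.

Let XE0 x : JO 0 (\sum_c X c * dd (ex c) x).
Proof. by apply: ideal_sum => // c; rewrite mulrC; apply: idealM. Qed.

Let cst0 : smf_cst O' 0 = 0. Proof. by []. Qed.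
Let cst1 : smf_cst O' 1 = 1. Proof. by []. Qed.
Let ds_u : du s = - lamO N.+1. Proof. by rewrite dds uW_eu cst1 mulr1. Qed.
Let ds_t : dt s = 0. Proof. by rewrite dds uW_et cst0 mulr0 oppr0. Qed.
Let ds_e a : dd (ex a) s = 0. Proof. by rewrite dds uW_ex cst0 mulr0 oppr0. Qed.

Let sJ k (x : smf O') : JO k (s * x) -> JO k x.
Proof.
by move=> /(idealM (hJO k) (sOV N.+1)); rewrite mulrA smf_mulV mul1r.
Qed.

(** Induction on the order. At order 0 the claims hold since g_0 is fixed and, at u = 0, X vanishes
    and [s] is 1. The evolution lemmas then gain one order at a time, as far as the model satisfies
    the flow. *)
Let variation k : (k <= N.+1)%N ->
  (forall a b, eqm (JO k) (DD (GG a b)) ((BB *m GG + GG *m BB^T) a b)) /\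
  eqm (JO k) (DD ff) (s * om).
Proof.
have base1 a b : eqm (JO 0) (DD (GG a b)) ((BB *m GG + GG *m BB^T) a b).
  apply: (eqm_trans (hJO 0) (y := 0)).
    rewrite /eqm subr0 /Ddr; exact: (idealD (hJO 0) (dtG0 a b) (idealN (hJO 0) (XE0 _))).
  apply: eqm_sym => //; rewrite /eqm subr0 !mxE; apply: idealD => //; apply: ideal_sum => // c.
    by rewrite !mxE mulrC; apply: idealM => //; apply: Je; exact: X0.
  by rewrite !mxE; apply: idealM => //; apply: Je; exact: X0.
have base2 : eqm (JO 0) (DD ff) (s * om).
  have -> : s * om = om + (s - 1) * om by ring.
  apply: (eqmD (hJO 0) dtf0); rewrite /eqm -opprD; apply: idealN => //.
  by apply: (idealD (hJO 0) (XE0 _)); rewrite mulrC; exact: (idealM (hJO 0) _ s1_0).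
elim: k => [//|k IH kN]; have [IH1 IH2] := IH (ltnW kN).
have low (x y : smf O') : eqm (JO N) x y -> eqm (JO k) x y by exact: Jn_le.
have eC a b (x : smf O') : e a (e b x) = e b (e a x) by exact: ddC.
have dteC a (x : smf O') : dt (e a x) = e a (dt x) by exact: ddC.
have dueC a (x : smf O') : du (e a x) = e a (du x) by exact: ddC.
have dudtC (x : smf O') : du (dt x) = dt (du x) by exact: ddC.
have he a : derivation (e a) by exact: hd.
have Hsym : (HH)^T = HH by apply: metric_inv_sym; exact: Gh_sym.
have HG : HH *m GG = 1%:M by exact: metric_invl.
have GH : GG *m HH = 1%:M by exact: metric_invr.
have hE1 a b := low _ _ (evG a b).
have hE2 := low _ _ evf.
have hX c := low _ _ (du_X c).
have elam a : e a (lamO N.+1) = 0 by exact: dd_cst.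
have dtlam : dt (lamO N.+1) = 0 by exact: dd_cst.
split.
  move=> a b; apply: eqm_Jn_S => //.
  rewrite /eqm -(derivB (hd _)); apply: sJ.
  exact: (evolution_metric (smf_half O') he (hd et) (hd eu) eC dteC dueC dudtC (Gh_sym N.+1)
    Hsym HG GH (hJO k) (Je (k := k)) (Jt (k := k)) dtlam elam ds_t ds_e hE1 hX IH1 IH2).
apply: eqm_Jn_S => //.
rewrite /eqm -(derivB (hd _)); apply: sJ.
exact: (evolution_potential (smf_half O') he (hd et) (hd eu) eC dteC dueC dudtC (Gh_sym N.+1)
  Hsym HG GH (hJO k) (Je (k := k)) (Jt (k := k)) dtlam elam ds_u ds_t ds_e du_om hE2 hX IH1 IH2).
Qed.

Let volume_variation : eqm (JO N) (dt Vh) (\sum_a e a (Vh * X a) - s * om * Vh).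
Proof.
have [v1 v2] := variation (leqnSn N).
have he a : derivation (e a) by exact: hd.
have Hsym : (HH)^T = HH by apply: metric_inv_sym; exact: Gh_sym.
have GH : GG *m HH = 1%:M by exact: metric_invr.
have dV w := dd_volume_density ff (Gh_sym N.+1) (@Gh_det N.+1) w.
exact: (evolution_volume (smf_half O') he (Gh_sym N.+1) Hsym GH (hJO N) v1 v2 (dV et) (fun c => dV (ex c))).
Qed.

(** The jets of [volume_variation] are evaluated at u = 0, where [s] is 1; the u-derivative of the
    factor [s] produces the term of index k - 1. *)
Lemma density_variation k p : (k <= N)%N -> O' p -> uW p = 0 ->
  dt (iter k du Vh) p =
  \sum_a dd (ex a) (iter k du (Vh * X a)) p
  - om p * (iter k du Vh p - k%:R * lambda * iter k.-1 du Vh p).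
Proof.
move=> kN Op up; rewrite iter_ddC (eqm_jet volume_variation kN)//.
rewrite iter_ddD iter_ddN iter_dd_sum evB// ev_sum//; congr (_ - _).
  by apply: eq_bigr => a _; rewrite iter_ddC.
have -> : s * om * Vh = om * (s * Vh) by ring.
rewrite iter_ddM_cst// (iter_dd_affine _ _ ds_u); last exact: dd_cst.
rewrite evM// evB// !evM// ev_natr// ev_cst// sOE// up.
by rewrite mulr0 subr0 mul1r.
Qed.

(** As [om] is constant in u, its derivatives factor out of the jet and the flux is linear in
    them. *)
Lemma density_flux k p a : O' p ->
  iter k du (Vh * X a) p = \sum_b iter k du (Vh * prim a b) p * dd (ex b) om p.
Proof.
move=> Op; rewrite /X mulr_sumr iter_dd_sum ev_sum//; apply: eq_bigr => b _.
have -> : Vh * (prim a b * e b om) = e b om * (Vh * prim a b) by ring.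
rewrite iter_ddM_cst; last by rewrite ddC du_om (deriv0 (hd _)).
by rewrite evM// mulrC.
Qed.

Let agreeV t : eqm (J N.+1) (rho N.+1 t Vh) (rD N.+1 t (time_volume (hF t) Ox0)).
Proof.
have sN := smooth_all N.+1.
have GGe c d : eqm (J N.+1) (map_mx (rho N.+1 t) GG c d) (map_mx (rD N.+1 t) (G t) c d).
  by rewrite mxE [X in eqm _ _ X]mxE; exact: agreeG.
have dV1 : dd 'e_iu (rho N.+1 t Vh) = rho N.+1 t Vh * (smf_cst (Dt N.+1 t) 2^-1 *
    \sum_a \sum_b map_mx (rho N.+1 t) HH a b * dd 'e_iu (map_mx (rho N.+1 t) GG a b)
    - dd 'e_iu (rho N.+1 t ff)).
  rewrite [LHS]res_dd (dd_volume_density ff (Gh_sym N.+1) (@Gh_det N.+1)).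
  by rewrite res_logder res_cst.
have dV2 : dd 'e_iu (rD N.+1 t (time_volume (hF t) Ox0)) = rD N.+1 t (time_volume (hF t) Ox0) *
    (smf_cst (Dt N.+1 t) 2^-1 * \sum_a \sum_b map_mx (rD N.+1 t) (time_inv (hF t) Ox0) a b *
       dd 'e_iu (map_mx (rD N.+1 t) (G t) a b) - dd 'e_iu (rD N.+1 t (f t))).
  rewrite [LHS]res_dd (dd_volume_density _ (time_metric_sym (hF t) Ox0)).
  by rewrite res_logder res_cst.
apply: (eqm_volume (GHr N.+1 t) (GHd N.+1 t) dV1 dV2 GGe (agreef t sN)).
apply: jet_eqm => j; rewrite leqn0 => /eqP -> z Dz uz; have Oz := Dt_Om Dz; have Dz' := Dt_D Dz.
transitivity (Vh (t, z)); first exact: resE.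
transitivity (time_volume (hF t) Ox0 z); last exact/esym/resE.
rewrite !volume_densityE//.
have fE : ff (t, z) = f t z.
  transitivity (rho N.+1 t ff z); first exact/esym/resE.
  by apply: etrans (eqm_jet (agreef t sN) (leq0n _) Dz uz) _; exact: resE.
rewrite fE !ev_det//; congr (_ * Num.sqrt (\det _)); apply/matrixP => a b.
rewrite mxE [RHS]mxE.
transitivity (rho N.+1 t (GG a b) z); first exact/esym/resE.
by apply: etrans (eqm_jet (agreeG t a b sN) (leq0n _) Dz uz) _; exact: resE.
Qed.

Lemma density_slice t k q : (k <= N.+1)%N -> chart_img i (x_of q) -> u_of q = 0 ->
  iter k du Vh (t, q) = iter k (dd 'e_iu) (time_volume (hF t) Ox0) q.
Proof.
move=> kN Oq uq; have Dz : Dt N.+1 t q by rewrite -(slice_id uq); exact: Dt_slice.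
by rewrite -rho_jet// -(rD_jet (N := N.+1))//; exact: (eqm_jet (agreeV t) kN).
Qed.

Let agree_prim t a b : eqm (J N) (rho N.+1 t (prim a b)) (rD N.+1 t (time_prim (hF t) Ox0 N a b)).
Proof.
have sN := smooth_all N.+1; have hJ := Jn_ideal (Dt N.+1 t) (@u_of R n) 'e_iu N.
have GGe c d : eqm (J N) (map_mx (rho N.+1 t) GG c d) (map_mx (rD N.+1 t) (G t) c d).
  by rewrite mxE [X in eqm _ _ X]mxE; exact: (Jn_S (agreeG t c d sN)).
(* Equal values at u = 0 together with u-derivatives congruent to order N give order N + 1, one more
   than claimed. *)
apply: Jn_S; apply: eqm_Jn_S.
  apply: jet_eqm => j; rewrite leqn0 => /eqP -> z Dz uz; have Oz := Dt_Om Dz; have Dz' := Dt_D Dz.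
  transitivity (prim a b (t, z)); first exact: resE.
  transitivity (time_prim (hF t) Ox0 N a b z); last exact/esym/resE.
  by rewrite time_prim0//; have [h _] := prim0 a b; exact: (h (t, z) Oz uz).
rewrite [X in eqm _ X _]res_dd [X in eqm _ _ X]res_dd.
apply: (eqm_trans hJ (y := rho N.+1 t (HH a b))).
  rewrite /eqm -(resB (tL t) (@tC t) (@Dt_Om N.+1 t)).
  exact: (Jn_res (tL t) (@tC t) (@Dt_Om N.+1 t) (u := uW) (du_prim a b)).
apply: (eqm_trans hJ (y := rD N.+1 t (time_inv (hF t) Ox0 a b))).
  have := eqm_inverse hJ (GHr N.+1 t) (GHd N.+1 t) GGe a b.
  by rewrite mxE [X in eqm _ _ X]mxE.
apply: eqm_sym => //; rewrite /eqm -(resB (idL (V := Q)) (@idC Q) (@Dt_D N.+1 t)).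
exact: (Jn_res (idL (V := Q)) (@idC Q) (@Dt_D N.+1 t) (u := @u_of R n) (du_time_prim (hF t) Ox0 N a b)).
Qed.

(** The coefficients of the flux are computed from the ambient metric at time [t] alone, so they do
    not depend on the curve passing through that potential. *)
Lemma flux_slice t k q a b : (k <= N)%N -> chart_img i (x_of q) -> u_of q = 0 ->
  iter k du (Vh * prim a b) (t, q) =
  iter k (dd 'e_iu) (time_volume (hF t) Ox0 * time_prim (hF t) Ox0 N a b) q.
Proof.
move=> kN Oq uq; have Dz : Dt N.+1 t q by rewrite -(slice_id uq); exact: Dt_slice.
have hJ := Jn_ideal (Dt N.+1 t) (@u_of R n) 'e_iu N.
rewrite -rho_jet// -(rD_jet (N := N.+1))// rhoM rDM.
exact: (eqm_jet (eqmM hJ (Jn_S (agreeV t)) (agree_prim t a b)) kN Dz uq).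
Qed.

Lemma Om_point t q : chart_img i (x_of q) -> u_of q = 0 -> O' (t, q).
Proof. by move=> Oq uq; rewrite -(slice_id uq); exact: Om_slice. Qed.

Lemma omE p : O' p -> om p = 'D_1 (fun t => Phi t (chart_param i (x_of p.2))) p.1.
Proof.
move=> Op.
apply: etrans (dd_eq et (f := ph) (g := fun p => Phi p.1 (chart_param i (x_of p.2))) Op phE) _.
rewrite /derive; under eq_fun do rewrite /= scaler0 add0r.
by [].
Qed.

End FixedOrder.

End ChartFamily.

Section LineDerivatives.
Context {R : realType} {V : normedModType R} {O : domain (V := V)}.

Lemma derive1n_smf_line (f : smf O) (z w : V) (b : R -> R) k : O z ->
  (\forall h \near (0 : R), b h = f (h *: w + z)) ->
  derive1n k b 0 = iter k (dd w) f z.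
Proof.
(* The identity is proved on a neighbourhood of 0, since the induction differentiates it. *)
move=> Oz bf; suff H : \forall h \near (0 : R), derive1n k b h = iter k (dd w) f (h *: w + z).
  by rewrite (nbhs_singleton H) scale0r add0r.
have cl : continuous (fun h : R => h *: w + z).
  by move=> h; apply: cvgD; [apply: cvgZr_tmp; exact: cvg_id|exact: cvg_cst].
have nO : \forall h \near (0 : R), O (h *: w + z).
  by apply: (cl 0 O); rewrite scale0r add0r; exact: near_dom.
elim: k => [//|k IH]; have IH' := nbhs_interior IH.
near=> h; rewrite derive1nS derive1E.
have nh : \near h, derive1n k b h = iter k (dd w) f (h *: w + z) by near: h.
rewrite (near_eq_derive _ nh) /=; apply: derive_val.
by apply: is_derive_smf_line; near: h.
Unshelve. all: by end_near.
Qed.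

End LineDerivatives.

(** * The coefficients v_k in a chart *)

Section ChartDensity.
Context {R : realType} {n : nat} {M : ptopologicalType} {A : atlas R n M}.
Variables (g : components A) (lambda : R).
Local Notation Q := 'rV[R]_(1 + n + 1).

(** The coefficient of u^j in e^{-phi_u} sqrt (det g_u), in the coordinates of the chart [i]. *)
Definition density_coef (phi : M -> R) (F : wfamily A) (j : nat) (i : chart_index A)
    (x : 'rV[R]_n) : R :=
  v_coef g lambda phi F j (chart_param i x) * expR (- phi (chart_param i x))
  * Num.sqrt (\det (g i x)).

Lemma chart_paramP (i : chart_index A) x : chart_img i x -> chart_dom i (chart_param i x).
Proof. by case=> p pi <-; rewrite coordK. Qed.

Lemma chart_paramK (i : chart_index A) x : chart_img i x -> chart_coord i (chart_param i x) = x.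
Proof. by case=> p pi <-; rewrite coordK. Qed.

Lemma riemannian_det (hg : riemannian g) (i : chart_index A) x : chart_img i x -> 0 < \det (g i x).
Proof. by have [_ _ pg] := hg => Ox; have [gs gp] := pg i x Ox I; exact: posdef_det_gt0. Qed.

Lemma det_congruence m (B C : 'M[R]_m) : \det (B *m C *m B^T) = \det B ^+ 2 * \det C.
Proof. by rewrite !det_mulmx det_tr expr2; ring. Qed.

Lemma density_coefE (phi : M -> R) (F : wfamily A) (hF : normal_ambient g lambda phi F)
    (i : chart_index A) (x0 : 'rV[R]_n) (Ox0 : chart_img i x0) j x : chart_img i x ->
  density_coef phi F j i x =
    j`!%:R^-1 * iter j (dd 'e_iu) (time_volume hF Ox0) (ambient_point 0 x 0).
Proof.
move=> Ox; have [[U [[oU U0] _ _ pd [m0 f0]]] _ _] := hF.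
have hap (h : R) : h *: 'e_iu + ambient_point 0 x 0 = ambient_point 0 x h :> Q.
  by apply: row_ext; rewrite ?v_ofL ?x_ofL ?u_ofL ?v_ap ?x_ap ?u_ap ?v_of_eu ?x_of_eu ?u_of_eu
    ?mulr0 ?mulr1 ?scaler0 ?addr0 ?add0r.
set D := time_domain hF Ox0; set V := time_volume hF Ox0; set p := chart_param i x.
have D0 : D (ambient_point 0 x 0).
  rewrite -(@slice_id R n (ambient_point 0 x 0)) ?u_ap//.
  by apply: time_domain_slice; rewrite x_ap.
set c := chart_at A p; set y := chart_coord c p.
have cp : chart_dom c p by exact: chart_atP.
(* [v_phi] is computed in the chart attached to the point. Passing to the chart [i] multiplies both
   determinants by the same squared Jacobian, so their ratio is unchanged. *)
have detg u : U (u, p) -> exists2 d, 0 < d &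
    \det (metric_at F u i x) = d * \det (metric_at F u c y) /\
    \det (g i x) = d * \det (g c y).
  move=> Uu; have [tu pu] := pd u; have [t0 p0] := pd 0.
  have [gs gp] := p0 i x Ox (U0 p); have pos := posdef_det_gt0 gs gp.
  move: (t0 i c x Ox (U0 p) cp); rewrite /= -/p -/y => E0.
  move: (tu i c x Ox Uu cp); rewrite /= -/p -/y => E1.
  set J := 'J _ _ in E0 E1; exists (\det J ^+ 2).
    rewrite lt0r sqr_ge0 andbT; apply/eqP => d0.
    by move: pos; rewrite E0 det_congruence d0 mul0r ltxx.
  split; first by rewrite E1 det_congruence.
  rewrite -!m0//; first by rewrite E0 det_congruence.
  by exists p.
have gpos : 0 < \det (g i x).
  have [t0 p0] := pd 0; have [gs gp] := p0 i x Ox (U0 p).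
  by rewrite -m0//; exact: posdef_det_gt0.
have Vap u : D (ambient_point 0 x u) ->
    V (ambient_point 0 x u) = expR (- fun_at F u p) * Num.sqrt (\det (metric_at F u i x)).
  move=> Du; rewrite /V /time_volume volume_densityE// time_potE// time_metric_det//.
  by rewrite x_ap u_ap.
(* The factor between [v_phi] and the density [V]; it does not depend on u and passes through the
   derivatives. *)
set cc := expR (- phi p) * Num.sqrt (\det (g i x)).
have cc0 : cc != 0 by rewrite mulf_neq0 ?gt_eqF ?expR_gt0 ?sqrtr_gt0.
rewrite /density_coef -/p -mulrA -/cc; case: j => [|j].
  rewrite mul1r fact0 invr1 mul1r; apply: esym; transitivity (V (ambient_point 0 x 0)) => //.
  by rewrite Vap// f0 m0.
rewrite -mulrA; congr (_ * _).
have cD u : D u -> smf_cst D cc^-1 u = cc^-1 by move=> Du; rewrite ev_cst.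
transitivity (cc * iter j.+1 (dd 'e_iu) (smf_cst D cc^-1 * V) (ambient_point 0 x 0)); last first.
  by rewrite iter_ddM_cst ?dd_cst// evM// cD// mulrA mulfV// mul1r.
rewrite mulrC; congr (_ * _); apply: derive1n_smf_line => //.
have nD : \forall h \near (0 : R), D (h *: 'e_iu + ambient_point 0 x 0).
  have cl : continuous (fun h : R => h *: 'e_iu + ambient_point 0 x 0 : Q).
    by move=> h; apply: cvgD; [apply: cvgZr_tmp; exact: cvg_id|exact: cvg_cst].
  by apply: (cl 0 D); rewrite scale0r add0r; exact: (near_dom D0).
have nU : \forall h \near (0 : R), U (h, p).
  have ch : {for 0, continuous (fun h : R => (h, p))}.
    by apply: pair_continuous; [exact: cvg_id|exact: cst_continuous].
  by apply: (ch U); apply: open_nbhs_nbhs.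
near=> h.
have Dh : D (h *: 'e_iu + ambient_point 0 x 0) by near: h.
have Uh : U (h, p) by near: h.
apply: etrans (esym (evM Dh _ _)); rewrite (cD _ Dh).
have VE : V (h *: 'e_iu + ambient_point 0 x 0) =
    expR (- fun_at F h p) * Num.sqrt (\det (metric_at F h i x)).
  by rewrite hap; apply: Vap; rewrite -hap.
rewrite VE.
have [d d0 [E1 E2]] := detg h Uh.
have gc : \det (g c y) != 0 by apply: contraTneq gpos => g0; rewrite E2 g0 mulr0 ltxx.
rewrite /v_phi -/c -/y /ambient_fun mulr0 addr0 subr0.
have -> : \det (metric_at F h c y) / \det (g c y) = \det (metric_at F h i x) / \det (g i x).
  by rewrite E1 E2; field; rewrite gc lt0r_neq0.
rewrite sqrtrM; last first.
  have [_ ph] := pd h; have [gs gp] := ph i x Ox Uh.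
  by apply: ltW; exact: posdef_det_gt0.
rewrite sqrtrV ?ltW// /cc; field.
by rewrite !gt_eqF ?expR_gt0 ?sqrtr_gt0.
Unshelve. all: by end_near.
Qed.

End ChartDensity.

Section ChartVariation.
Context {R : realType} {n : nat} {M : ptopologicalType} {A : atlas R n M}.
Variables (g : components A) (lambda : R).
Hypothesis hg : riemannian g.
Local Notation Q := 'rV[R]_(1 + n + 1).
Local Notation W := (R * 'rV[R]_(1 + n + 1))%type.

Let tap (q : R * 'rV[R]_n) : W := (q.1, ambient_point 0 q.2 0).
Let tapL (h : R) (w q : R * 'rV[R]_n) : tap (h *: w + q) = h *: tap w + tap q.
Proof. by rewrite /tap ambient_pointL. Qed.
Let tap_continuous : continuous tap.
Proof.
move=> q; apply: pair_continuous; first exact: fst_continuous.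
apply: (@continuous_comp _ _ _ snd (fun x : 'rV[R]_n => ambient_point 0 x 0)).
  exact: snd_continuous.
exact: ambient_point_continuous.
Qed.

Definition joint_dom (i : chart_index A) := [set q : R * 'rV[R]_n | chart_img i q.2].

Lemma joint_dom_open (i : chart_index A) : open (joint_dom i).
Proof.
by apply: (open_comp (f := snd)); [move=> p _; exact: snd_continuous|exact: img_open].
Qed.

Section Curve.
Variables (Phi : R -> M -> R) (F : R -> wfamily A).
Hypothesis hF : forall t, normal_ambient g lambda (Phi t) (F t).
Variables (i : chart_index A).
Hypothesis hPhi : smooth_on (joint_dom i) (fun q => Phi q.1 (chart_param i q.2)).
Variables (x0 : 'rV[R]_n) (Ox0 : chart_img i x0) (j : nat).

Let O' := Om hg hF Ox0 j.+1.
Let V : smf O' := Vh hg hF Ox0 j.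
Let du := dd ((0 : R), ('e_iu : Q)) : smf O' -> smf O'.

Let Otap (q : R * 'rV[R]_n) : chart_img i q.2 -> O' (tap q).
Proof. by move=> Oq; apply: Om_point; rewrite ?x_ap ?u_ap. Qed.

Let densE k (q : R * 'rV[R]_n) : (k <= j.+1)%N -> chart_img i q.2 ->
  density_coef g lambda (Phi q.1) (F q.1) k i q.2 = k`!%:R^-1 * iter k du V (tap q).
Proof.
move=> kj Oq; rewrite (density_coefE (hF q.1) Ox0)//; congr (_ * _).
apply/esym; apply: (density_slice hg hF Ox0 hPhi q.1 kj); first by rewrite x_ap.
exact: u_ap.
Qed.

Lemma density_coef_smooth : smooth_on (joint_dom i)
  (fun q => density_coef g lambda (Phi q.1) (F q.1) j i q.2).
Proof.
move=> k; apply: (eq_Ck_on (@joint_dom_open i)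
    (f := fun q => j`!%:R^-1 * (iter j du V (tap q)))).
  by move=> q /set_mem Oq; rewrite densE.
apply: Ck_onM; [exact: joint_dom_open|exact: Ck_on_cst|].
exact: (Ck_on_affine tapL tap_continuous Otap (smf_smooth (iter j du V) k)).
Qed.

Let ddx (f : smf O') t (x : 'rV[R]_n) a : chart_img i x ->
  dd ((0 : R), ('e_(ix a) : Q)) f (tap (t, x)) = partial a (fun y => f (tap (t, y))) x.
Proof.
move=> Ox; rewrite ddE; last exact: Otap.
rewrite -ambient_point_ex /partial.
apply: esym; apply: (@derive_affine _ _ _ _ _ (fun y => tap (t, y)) (fun y => tap (0, y))) => h.
by rewrite -tapL; congr (tap (_, _)); rewrite /= scaler0 add0r.
Qed.

Let nimg (x : 'rV[R]_n) : chart_img i x -> \forall y \near x, chart_img i y.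
Proof. by move=> Ox; apply: open_nbhs_nbhs; split=> //; exact: img_open. Qed.

Lemma density_coef_variation x : (0 < j)%N -> chart_img i x ->
  'D_1 (fun t => density_coef g lambda (Phi t) (F t) j i x) 0 =
  \sum_a partial a (fun x => \sum_b
     (j`!%:R^-1 * iter j (dd 'e_iu) (time_volume (hF 0) Ox0 * time_prim (hF 0) Ox0 j a b)
         (ambient_point 0 x 0)) *
     partial b (fun x => 'D_1 (fun t => Phi t (chart_param i x)) 0) x) x
  - 'D_1 (fun t => Phi t (chart_param i x)) 0 *
    (density_coef g lambda (Phi 0) (F 0) j i x -
     lambda * density_coef g lambda (Phi 0) (F 0) j.-1 i x).
Proof.
move=> hj Ox; have O0 : O' (tap (0, x)) by exact: Otap.
have omx y : chart_img i y ->
    om hg hF Ox0 j (tap (0, y)) = 'D_1 (fun t => Phi t (chart_param i y)) 0.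
  by move=> Oy; rewrite (omE hPhi (Otap (q := (0, y)) Oy)) /= x_ap.
have -> : 'D_1 (fun t => density_coef g lambda (Phi t) (F t) j i x) 0 =
    j`!%:R^-1 * dd ((1 : R), (0 : Q)) (iter j du V) (tap (0, x)).
  transitivity (dd ((1 : R), (0 : Q)) (smf_cst O' j`!%:R^-1 * iter j du V) (tap (0, x))).
    rewrite ddE//; transitivity ('D_1 ((smf_cst O' j`!%:R^-1 * iter j du V) \o (fun t => tap (t, x))) 0).
      congr (derive _ (0 : R) (1 : R)); apply/funext => t.
      have Ot : O' (tap (t, x)) by exact: Otap.
      rewrite (densE (q := (t, x)) (leqnSn j) Ox); apply: esym.
      by apply: etrans (evM Ot _ _) _; rewrite ev_cst.
    apply: (@derive_affine _ _ _ _ _ (fun t => tap (t, x)) (fun t => (t, 0) : W)) => h.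
    by rewrite /tap; congr (_, _); rewrite /= scaler0 add0r.
  by rewrite (deriv_mulr_cst (dd_derivation _ _)) ?dd_cst// evM// ev_cst.
have up : uW (tap (0, x)) = 0 by exact: u_ap.
rewrite (density_variation hPhi (leqnn j) O0 up) mulrBr mulr_sumr; congr (_ - _).
  apply: eq_bigr => a _; set h := iter j _ _.
  transitivity (dd ((0 : R), ('e_(ix a) : Q)) (smf_cst O' j`!%:R^-1 * h) (tap (0, x))).
    by rewrite (deriv_mulr_cst (dd_derivation _ _)) ?dd_cst// evM// ev_cst.
  rewrite ddx//; apply: near_eq_derive; apply: filterS (nimg Ox) => y Oy.
  have Oty : O' (tap (0, y)) by exact: Otap.
  rewrite evM// ev_cst// /h (density_flux j a Oty) mulr_sumr; apply: eq_bigr => b _.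
  rewrite (flux_slice hg hF Ox0 hPhi 0 a b (leqnn j)) ?x_ap ?u_ap//.
  rewrite mulrA; congr (_ * _); rewrite ddx//.
  by apply: near_eq_derive; apply: filterS (nimg Oy) => z; exact: omx.
rewrite omx// mulrCA; congr (_ * _); rewrite mulrBr.
rewrite -(densE (q := (0, x)) (leqnSn j) Ox); congr (_ - _).
(* Here j / j! = 1 / (j - 1)!, so the factor j of the affine Leibniz rule normalises the coefficient
   of index j - 1. *)
rewrite (densE (q := (0, x)) (leqW (leq_pred j)) Ox) -{1}(prednK hj) factS (prednK hj) natrM.
by rewrite -[tap _]/(tap (0, x)); field; rewrite !pnatr_eq0 -!lt0n fact_gt0 hj.
Qed.

End Curve.

End ChartVariation.

(** * Lebesgue measure on R^n *)

Section BorelMeasurability.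
Context {R : realType}.

Lemma open_borel {V : ptopologicalType} (U : set V) : open U -> measurable (U : set (borel V)).
Proof. by move=> oU; exact: sub_gen_smallest. Qed.

Lemma continuous_open_preimage {V W : topologicalType} (U : set V) (f : V -> W) (B : set W) :
  open U -> (forall x, U x -> {for x, continuous f}) -> open B -> open (U `&` f @^-1` B).
Proof.
move=> oU cf oB; rewrite openE => x [Ux Bx]; rewrite /interior.
apply: filterI; first exact: open_nbhs_nbhs.
by apply: (cf x Ux B); exact: open_nbhs_nbhs.
Qed.

Lemma continuous_borel {V W : ptopologicalType} (U : set V) (f : V -> W) : open U ->
  (forall x, U x -> {for x, continuous f}) ->
  measurable_fun (U : set (borel V)) (f : borel V -> borel W).
Proof.
move=> oU cf; apply: (@measurability _ _ (borel V) (borel W) _ _ (@open W)) => //.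
by move=> _ [B oB <-]; apply: open_borel; exact: continuous_open_preimage.
Qed.

Lemma continuous_borel_real {V : ptopologicalType} (U : set V) (f : V -> R) : open U ->
  (forall x, U x -> {for x, continuous f}) ->
  measurable_fun (U : set (borel V)) (f : borel V -> R).
Proof.
move=> oU cf; apply: (measurability _ (RGenOpens.measurableE R)).
move=> _ [_ [a [b ->] <-]]; by apply: open_borel; apply: continuous_open_preimage => //; exact: interval_open.
Qed.

End BorelMeasurability.

Section SigmaFinite.
Context d (T : measurableType d) (R : realType) (mu : {measure set T -> \bar R}).

(** A copy of [mu] that carries the proof in its name, so that the sigma-finite structure can be
    attached to it and used in product measures. *)
Definition as_sigma_finite of sigma_finite setT mu : set T -> \bar R := mu.

Variable sf : sigma_finite setT mu.
HB.instance Definition _ := Measure.on (as_sigma_finite sf).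
HB.instance Definition _ := Measure_isSigmaFinite.Build _ _ _ (as_sigma_finite sf) sf.

End SigmaFinite.

Section RowSpaceMeasure.
Context {R : realType}.
Local Notation rV n := 'rV[R]_n.

Lemma ball_rowE n (x y : rV n) (e : R) : 0 < e ->
  ball x e y <-> forall a, `|x 0 a - y 0 a| < e.
Proof.
move=> e0; split=> [[_ xy] a|xy]; first exact: xy.
by split=> // i a; rewrite (ord1 i); exact: xy.
Qed.

Lemma ball_row_mx n (t s : R) (x y : rV n) (e : R) : 0 < e ->
  ball (row_mx t%:M x : rV (1 + n)) e (row_mx s%:M y : rV (1 + n)) <-> ball t e s /\ ball x e y.
Proof.
move=> e0; rewrite ball_rowE//; split=> [h|[ts /(ball_rowE _ _ e0) xy] a].
  split; first by have := h (lshift n 0); rewrite !row_mxEl !mxE eqxx.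
  by apply/ball_rowE => // a; have := h (rshift 1 a); rewrite !row_mxEr.
case: (split_ordP a) => b ->; last by rewrite !row_mxEr.
by rewrite !row_mxEl (ord1 b) !mxE eqxx.
Qed.

Let ratpt n := ({ffun 'I_n -> rat} * rat)%type.
Let ctr n (c : ratpt n) : rV n := \row_a ratr (c.1 a).

Lemma rational_ball n (U : set (rV n)) x : open U -> U x ->
  exists c : ratpt n, [/\ 0 < ratr c.2 :> R, ball (ctr c) (ratr c.2) x &
    ball (ctr c) (ratr c.2) `<=` U].
Proof.
rewrite openE => oU /oU /nbhs_ballP[e /= e0 eU].
have [r] := @rat_in_itvoo R 0 (e / 2) ltac:(by rewrite divr_gt0).
rewrite in_itv /= => /andP[r0 re].
have q a : exists q : rat, `|ratr q - x 0 a| < ratr r :> R.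
  have [q] := @rat_in_itvoo R (x 0 a - ratr r) (x 0 a + ratr r) ltac:(lra).
  by rewrite in_itv /= => qx; exists q; rewrite ltr_distl.
pose f := [ffun a => projT1 (cid (q a))].
have fP a : `|ratr (f a) - x 0 a| < ratr r :> R by rewrite ffunE; exact: projT2 (cid (q a)).
exists (f, r); split=> //; first by apply/ball_rowE => // a; rewrite mxE fP.
move=> y /(ball_rowE _ _ r0) /= yr; apply: eU; apply/ball_rowE => // a.
have := yr a; have := fP a; rewrite mxE /= => h1 h2.
have -> : x 0 a - y 0 a = (ratr (f a) - y 0 a) - (ratr (f a) - x 0 a) by ring.
by apply: le_lt_trans (ler_normB _ _) _; lra.
Qed.

Definition row_pair n (p : (measurableTypeR R * borel (rV n))%type) : borel (rV (1 + n)) :=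
  row_mx p.1%:M (p.2 : rV n).

(** The Borel sets of R^(1+n) are generated by open sets, the product sigma-algebra by rectangles;
    an open set is a countable union of boxes with rational centre and radius. *)
Lemma measurable_row_pair n : measurable_fun setT (@row_pair n).
Proof.
apply: (@measurability _ _ _ (borel (rV (1 + n))) _ _ (@open (rV (1 + n)))) => //.
move=> _ [U oU <-]; rewrite setTI.
pose I := {c : ratpt (1 + n) | `[< 0 < ratr c.2 :> R /\ ball (ctr c) (ratr c.2) `<=` U >]}.
pose box (c : ratpt (1 + n)) : set (measurableTypeR R * borel (rV n)) :=
  ball (ratr (c.1 (lshift n 0)) : R) (ratr c.2) `*`
  ball (\row_a ratr (c.1 (rshift 1 a)) : rV n) (ratr c.2).
have ctrE c : ctr c = row_mx (ratr (c.1 (lshift n 0)))%:M (\row_a ratr (c.1 (rshift 1 a))).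
  apply/rowP => a; case: (split_ordP a) => b ->; rewrite ?row_mxEl ?row_mxEr !mxE//.
  by rewrite (ord1 b) eqxx.
have -> : @row_pair n @^-1` U = \bigcup_(c : I) box (val c).
  apply/seteqP; split=> [[t x] /= Utx|[t x] [[c cP] _ [/= h1 h2]]].
    have [c [c0 cx cU]] := rational_ball oU Utx.
    have cP : `[< 0 < ratr c.2 :> R /\ ball (ctr c) (ratr c.2) `<=` U >] by apply/asboolP.
    exists (exist _ c cP) => //=; move: cx; rewrite ctrE.
    by move/(ball_row_mx _ _ _ _ c0).
  have /asboolP[c0 cU] := cP; apply: cU; rewrite ctrE.
  exact/(ball_row_mx _ _ _ _ c0).
apply: countable_bigcupT_measurable => [|c]; first exact: countableP.
have /asboolP[c0 _] := valP c.
apply: measurableX; first by apply: open_measurable; exact: ball_open.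
by apply: open_borel; exact: ball_open.
Qed.

(** [lebesgue_int] is an iterated integral without a measure. One that represents it is built by
    induction, pushing forward the product of Lebesgue measure and the measure in dimension n. The
    bounds on balls provide the sigma-finiteness that Tonelli requires. *)
Lemma row_measure n : exists mu : {measure set (borel (rV n)) -> \bar R},
  (forall (x : rV n) r, 0 < r -> (0 < mu (ball x r) < +oo)%E) /\
  (forall f : borel (rV n) -> \bar R, measurable_fun setT f -> (forall x, (0 <= f x)%E) ->
    (\int[mu]_x f x = lebesgue_int f)%E).
Proof.
elim: n => [|n [mu [mu_ball mu_int]]].
  have e0 (x : rV 0) : x = 0 by apply/rowP => -[].
  exists (@dirac _ (borel (rV 0)) (0 : rV 0) R); split=> [x r r0|f mf f0].
    by rewrite (e0 x) /= diracE mem_set ?lte01 ?ltry//; exact: ballxx.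
  by rewrite integral_dirac// diracT mul1e.
have mball (x : rV n) r : measurable (ball x r : set (borel (rV n))).
  by apply: open_borel; exact: ball_open.
have sf : sigma_finite setT mu.
  exists (fun k => ball (0 : rV n) k.+1%:R) => [|k]; last first.
    by split=> //; have /andP[] := mu_ball 0 k.+1%:R (ltr0Sn _ _).
  apply/seteqP; split=> // x _; exists (Num.Def.archi_bound `|x|) => //.
  rewrite -ball_normE /= sub0r normrN; apply: lt_trans (archi_boundP (normr_ge0 x)) _.
  by rewrite ltr_nat.
pose m : {sigma_finite_measure set (borel (rV n)) -> \bar R} := as_sigma_finite sf.
pose nu := measure_function_pushforward__canonical__measure_function_Measure
  (@lebesgue_measure R \x m)%E (@measurable_row_pair n).
exists nu; split=> [y r r0|f mf f0].
  pose t0 : R := y 0 (@lshift 1 n 0).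
  have -> : nu (ball y r) = (@lebesgue_measure R (ball t0 r) * m (ball (rsubmx (y : rV (1 + n))) r))%E.
    rewrite -(product_measure1E (@lebesgue_measure R) m)//; last exact: measurable_ball.
    have yE : y = row_mx t0%:M (rsubmx (y : rV (1 + n))) :> rV (1 + n).
      apply: etrans (esym (hsubmxK (y : rV (1 + n)))) _; congr row_mx.
      by apply/rowP => a; rewrite (ord1 a) !mxE eqxx.
    congr ((_ \x _)%E _); apply/seteqP; split=> -[t x] /=.
      by rewrite /row_pair {1}yE => /(ball_row_mx _ _ _ _ r0).
    by move=> h; rewrite /row_pair {1}yE; apply/(ball_row_mx _ _ _ _ r0).
  have /andP[m0 mfin] := mu_ball (rsubmx (y : rV (1 + n))) r r0.
  rewrite lebesgue_measure_ball ?ltW//; apply/andP; split.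
    by rewrite mule_gt0// lte_fin pmulrn_lgt0.
  by rewrite lte_mul_pinfty// ?lee_fin ?ltW ?mulrn_wgt0.
transitivity (\int[(@lebesgue_measure R \x m)%E]_z (f \o @row_pair n) z)%E.
  by apply: (ge0_integral_pushforward (@measurable_row_pair n)).
have mfr : measurable_fun setT (f \o @row_pair n).
  exact: (measurableT_comp mf (@measurable_row_pair n)).
rewrite fubini_tonelli1//; last by move=> p; exact: f0.
apply: eq_integral => t _; apply: (mu_int (fun x => f (row_pair (t, x)))) => //.
exact: (measurable_fun_pair2 t mfr).
Qed.

End RowSpaceMeasure.

(** * Differentiation under the integral sign *)

Section Integrals.
Context {R : realType}.

Lemma compact_fun_bound {T : topologicalType} (f : T -> R) (K : set T) :
  compact K -> continuous f -> exists2 C, 0 <= C & forall x, K x -> `|f x| <= C.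
Proof.
move=> cK cf; have [->|/set0P K0] := eqVneq K set0; first by exists 0.
have cn : continuous (fun x => `|f x|).
  by move=> x; apply: (@continuous_comp _ _ _ f (@Num.norm R R)); [exact: cf|exact: norm_continuous].
have [c _ cm] := compact_EVT_max K0 cK (continuous_subspaceT cn).
by exists `|f c| => // x /mem_set/cm.
Qed.

Lemma derivable_lipschitz (f : R -> R) (C b t : R) : 0 < b ->
  (forall s, derivable f s 1) -> (forall s, - b < s < b -> `|'D_1 f s| <= C) ->
  - b < t < b -> `|f t - f 0| <= C * `|t|.
Proof.
move=> b0 df dC /andP[t1 t2].
have hd (s : R) : is_derive s 1 f ('D_1 f s) by exact: derivableP.
have cf : continuous f by move=> s; apply/differentiable_continuous/derivable1_diffP.
have [t0|t0] := leP 0 t.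
  have [c] := @MVT_segment R f ('D_1 f) 0 t t0 (fun x _ => hd x) (continuous_subspaceT cf).
  rewrite in_itv /= => /andP[c0 ct] ->; rewrite subr0 normrM ler_wpM2r//.
  by apply: dC; lra.
have [c] := @MVT_segment R f ('D_1 f) t 0 (ltW t0) (fun x _ => hd x) (continuous_subspaceT cf).
rewrite in_itv /= => /andP[c0 ct]; rewrite sub0r distrC => ->; rewrite normrM normrN ler_wpM2r//.
by apply: dC; lra.
Qed.

Section Differentiation.
Context d (T : measurableType d) (mu : {measure set T -> \bar R}).

Lemma is_derive_Rintegral (f : R -> T -> R) (G : T -> R) :
  mu.-integrable setT (EFin \o f 0) -> (forall t, measurable_fun setT (f t)) ->
  (forall t x, derivable (f ^~ x) t 1) -> (forall x, 0 <= G x) ->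
  mu.-integrable setT (EFin \o G) ->
  (forall t x, - 1 < t < 1 -> `|'D_1 (f ^~ x) t| <= G x) ->
  is_derive (0 : R) 1 (fun t => \int[mu]_x f t x) (\int[mu]_x 'D_1 (f ^~ x) 0).
Proof.
move=> i0 mf df G0 iG fG.
have I0 : `](-1 : R), 1[%classic 0 by rewrite /= in_itv /=; lra.
(* Integrability is assumed for [f 0] only; for |t| < 1 the mean value theorem dominates [f t] by |f
   0| + G. *)
have it t : `](-1 : R), 1[%classic t -> mu.-integrable setT (EFin \o f t).
  rewrite /= in_itv /= => t1.
  apply: (@le_integrable _ _ _ _ _ measurableT _ (fun x => (`|f 0 x| + G x)%:E)).
  - exact/measurable_EFinP/mf.
  - move=> x _; rewrite /= lee_fin [leRHS]ger0_norm ?addr_ge0//.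
    have -> : f t x = f 0 x + (f t x - f 0 x) by ring.
    apply: le_trans (ler_normD _ _) _; rewrite lerD2l.
    have := derivable_lipschitz ltr01 (df ^~ x) (fG ^~ x) t1.
    move/le_trans; apply; rewrite ler_piMr//.
    by rewrite ler_norml; lra.
  - have := integrableD measurableT (integrable_norm i0) iG.
    by apply: eq_integrable.
have fG' t x : `](-1 : R), 1[%classic t -> setT x -> `|partial1of2 f t x| <= G x.
  by rewrite /= in_itv /= => t1 _; rewrite partial1of2E; exact: fG.
have df' t x : `](-1 : R), 1[%classic t -> setT x -> derivable (f^~ x) t 1 by [].
apply: DeriveDef; first exact: (derivable_under_integral measurableT I0 it df' G0 iG fG').
rewrite -derive1E (differentiation_under_integral measurableT I0 it df' G0 iG fG').
by apply: eq_Rintegral => x _; rewrite partial1of2E.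
Qed.

Lemma integrable_cst_indic (C : R) (K : set T) : measurable K -> (mu K < +oo)%E ->
  mu.-integrable setT (fun x => (C * \1_K x)%:E).
Proof.
move=> mK fK; have i1 : mu.-integrable setT (fun x => (\1_K x)%:E).
  apply/integrableP; split; first exact/measurable_EFinP.
  under eq_integral do rewrite gee0_abs ?lee_fin//.
  by rewrite integral_indic// setIT.
exact: (integrableZl measurableT C i1).
Qed.

End Differentiation.

Section CompactSupport.
Context {T : ptopologicalType} (mu : {measure set (borel T) -> \bar R}).
Hypothesis hausT : hausdorff_space T.

Lemma compact_borel (K : set T) : compact K -> measurable (K : set (borel T)).
Proof.
move=> cK; rewrite -[K]setCK; apply: measurableC; apply: open_borel.
by apply: closed_openC; exact: compact_closed.
Qed.

Lemma continuous_measurable (f : T -> R) : continuous f ->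
  measurable_fun setT (f : borel T -> R).
Proof. by move=> cf; apply: continuous_borel_real; [exact: openT|move=> x _; exact: cf]. Qed.

Lemma compact_support_integrable (f : T -> R) (K : set T) : compact K -> (mu K < +oo)%E ->
  continuous f -> (forall x, ~ K x -> f x = 0) -> mu.-integrable setT (EFin \o f).
Proof.
move=> cK fK cf f0; have [C C0 fC] := compact_fun_bound cK cf.
apply: (le_integrable measurableT _ _ (integrable_cst_indic C (compact_borel cK) fK)).
  by apply/measurable_EFinP; exact: continuous_measurable.
move=> x _; rewrite /= lee_fin normrM (ger0_norm C0) indicE.
have [xK|/f0 ->] := pselect (K x); last by rewrite normr0 mulr_ge0.
by rewrite mem_set// normr1 mulr1 fC.
Qed.

End CompactSupport.
End Integrals.

(** * Translation invariance and integrals of derivatives *)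

Section RowVolume.
Context {R : realType}.
Local Notation rV n := 'rV[R]_n.

Definition row_volume n : {measure set (borel (rV n)) -> \bar R} :=
  projT1 (cid (@row_measure R n)).

Lemma row_volume_ball n (x : rV n) r : 0 < r -> (0 < row_volume n (ball x r) < +oo)%E.
Proof. by have [h _] := projT2 (cid (@row_measure R n)); exact: h. Qed.

Lemma integral_row_volume n (f : borel (rV n) -> \bar R) : measurable_fun setT f ->
  (forall x, (0 <= f x)%E) -> (\int[row_volume n]_x f x = lebesgue_int f)%E.
Proof. by have [_ h] := projT2 (cid (@row_measure R n)); exact: h. Qed.

Lemma row_hausdorff n : hausdorff_space (rV n). Proof. exact: norm_hausdorff. Qed.

Lemma row_volume_sigma_finite n : sigma_finite setT (row_volume n).
Proof.
exists (fun k => ball (0 : rV n) k.+1%:R) => [|k]; last first.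
  split; first by apply: open_borel; exact: ball_open.
  by have /andP[] := row_volume_ball (0 : rV n) (ltr0Sn R k).
apply/seteqP; split=> // x _; exists (Num.Def.archi_bound `|x|) => //.
rewrite -ball_normE /= sub0r normrN; apply: lt_trans (archi_boundP (normr_ge0 x)) _.
by rewrite ltr_nat.
Qed.

Lemma translation_continuous {V : normedModType R} (v : V) : continuous (fun x => x + v).
Proof. by move=> x; apply: cvgD; [exact: cvg_id|exact: cvg_cst]. Qed.

Lemma measurable_translation n (v : rV n) : measurable_fun setT (fun x : borel (rV n) => x + v : borel (rV n)).
Proof.
by apply: (@continuous_borel (rV n) (rV n)); [exact: openT|move=> x _; exact: translation_continuous].
Qed.

(** The translated measure has the right value on half-open intervals, and these characterise
    Lebesgue measure. *)
Lemma lebesgue_translation (f : R -> \bar R) (c : R) : measurable_fun setT f ->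
  (forall t, (0 <= f t)%E) ->
  (\int[@lebesgue_measure R]_t f (t + c)%R = \int[@lebesgue_measure R]_t f t)%E.
Proof.
move=> mf f0.
have mc : measurable_fun setT (fun t : measurableTypeR R => t + c : measurableTypeR R).
  exact: measurable_funD.
pose nu := measure_function_pushforward__canonical__measure_function_Measure
  (@lebesgue_measure R) mc.
transitivity (\int[nu]_t f t)%E.
  by apply: esym; apply: (ge0_integral_pushforward mc).
apply: eq_measure_integral => //= B mB _; apply/esym.
apply: (lebesgue_measure_unique (mu := nu)) => // _ [[a b]] _ <-.
transitivity (@lebesgue_measure R `]a - c, b - c]%classic); last first.
  rewrite /nu /= /pushforward; congr (lebesgue_measure _); apply/seteqP.
  by split=> t /=; rewrite !in_itv /=; lra.
rewrite !lebesgue_measure_itv /= !lte_fin ltrD2r; case: ifP => // _.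
by rewrite -!EFinB; congr (_%:E); ring.
Qed.

Lemma row_volume_translation n (f : borel (rV n) -> \bar R) (v : rV n) : measurable_fun setT f ->
  (forall x, (0 <= f x)%E) ->
  (\int[row_volume n]_x f (x + v)%R = \int[row_volume n]_x f x)%E.
Proof.
elim: n f v => [|n IH] f v mf f0.
  by apply: eq_integral => x _; congr f; apply/rowP => -[].
have mfv := measurableT_comp mf (measurable_translation v).
rewrite !integral_row_volume//=.
pose t0 : R := v 0 (@lshift 1 n 0); pose v' : rV n := rsubmx (v : rV (1 + n)).
have vE t x : row_mx t%:M x + v = row_mx (t + t0)%:M (x + v') :> rV (1 + n).
  apply/rowP => a; rewrite mxE; case: (split_ordP a) => b ->.
    by rewrite !row_mxEl (ord1 b) !mxE eqxx.
  by rewrite !row_mxEr !mxE.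
have mfr : measurable_fun setT (f \o @row_pair R n).
  exact: (measurableT_comp mf (@measurable_row_pair R n)).
have mft t := measurable_fun_pair2 t mfr.
pose m : {sigma_finite_measure set (borel (rV n)) -> \bar R} :=
  as_sigma_finite (row_volume_sigma_finite n).
have E t : lebesgue_int (fun x : rV n => f (row_mx t%:M x)) = fubini_F m (f \o @row_pair R n) t.
  by rewrite -integral_row_volume//; exact: mft.
transitivity (\int[@lebesgue_measure R]_t fubini_F m (f \o @row_pair R n) (t + t0)%R)%E.
  apply: eq_integral => t _; rewrite -E; under eq_fun do rewrite vE.
  rewrite -!integral_row_volume//; last 2 first.
  - exact: (mft (t + t0)).
  - exact: (measurableT_comp (mft (t + t0)) (measurable_translation v')).
  by rewrite (IH (fun x => f (row_mx (t + t0)%:M x)) v'); [|exact: (mft (t + t0))|].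
rewrite lebesgue_translation//.
- by apply: eq_integral => t _; rewrite -E.
- apply: measurable_fun_fubini_tonelli_F => //.
- by move=> t; exact: f0.
- by move=> t; apply: integral_ge0 => x _; exact: f0.
Qed.

Lemma Rintegral_translation n (f : rV n -> R) (v : rV n) : continuous f ->
  \int[row_volume n]_x f (x + v) = \int[row_volume n]_x f x.
Proof.
move=> cf; have mf : measurable_fun setT (EFin \o f : borel (rV n) -> \bar R).
  by apply/measurable_EFinP; exact: continuous_measurable.
have tr (h : borel (rV n) -> \bar R) : measurable_fun setT h -> (forall x, (0 <= h x)%E) ->
    (\int[row_volume n]_x h (x + v)%R = \int[row_volume n]_x h x)%E by exact: row_volume_translation.
rewrite /Rintegral; congr fine; rewrite [LHS]integralE [RHS]integralE; congr (_ - _)%E.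
  transitivity (\int[row_volume n]_x (EFin \o f)^\+ (x + v)%R)%E.
    apply: eq_integral => x _. by rewrite unlock.
  exact: (tr _ (measurable_funepos mf) (funepos_ge0 _)).
transitivity (\int[row_volume n]_x (EFin \o f)^\- (x + v)%R)%E.
  by apply: eq_integral => x _; rewrite unlock.
exact: (tr _ (measurable_funeneg mf) (funeneg_ge0 _)).
Qed.

(** The integral of x -> f (x + t v) does not depend on [t]; its derivative at t = 0, taken under
    the integral sign, is the integral in question. *)
Lemma Rintegral_derive_eq0 n (f : rV n -> R) (v : rV n) (r : R) : 0 < r -> Ck_on 1 setT f ->
  (forall x, ~ ball 0 r x -> f x = 0) -> \int[row_volume n]_x 'D_v f x = 0.
Proof.
move=> r0 Cf f0; have [_ df] := Cf.
have cDf : continuous ('D_v f) by have [_ [c _]] := df v; move=> x; exact: c.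
have D0 y : r < `|y| -> 'D_v f y = 0.
  move=> ry; transitivity ('D_v (cst 0 : rV n -> R) y); last exact: derive_cst.
  apply: near_eq_derive.
  have cn : {for y, continuous (@Num.norm R (rV n))} by exact: norm_continuous.
  have nr : \forall z \near y, r < `|z| by exact: (cn [set z | r < z] (lt_nbhsr ry)).
  apply: filterS nr => z rz; apply: f0.
  by rewrite -ball_normE /= sub0r normrN; apply/negP; rewrite -leNgt ltW.
(* With this radius, for |t| < 1 the derivative of the translate by [t *: v] vanishes off [K], so a
   multiple of the indicator of [K] dominates it. *)
pose rho := r + `|v|; pose K := [set x : rV n | `|x| <= rho].
have rho0 : 0 < rho by rewrite /rho ltr_pwDl.
have cK : compact K.
  apply: bounded_closed_compact.
    exists rho; split; first exact: num_real.
    by move=> M rM x Kx; apply: le_trans Kx (ltW rM).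
  apply: (@closed_comp _ _ (@Num.norm R (rV n)) [set y | y <= rho]); last exact: closed_le.
  by move=> x _; exact: norm_continuous.
have mK : measurable (K : set (borel (rV n))) by apply: compact_borel => //; exact: row_hausdorff.
have fK : (row_volume n K < +oo)%E.
  have rho1 : 0 < rho + 1 by rewrite addr_gt0.
  have /andP[_] := row_volume_ball (0 : rV n) rho1; apply: le_lt_trans.
  apply: le_measure; rewrite ?inE//; first by apply: open_borel; exact: ball_open.
  move=> x Kx; rewrite -ball_normE /= sub0r normrN; apply: le_lt_trans Kx _.
  by rewrite ltrDl.
have [C C0 DC] := compact_fun_bound cK cDf.
pose F (h : R) (x : rV n) := f (h *: v + x).
have cl (h : R) : continuous (fun x => h *: v + x).
  have -> : (fun x => h *: v + x) = (fun x => x + h *: v) by apply/funext => x; rewrite addrC.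
  exact: translation_continuous.
have cf : continuous f by have [c _] := Cf; move=> x; exact: c.
have cF h : continuous (F h).
  by move=> x; apply: (@continuous_comp _ _ _ (fun x => h *: v + x) f); [exact: cl|exact: cf].
have dF (t : R) (x : rV n) : is_derive t 1 (F ^~ x) ('D_v f (t *: v + x)).
  by apply: is_derive_line; have [d _] := df v; exact: d.
have E0 : \int[row_volume n]_x 'D_1 (F ^~ x) 0 = \int[row_volume n]_x 'D_v f x.
  by apply: eq_Rintegral => x _; rewrite (@derive_val _ _ _ _ _ _ _ (dF 0 x)) scale0r add0r.
rewrite -E0.
have FE : (fun t => \int[row_volume n]_x F t x) = cst (\int[row_volume n]_x f x).
  apply/funext => t /=; rewrite -(Rintegral_translation (t *: v) cf).
  by apply: eq_Rintegral => x _; rewrite /F addrC.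
have : is_derive (0 : R) 1 (fun t => \int[row_volume n]_x F t x)
    (\int[row_volume n]_x 'D_1 (F ^~ x) 0).
  apply: (@is_derive_Rintegral R _ (borel (rV n)) (row_volume n) F (fun x => C * \1_K x)).
  - apply: (compact_support_integrable (@row_hausdorff n) cK fK (cF 0)) => x nK.
    rewrite /F scale0r add0r; apply: f0 => bx; apply: nK.
    move: bx; rewrite -ball_normE /= sub0r normrN => xr.
    by apply: le_trans (ltW xr) _; rewrite lerDl.
  - by move=> t; exact: continuous_measurable (cF t).
  - by move=> t x; have [] := dF t x.
  - by move=> x; rewrite mulr_ge0.
  - exact: (integrable_cst_indic C mK fK).
  - move=> t x t1; rewrite (@derive_val _ _ _ _ _ _ _ (dF t x)) indicE.
    have [Kx|nKx] := pselect (K x).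
      rewrite (mem_set Kx) mulr1; have [Ky|nKy] := pselect (K (t *: v + x)); first exact: DC.
      suff Dz : 'D_v f (t *: v + x) = 0 by rewrite Dz normr0.
      apply: D0.
      have yr : rho < `|t *: v + x| by rewrite ltNge; exact/negP.
      by apply: le_lt_trans yr; rewrite lerDl.
    suff Dz : 'D_v f (t *: v + x) = 0 by rewrite Dz normr0 mulr_ge0.
    apply: D0.
    have xr : rho < `|x| by rewrite ltNge; exact/negP.
    have : `|x| <= `|t *: v + x| + `|t *: v|.
      by rewrite -{1}[x](addKr (t *: v)) addrC; exact: ler_normB.
    have tv : `|t *: v| <= `|v|.
      rewrite normrZ; apply: ler_piMl; first exact: normr_ge0.
      by rewrite ler_norml; case/andP: t1 => t1 t2; apply/andP; split; exact: ltW.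
    move: (`|t *: v|) (`|t *: v + x|) xr tv => a b; rewrite /rho; move: (`|x|) (`|v|) => c e.
    by clear; lra.
rewrite FE => h; rewrite -(@derive_val _ _ _ _ _ _ _ h).
exact: derive_cst.
Qed.

End RowVolume.

(** * Integration on the manifold *)

Section Transfer.
Context {R : realType} d1 d2 (T1 : measurableType d1) (T2 : measurableType d2).
Variables (mu1 : {measure set T1 -> \bar R}) (mu2 : {measure set T2 -> \bar R}).
Variables (D : set T1) (E : set T2) (pi : T2 -> T1) (rho : T2 -> R).
Hypotheses (mD : measurable D) (mE : measurable E) (mpi : measurable_fun E pi).
Hypotheses (mrho : measurable_fun E rho) (rho0 : forall x, E x -> 0 <= rho x).
Hypothesis piD : forall x, E x -> D (pi x).
Hypothesis mu12 : forall B, measurable B -> B `<=` D ->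
  mu1 B = (\int[mu2]_(x in E) (rho x * \1_B (pi x))%:E)%E.

Import HBNNSimple.

Let mcomp (f : T1 -> R) : measurable_fun setT f -> measurable_fun E (fun x => f (pi x)).
Proof. by move=> mf; exact: (measurableT_comp mf mpi). Qed.

Let transfer_nnsfun (h : {nnsfun T1 >-> R}) :
  (\int[mu2]_(x in E) (rho x * h (pi x))%:E = \int[mu1]_(x in D) (h x)%:E)%E.
Proof.
have mh r : measurable (h @^-1` [set r]) by [].
transitivity (\sum_(y \in range h) \int[mu1]_(x in D) (y * \1_(h @^-1` [set y]) x)%:E)%E; last first.
  rewrite -ge0_integral_fsum//; last 2 first.
  - by move=> y; apply/measurable_EFinP/measurable_funTS; exact: measurable_funM.
  - by move=> y x _; rewrite nnfun_muleindic_ge0.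
  by apply: eq_integral => x _; rewrite fsumEFin// -fimfunE.
transitivity (\sum_(y \in range h) \int[mu2]_(x in E) (rho x * (y * \1_(h @^-1` [set y]) (pi x)))%:E)%E.
  rewrite -ge0_integral_fsum//; last 2 first.
  - move=> y; apply/measurable_EFinP/measurable_funM => //.
    by apply: (mcomp (f := fun p => y * \1_(h @^-1` [set y]) p)); exact: measurable_funM.
  - move=> y x Ex; rewrite EFinM mule_ge0 ?lee_fin ?rho0//.
    exact: nnfun_muleindic_ge0.
  apply: eq_integral => x _; rewrite fsumEFin//; congr (_%:E).
  by rewrite (fimfunE h (pi x)) mulr_fsumr.
apply: eq_fsbigr => y yh; have y0 : 0 <= y by move: yh; rewrite inE => -[t _ <-].
rewrite integralZl_indic_nnsfun// integral_indic//.
rewrite mu12; [|exact: measurableI|exact: subIsetr].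
rewrite -ge0_integralZl ?lee_fin//; last 2 first.
- apply/measurable_EFinP/measurable_funM => //.
  by apply: (mcomp (f := \1_(h @^-1` [set y] `&` D))); apply: measurable_indic; exact: measurableI.
- by move=> x Ex; rewrite lee_fin mulr_ge0 ?rho0.
apply: eq_integral => x /set_mem Ex; rewrite -EFinM mulrCA; congr (_ * (_ * _))%:E.
rewrite !indicE; congr (nat_of_bool _)%:R; apply/idP/idP => /set_mem; last by case=> h1 _; exact/mem_set.
by move=> h1; apply/mem_set; split=> //; exact: piD.
Qed.

(** By monotone convergence from simple functions, for which [mu12] is applied to each level set
    inside [D]. *)
Lemma integral_transfer (f : T1 -> \bar R) : measurable_fun D f ->
  (forall p, D p -> (0 <= f p)%E) ->
  (\int[mu1]_(p in D) f p = \int[mu2]_(x in E) ((rho x)%:E * f (pi x)))%E.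
Proof.
move=> mf f0; pose h := nnsfun_approx mD mf.
have -> : (\int[mu1]_(x in D) f x = limn (fun n => \int[mu1]_(x in D) (EFin \o h n) x))%E.
  rewrite -monotone_convergence//.
  - by apply: eq_integral => x /set_mem Dx; apply/esym/cvg_lim => //; exact: cvg_nnsfun_approx.
  - by move=> n; apply/measurable_EFinP/measurable_funTS.
  - by move=> n x _; rewrite lee_fin.
  - by move=> x _ a b ab; rewrite lee_fin; exact/lefP/nd_nnsfun_approx.
have -> : (\int[mu2]_(x in E) ((rho x)%:E * f (pi x)) =
    limn (fun n => \int[mu2]_(x in E) (rho x * h n (pi x))%:E))%E.
  rewrite -monotone_convergence//.
  - apply: eq_integral => x /set_mem Ex; apply/esym/cvg_lim => //.
    under eq_fun do rewrite EFinM.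
    by apply: cvgeZl => //; apply: cvg_nnsfun_approx => //; exact: piD.
  - by move=> n; apply/measurable_EFinP/measurable_funM => //; exact: mcomp.
  - by move=> n x Ex; rewrite lee_fin mulr_ge0 ?rho0.
  - by move=> x Ex a b ab; rewrite lee_fin ler_wpM2l ?rho0//; exact/lefP/nd_nnsfun_approx.
by congr (limn _); apply/funext => n; rewrite transfer_nnsfun.
Qed.

End Transfer.

Section ManifoldIntegral.
Context {R : realType} {n : nat} {M : ptopologicalType} {A : atlas R n M}.
Variables (hausM : hausdorff_space M) (g : components A) (hg : riemannian g).
Variable vol : {measure set (borel M) -> \bar R}.
Hypothesis hvol : riemannian_volume g vol.
Local Notation mu := (row_volume n : {measure set (borel 'rV[R]_n) -> \bar R}).

Definition chart_density (i : chart_index A) (x : 'rV[R]_n) : R := Num.sqrt (\det (g i x)).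

Lemma chart_density_gt0 i x : chart_img i x -> 0 < chart_density i x.
Proof. by move=> Ox; rewrite sqrtr_gt0 (riemannian_det hg). Qed.

Lemma chart_density_smooth i : smooth_on (chart_img i) (chart_density i).
Proof.
have [sg _ _] := hg; move=> k.
have oi : open (chart_img i) by exact: img_open.
apply: (Ck_on_sqrt oi); first by move=> x; exact: (riemannian_det hg).
rewrite /determinant.
apply: Ck_on_sum => // s; apply: Ck_onM => //; first exact: Ck_on_cst.
by apply: Ck_on_prod => // a; have h b := (Ck_on_mx _ _ oi).1 (sg i k) a b; exact: h.
Qed.

Lemma chart_density_continuous i x : chart_img i x -> {for x, continuous (chart_density i)}.
Proof. by have [c _] := chart_density_smooth i 0; exact: c. Qed.

Let rho0 i x : chart_img i x -> 0 <= chart_density i x.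
Proof. by move=> Ox; exact/ltW/chart_density_gt0. Qed.
Let mrho i : measurable_fun (chart_img i : set (borel _)) (chart_density i).
Proof. by apply: continuous_borel_real; [exact: img_open|exact: chart_density_continuous]. Qed.
Let mpi (i : chart_index A) : measurable_fun (chart_img i : set (borel 'rV[R]_n))
  (chart_param i : 'rV[R]_n -> borel M).
Proof. by apply: continuous_borel; [exact: img_open|exact: param_continuous]. Qed.
Let mimg (i : chart_index A) : measurable (chart_img i : set (borel 'rV[R]_n)).
Proof. by apply: open_borel; exact: img_open. Qed.
Let mdom (i : chart_index A) : measurable (chart_dom i : set (borel M)).
Proof. by apply: open_borel; exact: dom_open. Qed.

Lemma chart_volume (i : chart_index A) (B : set (borel M)) : measurable B -> B `<=` chart_dom i ->
  vol B = (\int[mu]_(x in chart_img i) (chart_density i x * \1_B (chart_param i x))%:E)%E.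
Proof.
move=> mB BD; rewrite (hvol mB BD).
have E : (fun x => (Num.sqrt (\det (g i x)) * \1_(chart_coord i @` B) x)%:E) =
    (fun x => (chart_density i x * \1_B (chart_param i x))%:E) \_ (chart_img i).
  apply/funext => x; rewrite patchE; case: ifPn => [/set_mem Ox|/negP nOx].
    congr (_ * _)%:E; rewrite !indicE; congr (nat_of_bool _)%:R; apply/idP/idP => /set_mem.
      by case=> p Bp <-; rewrite coordK ?mem_set//; exact: BD.
    by move=> Bx; apply/mem_set; exists (chart_param i x) => //; exact: chart_paramK.
  rewrite indicE memNset ?mulr0// => -[p Bp px]; apply: nOx; apply/mem_set.
  by exists p => //; exact: BD.
have m1 : measurable_fun (chart_img i : set (borel 'rV[R]_n))
    (fun x => (chart_density i x * \1_B (chart_param i x))%:E).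
  apply/measurable_EFinP/measurable_funM; first exact: mrho.
  have mB1 : measurable_fun setT (\1_B : borel M -> R) by exact: measurable_indic.
  exact: (measurableT_comp mB1 (@mpi i)).
rewrite -(integral_row_volume (f := fun x => (Num.sqrt (\det (g i x)) * \1_(chart_coord i @` B) x)%:E)).
- by rewrite [RHS]integral_mkcond -E.
- by rewrite E; apply/(measurable_restrictT _ _).1.
- by move=> x; rewrite lee_fin mulr_ge0 ?sqrtr_ge0.
Qed.

Lemma chart_integral (i : chart_index A) (f : borel M -> \bar R) :
  measurable_fun (chart_dom i : set (borel M)) f ->
  (forall p, chart_dom i p -> (0 <= f p)%E) ->
  (\int[vol]_(p in chart_dom i) f p =
   \int[mu]_(x in chart_img i) ((chart_density i x)%:E * f (chart_param i x)))%E.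
Proof.
move=> mf f0; apply: (integral_transfer (@mdom i) (@mimg i) (@mpi i) (@mrho i) (@rho0 i)) => //.
- by move=> x; exact: chart_paramP.
- by move=> B mB BD; exact: chart_volume.
Qed.

Lemma chart_Rintegral (i : chart_index A) (f : M -> R) (h : 'rV[R]_n -> R) :
  measurable_fun setT (f : borel M -> R) -> (forall p, ~ chart_dom i p -> f p = 0) ->
  (forall x, chart_img i x -> h x = chart_density i x * f (chart_param i x)) ->
  (forall x, ~ chart_img i x -> h x = 0) ->
  \int[vol]_p f p = \int[mu]_x h x.
Proof.
move=> mf f0 hE h0.
have half (F : borel M -> \bar R) (H : borel 'rV[R]_n -> \bar R) : measurable_fun setT F ->
    (forall p, 0 <= F p)%E -> (forall p, ~ chart_dom i p -> F p = 0%E) ->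
    (forall x, chart_img i x -> H x = (chart_density i x)%:E * F (chart_param i x))%E ->
    (forall x, ~ chart_img i x -> H x = 0%E) ->
    (\int[vol]_p F p = \int[mu]_x H x)%E.
  move=> mF F0 FD HE H0.
  have -> : F = F \_ (chart_dom i).
    by apply/funext => p; rewrite patchE; case: ifPn => // /negP np; apply: FD => dp; exact/np/mem_set.
  have -> : H = H \_ (chart_img i).
    by apply/funext => p; rewrite patchE; case: ifPn => // /negP np; apply: H0 => dp; exact/np/mem_set.
  rewrite -!integral_mkcond chart_integral//; last exact: measurable_funTS.
  by apply: eq_integral => x /set_mem Ox; rewrite HE.
have mfE : measurable_fun setT (EFin \o f : borel M -> \bar R) by exact/measurable_EFinP.
rewrite /Rintegral; congr fine; rewrite [LHS]integralE [RHS]integralE; congr (_ - _)%E.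
  apply: half; first exact: measurable_funepos.
  - by move=> p; exact: funepos_ge0.
  - by move=> p np; rewrite unlock /= f0// maxxx.
  - move=> x Ox; rewrite unlock /= hE// maxeMr ?lee_fin ?rho0// mule0.
    by rewrite -EFinM.
  - by move=> p np; rewrite unlock /= h0// maxxx.
apply: half; first exact: measurable_funeneg.
- by move=> p; exact: funeneg_ge0.
- by move=> p np; rewrite unlock /= f0// oppr0 maxxx.
- move=> x Ox; rewrite unlock /= hE// maxeMr ?lee_fin ?rho0// mule0.
  by rewrite -EFinM mulrN.
- by move=> p np; rewrite unlock /= h0// oppr0 maxxx.
Qed.

End ManifoldIntegral.

(** * Volume of compact sets and positive integrals *)

Section ManifoldVolume.
Context {R : realType} {n : nat} {M : ptopologicalType} {A : atlas R n M}.
Variables (hausM : hausdorff_space M) (g : components A) (hg : riemannian g).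
Variable vol : {measure set (borel M) -> \bar R}.
Hypothesis hvol : riemannian_volume g vol.
Local Notation mu := (row_volume n : {measure set (borel 'rV[R]_n) -> \bar R}).

Lemma compact_seq_cover (K : set M) (N : M -> set M) : compact K ->
  (forall p, open (N p)) -> (forall p, N p p) ->
  exists s : seq M, forall x, K x -> exists2 p, p \in s & N p x.
Proof.
move=> cK oN Np; have : cover_compact K by rewrite -compact_cover.
move=> /(_ M setT N (fun p _ => oN p)) [x Kx|D _ DK]; first by exists x.
by exists (finmap.enum_fset D) => x /DK[p /= pD Npx]; exists p.
Qed.

(** In a chart the density lies between two positive constants near the point, so a small coordinate
    ball has positive finite volume, as in R^n. *)
Lemma vol_neighborhood (p : M) (U : set M) : open U -> U p ->
  exists N : set M, [/\ open N, N p, N `<=` U & (0 < vol N < +oo)%E].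
Proof.
move=> oU Up; pose i := chart_at A p; pose x := chart_coord i p.
have ip : chart_dom i p by exact: chart_atP.
have Ox : chart_img i x by exists p.
have px : chart_param i x = p by exact: coordK.
pose rho := chart_density g i; have r0 : 0 < rho x by exact: chart_density_gt0.
have cr : {for x, continuous rho} by exact: chart_density_continuous.
have n1 : \forall y \near x, chart_img i y.
  by apply: open_nbhs_nbhs; split=> //; exact: img_open.
have n2 : \forall y \near x, rho x / 2 < rho y.
  by apply: (cr [set z | rho x / 2 < z]); apply: lt_nbhsr; rewrite ltr_pdivrMr// ltr_pMr// ltr1n.
have n3 : \forall y \near x, rho y < rho x + 1.
  by apply: (cr [set z | z < rho x + 1]); apply: lt_nbhsl; rewrite ltrDl.
have n4 : \forall y \near x, U (chart_param i y).
  have cp : {for x, continuous (chart_param i)} by exact: param_continuous.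
  by apply: (cp U); rewrite px; exact: open_nbhs_nbhs.
have /nbhs_ballP[r /= rp rB] : \forall y \near x,
    [/\ chart_img i y, rho x / 2 < rho y, rho y < rho x + 1 & U (chart_param i y)].
  by near=> y; split; near: y.
pose N := chart_dom i `&` chart_coord i @^-1` ball x r.
have oN : open N.
  apply: continuous_open_preimage; [exact: dom_open|by move=> q; exact: Defs.coord_continuous|].
  exact: ball_open.
exists N; split=> //; first by split=> //; exact: ballxx.
  by move=> q [iq /rB[_ _ _]]; rewrite coordK.
have mimg : measurable (chart_img i : set (borel 'rV[R]_n)).
  by apply: open_borel; exact: img_open.
have mB : measurable (ball x r : set (borel 'rV[R]_n)) by apply: open_borel; exact: ball_open.
have Bimg : ball x r `<=` chart_img i by move=> y /rB[].
have vE : vol N = (\int[mu]_(y in chart_img i) (rho y * \1_(ball x r) y)%:E)%E.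
  rewrite (chart_volume hg hvol (i := i) (open_borel oN)); last by move=> q [].
  apply: eq_integral => y /set_mem Oy; congr (_ * _)%:E; rewrite !indicE.
  congr (nat_of_bool _)%:R; apply/idP/idP => /set_mem; rewrite /N /= ?chart_paramK//.
    by case=> _ h; exact/mem_set.
  by move=> h; apply/mem_set; split; [exact: chart_paramP|rewrite /= chart_paramK].
have mi (c : R) : measurable_fun (chart_img i : set (borel 'rV[R]_n)) (fun y => (c * \1_(ball x r) y)%:E).
  by apply/measurable_EFinP/measurable_funM => //; exact: measurable_indic.
have mr : measurable_fun (chart_img i : set (borel 'rV[R]_n)) (fun y => (rho y * \1_(ball x r) y)%:E).
  apply/measurable_EFinP/measurable_funM; last exact: measurable_indic.
  apply: continuous_borel_real; first exact: img_open.
  by move=> y; exact: chart_density_continuous.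
have cE (c : R) : 0 < c -> (\int[mu]_(y in chart_img i) (c * \1_(ball x r) y)%:E = c%:E * mu (ball x r))%E.
  move=> c0; rewrite (integralZl_indic (m := mu) mimg (fun=> (ball x r : set (borel 'rV[R]_n))))//.
    by rewrite integral_indic// setIidl.
  by move=> /(lt_trans c0); rewrite ltxx.
have /andP[b0 bfin] := row_volume_ball x rp.
rewrite vE; apply/andP; split.
  apply: lt_le_trans (_ : ((rho x / 2)%:E * mu (ball x r) <= _)%E).
    by rewrite mule_gt0// lte_fin divr_gt0.
  rewrite -cE ?divr_gt0//; apply: ge0_le_integral => //.
  - by move=> y _; rewrite lee_fin mulr_ge0// divr_ge0// ltW.
  - move=> y _; rewrite lee_fin indicE; case: (boolP (y \in _)) => [|_]; last by rewrite !mulr0.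
    by move=> /set_mem/rB[_ h _ _]; rewrite !mulr1 ltW.
apply: le_lt_trans (_ : (_ <= (rho x + 1)%:E * mu (ball x r))%E) _; last first.
  by rewrite lte_mul_pinfty// lee_fin addr_ge0 ?ltW.
rewrite -cE ?addr_gt0//; apply: ge0_le_integral => //.
- by move=> y Oy; rewrite lee_fin mulr_ge0// ltW//; exact: chart_density_gt0.
- move=> y _; rewrite lee_fin indicE; case: (boolP (y \in _)) => [|_]; last by rewrite !mulr0.
  by move=> /set_mem/rB[_ _ h _]; rewrite !mulr1 ltW.
Unshelve. all: by end_near.
Qed.

Lemma vol_compact (K : set M) : compact K -> (vol K < +oo)%E.
Proof.
move=> cK.
pose N p := projT1 (cid (vol_neighborhood openT (I : [set: M] p))).
have NP p : [/\ open (N p), N p p & (0 < vol (N p) < +oo)%E].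
  by rewrite /N; case: cid => N' /= [h1 h2 _ h3].
have [||s sK] := compact_seq_cover cK (N := N).
- by move=> p; have [] := NP p.
- by move=> p; have [] := NP p.
have mN p : measurable (N p : set (borel M)) by apply: open_borel; have [] := NP p.
(* Stated for every measurable set covered by the list, so that the induction can remove one
   neighbourhood at a time. *)
suff H (B : set (borel M)) : measurable B ->
    (forall x, B x -> exists2 p, p \in s & N p x) -> (vol B < +oo)%E.
  by apply: H => //; exact: compact_borel.
elim: s {sK} B => [|p s IH] B mB BN.
  suff -> : B = set0 by rewrite measure0 ltry.
  by apply/seteqP; split=> // x /BN[].
rewrite (measureDI vol mB (mN p)); apply: lte_add_pinfty.
  apply: IH; first exact: measurableD.
  move=> x [Bx nNx]; have [q] := BN x Bx; rewrite inE => /orP[/eqP ->//|qs Nq].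
  by exists q.
have [_ _ /andP[_]] := NP p; apply: le_lt_trans.
by apply: (@le_measure _ _ _ vol); [exact/mem_set/measurableI|exact/mem_set|exact: subIsetr].
Qed.

Lemma continuous_integrable (f : M -> R) (K : set M) : compact K -> continuous f ->
  (forall p, ~ K p -> f p = 0) -> vol.-integrable setT (EFin \o f).
Proof. by move=> cK; apply: compact_support_integrable => //; exact: vol_compact. Qed.

(** Near [p] the function exceeds half of [f p], on a set of positive finite volume. *)
Lemma Rintegral_gt0 (f : M -> R) (K : set M) (p : M) : compact K -> continuous f ->
  (forall p, ~ K p -> f p = 0) -> (forall p, 0 <= f p) -> 0 < f p -> 0 < \int[vol]_p f p.
Proof.
move=> cK cf fK f0 fp; pose c := f p / 2.
have c0 : 0 < c by rewrite divr_gt0.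
have cfp : c < f p by rewrite ltr_pdivrMr// ltr_pMr// ltr1n.
have oU : open (f @^-1` [set y | c < y]) by apply: open_comp; [move=> x _; exact: cf|exact: open_gt].
have [N [oN Np NU /andP[N0 Nfin]]] := vol_neighborhood oU cfp.
have mN : measurable (N : set (borel M)) by exact: open_borel.
have iN := integrable_cst_indic c mN Nfin.
apply: (@lt_le_trans _ _ (\int[vol]_p (c * \1_N p))).
  rewrite /Rintegral (integralZl_indic (m := vol) measurableT (fun=> N : set (borel M)))//; last first.
    by move=> /(lt_trans c0); rewrite ltxx.
  rewrite integral_indic// setIT; apply: fine_gt0.
  by rewrite mule_gt0//= lte_mul_pinfty// lee_fin ltW.
apply: le_Rintegral => //; first exact: continuous_integrable cK cf fK.
move=> q _; rewrite indicE; case: (boolP (q \in _)) => [|_]; last by rewrite mulr0.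
by move=> /set_mem qN; rewrite mulr1; apply: ltW; exact: (NU q qN).
Qed.

End ManifoldVolume.

(** * Smooth functions supported in a chart *)

Section Bumps.
Context {R : realType} {n : nat} {M : ptopologicalType} {A : atlas R n M}.
Hypothesis hausM : hausdorff_space M.

Lemma smooth_fun_continuous (f : M -> R) : smooth_fun A f -> continuous f.
Proof.
move=> sf p; pose i := chart_at A p; have ip : chart_dom i p by exact: chart_atP.
have Ox : chart_img i (chart_coord i p) by exists p.
have [c _] := sf i 0.
apply: (@near_eq_continuous _ _ ((f \o chart_param i) \o chart_coord i)).
  have : \forall q \near p, chart_dom i q by apply: open_nbhs_nbhs; split=> //; exact: dom_open.
  by apply: filterS => q iq /=; rewrite coordK.
by apply: continuous_comp; [exact: Defs.coord_continuous|exact: c].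
Qed.

Lemma bump_function (i : chart_index A) (p : M) (U : set M) : chart_dom i p -> open U -> U p ->
  exists (b : M -> R) (K N : set M), [/\ smooth_fun A b, forall q, 0 <= b q <= 1,
    compact K /\ K `<=` U `&` chart_dom i, forall q, ~ K q -> b q = 0 &
    [/\ open N, N p & forall q, N q -> b q = 1]].
Proof.
move=> ip oU Up; pose x := chart_coord i p.
have Ox : chart_img i x by exists p.
have px : chart_param i x = p by exact: coordK.
have n1 : \forall y \near x, chart_img i y.
  by apply: open_nbhs_nbhs; split=> //; exact: img_open.
have n4 : \forall y \near x, U (chart_param i y).
  have cp : {for x, continuous (chart_param i)} by exact: param_continuous.
  by apply: (cp U); rewrite px; exact: open_nbhs_nbhs.
have /nbhs_ballP[r3 /= r30 rB] : \forall y \near x, chart_img i y /\ U (chart_param i y).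
  by near=> y; split; near: y.
(* The product [h] of cutoffs is 1 on the box of half-width [r] and 0 off the one of half-width 2 r;
   a third of [r3] keeps the latter in the ball of radius [r3]. *)
pose r := r3 / 3; have r0 : 0 < r by rewrite divr_gt0.
pose h (y : 'rV[R]_n) := \prod_a (step (2 + (y 0 a - x 0 a) / r) * step (2 - (y 0 a - x 0 a) / r)) : R.
pose Q := [set y : 'rV[R]_n | forall a, `[x 0 a - 2 * r, x 0 a + 2 * r]%classic (y 0 a)].
have cQ : compact Q by exact: (@rV_compact R n (fun a => `[x 0 a - 2 * r, x 0 a + 2 * r]%classic) (fun a => @segment_compact R _ _)).
have QB y : Q y -> chart_img i y /\ U (chart_param i y).
  move=> Qy; apply: rB; apply/ball_rowE => // a; have := Qy a; rewrite /= in_itv /=.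
  by rewrite /r => /andP[y1 y2]; rewrite ltr_norml; lra.
have hQ y : ~ Q y -> h y = 0.
  move=> nQ; have [a na] : exists a, ~ `[x 0 a - 2 * r, x 0 a + 2 * r]%classic (y 0 a).
    by apply: contrapT => ne; apply: nQ => a; apply: contrapT => na; apply: ne; exists a.
  rewrite /h (bigD1 a)//=; move: na; rewrite /= in_itv /= => /negP; rewrite negb_and -!ltNge.
  case/orP => ya.
    rewrite [step (2 + _)]step_le0 ?mul0r//.
    by rewrite -lerBrDl sub0r ler_pdivrMr//; lra.
  rewrite [step (2 - _)]step_le0 ?mulr0 ?mul0r//.
  by rewrite subr_le0 ler_pdivlMr//; lra.
pose K := chart_param i @` Q.
have cK : compact K.
  apply: continuous_compact => //; apply: continuous_in_subspaceT => y /set_mem/QB[Oy _].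
  exact: param_continuous.
have clK : closed K by exact: compact_closed.
pose b q : R := if pselect (chart_dom i q) then h (chart_coord i q) else 0.
pose N := chart_dom i `&` chart_coord i @^-1` ball x r.
have bK q : ~ K q -> b q = 0.
  move=> nK; rewrite /b; case: pselect => // iq; apply: hQ => Qq; apply: nK.
  by exists (chart_coord i q) => //; exact: coordK.
exists b, K, N; split=> //.
- move=> j k; apply: (@Ck_on_local _ _ _ _ _ (b \o chart_param j)); first exact: img_open.
  (* Near a point of the chart [i] the function is [h] composed with the transition map. Any other
     point has a neighbourhood off [K], which is closed and lies in the chart, and there the
     function vanishes. *)
  move=> y Oy; have [iy|niy] := pselect (chart_dom i (chart_param j y)).
    pose V := chart_img j `&` chart_param j @^-1` chart_dom i.
    have oV : open V.
      apply: continuous_open_preimage; [exact: img_open| |exact: dom_open].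
      by move=> z; exact: param_continuous.
    exists V; split=> //.
    apply: (eq_Ck_on oV (f := h \o (chart_coord i \o chart_param j))).
      by move=> z /set_mem[_ iz] /=; rewrite /b; case: pselect.
    have ct a : Ck_on k V (fun z => (chart_coord i \o chart_param j) z 0 a).
      by have := (Ck_on_mx k (chart_coord i \o chart_param j) oV).1 (transition_smooth j i k) 0 a.
    have ca (s t : R) a : Ck_on k V (fun z => s + t * (chart_coord i \o chart_param j) z 0 a).
      apply: Ck_onD => //; first exact: Ck_on_cst.
      by apply: Ck_onM => //; exact: Ck_on_cst.
    apply: Ck_on_prod => // a; apply: Ck_onM => //; apply: Ck_on_step => //.
      apply: (eq_Ck_on oV) (ca (2 - x 0 a / r) r^-1 a) => z _ /=; ring.
    apply: (eq_Ck_on oV) (ca (2 + x 0 a / r) (- r^-1) a) => z _ /=; ring.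
  pose V := chart_img j `&` chart_param j @^-1` (~` K).
  have oV : open V.
    apply: continuous_open_preimage; [exact: img_open| |exact: closed_openC].
    by move=> z; exact: param_continuous.
  exists V; split=> //.
    by split=> // -[z /QB[Oz _] zy]; apply: niy; rewrite -zy; exact: chart_paramP.
  by apply: (eq_Ck_on oV) (Ck_on_cst k V (0 : R)) => z /set_mem[_ nK] /=; rewrite bK.
- move=> q; rewrite /b; case: (pselect (chart_dom i q)) => [iq|niq]; last by rewrite lexx ler01.
  rewrite /h; apply/andP; split.
    by apply: prodr_ge0 => a _; rewrite mulr_ge0 ?step_ge0.
  apply: prodr_ile1 => a _; rewrite mulr_ge0 ?step_ge0//=.
  by rewrite mulr_ile1 ?step_ge0 ?step_le1.
- by split=> // _ [y Qy <-]; have [Oy Uy] := QB y Qy; split=> //; exact: chart_paramP.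
split.
- apply: continuous_open_preimage; [exact: dom_open|by move=> q; exact: Defs.coord_continuous|].
  exact: ball_open.
- by split=> //; exact: ballxx.
- move=> q [iq /(ball_rowE _ _ r0) qB]; rewrite /b; case: (pselect (chart_dom i q)) => // iq'.
  rewrite /h big1// => a _; have := qB a; rewrite ltr_norml => /andP[q1 q2].
  set q' := chart_coord i q 0 a in q1 q2 *.
  have d1 : (q' - x 0 a) / r <= 1 by rewrite ler_pdivrMr//; lra.
  have d2 : -1 <= (q' - x 0 a) / r by rewrite ler_pdivlMr//; lra.
  by rewrite !step_ge1 ?mulr1//; lra.
Unshelve. all: by end_near.
Qed.

End Bumps.

(** * The first variation *)

Section JointSmoothness.
Context {R : realType} {n : nat} {M : ptopologicalType} {A : atlas R n M}.
Variables (i : chart_index A) (f : R * 'rV[R]_n -> R).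
Hypothesis sf : smooth_on (joint_dom i) f.

Let lineA (t h : R) (x : 'rV[R]_n) : (h *: 1 + t, x) = h *: ((1 : R), (0 : 'rV[R]_n)) + (t, x).
Proof. by congr (_, _); rewrite /= scaler0 add0r. Qed.

Lemma joint_derive1E t x :
  'D_1 (fun t => f (t, x)) t = 'D_((1 : R), (0 : 'rV[R]_n)) f (t, x).
Proof.
by apply: (@derive_affine _ _ _ _ _ (fun t => (t, x)) (fun t => (t, 0))) => h; exact: lineA.
Qed.

Lemma joint_derivable t x : chart_img i x -> derivable (fun t => f (t, x)) t 1.
Proof.
move=> Ox; apply/(@derivable_affine _ _ _ _ f (fun t => (t, x)) (fun t => (t, 0))).
  by move=> h; exact: lineA.
by have [_ /(_ (1, 0)) [d _]] := sf 1; exact: d.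
Qed.

Lemma joint_derive1_smooth : smooth_on (joint_dom i) (fun q => 'D_1 (fun t => f (t, q.2)) q.1).
Proof.
move=> k; apply: (eq_Ck_on (@joint_dom_open R n M A i) (f := fun q => 'D_((1 : R), (0 : 'rV[R]_n)) f q)).
  by move=> [t x] _; rewrite /= joint_derive1E.
by have [_ /(_ (1, 0)) [_ d]] := sf k.+1; exact: d.
Qed.

Lemma joint_slice_smooth t : smooth_on (chart_img i) (fun x => f (t, x)).
Proof.
move=> k; apply: (@Ck_on_affine _ _ _ _ _ (joint_dom i) _ f (fun x => (t, x)) (fun x => (0, x))) => //.
  by move=> h w x; congr (_, _); rewrite /= scaler0 add0r.
by move=> x; apply: pair_continuous; [exact: cst_continuous|exact: cvg_id].
Qed.

End JointSmoothness.

Section Variation.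
Context {R : realType} {n : nat} {M : ptopologicalType} {A : atlas R n M}.
Variables (g : components A) (lambda : R) (phi0 : M -> R) (amb : (M -> R) -> wfamily A).
Hypotheses (hg : riemannian g) (hphi0 : smooth_fun A phi0).
Hypothesis hamb : forall phi, conformal_class A phi0 phi -> normal_ambient g lambda phi (amb phi).

Definition weighted_coef (phi : M -> R) (j : nat) (p : M) : R :=
  v_coef g lambda phi (amb phi) j p * expR (- phi p).

(** Weaker than [C1_curve], with neither normalisation nor support condition, so that the straight
    lines phi + t om qualify. *)
Definition class_curve (Phi : R -> M -> R) : Prop :=
  (forall i : chart_index A, smooth_on (joint_dom i) (fun q => Phi q.1 (chart_param i q.2))) /\
  forall t, conformal_class A phi0 (Phi t).

Local Notation rho := (chart_density g).

Let rhoN0 (i : chart_index A) x : chart_img i x -> rho i x != 0.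
Proof. by move=> Ox; rewrite lt0r_neq0//; exact: (chart_density_gt0 hg Ox). Qed.

Let density_coef_weighted phi j i x :
  density_coef g lambda phi (amb phi) j i x = weighted_coef phi j (chart_param i x) * rho i x.
Proof. by []. Qed.

Lemma weighted_coef_joint Phi j (i : chart_index A) : class_curve Phi ->
  smooth_on (joint_dom i) (fun q => weighted_coef (Phi q.1) j (chart_param i q.2)).
Proof.
move=> [sPhi cPhi] k; have oJ := @joint_dom_open R n M A i.
apply: (@Ck_on_local _ _ _ _ _ (fun q => weighted_coef (Phi q.1) j (chart_param i q.2))) => //.
move=> [t0 x0] Ox0; exists (joint_dom i); split=> //.
have hF t : normal_ambient g lambda (Phi t) (amb (Phi t)) by exact: hamb.
apply: (eq_Ck_on oJ (f := fun q => density_coef g lambda (Phi q.1) (amb (Phi q.1)) j i q.2 * (rho i q.2)^-1)).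
  by move=> [t x] /set_mem Ox; rewrite density_coef_weighted mulfK// rhoN0.
apply: (Ck_onM oJ (f := fun q => density_coef g lambda (Phi q.1) (amb (Phi q.1)) j i q.2)
  (g := fun q => (rho i q.2)^-1)).
  exact: (density_coef_smooth hg hF (sPhi i) Ox0).
apply: Ck_onV => //; first by move=> [t x]; exact: rhoN0.
apply: (@Ck_on_affine _ _ _ _ _ (chart_img i) _ (rho i) snd snd) => //.
  exact: snd_continuous.
exact: chart_density_smooth.
Qed.

Lemma weighted_coef_smooth phi j : conformal_class A phi0 phi -> smooth_fun A (weighted_coef phi j).
Proof.
move=> cphi i.
have cc : class_curve (fun=> phi).
  split=> // i' k; have [w sw ->] := cphi.
  apply: (@Ck_on_affine _ _ _ _ _ (chart_img i') _ ((phi0 \+ w) \o chart_param i') snd snd) => //.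
    exact: snd_continuous.
  apply: Ck_onD; [exact: img_open|exact: hphi0|exact: sw].
exact: (joint_slice_smooth (weighted_coef_joint j i cc) 0).
Qed.

Section FixedPotential.
Variables (phi : M -> R) (cphi : conformal_class A phi0 phi) (k : nat) (hk : (0 < k)%N).
Let hF : normal_ambient g lambda phi (amb phi) := hamb cphi.

Definition flux_coef i (x0 : 'rV[R]_n) (Ox0 : chart_img i x0) a b (x : 'rV[R]_n) : R :=
  k`!%:R^-1 * iter k (dd 'e_iu) (time_volume hF Ox0 * time_prim hF Ox0 k a b)
    (ambient_point 0 x 0).

Lemma flux_coef_smooth i x0 (Ox0 : chart_img i x0) a b : smooth_on (chart_img i) (flux_coef Ox0 a b).
Proof.
move=> l; apply: Ck_onM; [exact: img_open|exact: Ck_on_cst|].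
set h := iter k _ _.
apply: (Ck_on_affine (@ambient_pointL R n) (@ambient_point_continuous R n) _ (smf_smooth h l)).
move=> x Ox; have D0 : time_domain hF Ox0 (slice (ambient_point 0 x 0)).
  by apply: time_domain_slice; rewrite x_ap.
by rewrite slice_id ?u_ap in D0.
Qed.

(* The linearisation of the [k]-th weighted coefficient is a divergence, up to
   a zeroth-order term; [flux] is the vector field in it. *)
Definition flux i x0 (Ox0 : chart_img i x0) a (h : 'rV[R]_n -> R) x : R :=
  \sum_b flux_coef Ox0 a b x * partial b h x.

Definition divergence_op i x0 (Ox0 : chart_img i x0) (h : 'rV[R]_n -> R) x : R :=
  \sum_a partial a (flux Ox0 a h) x.

Lemma flux_smooth i x0 (Ox0 : chart_img i x0) a h : smooth_on (chart_img i) h ->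
  smooth_on (chart_img i) (flux Ox0 a h).
Proof.
move=> sh l; apply: Ck_on_sum; first exact: img_open.
move=> b; apply: Ck_onM; [exact: img_open|exact: flux_coef_smooth|].
by have [_ /(_ 'e_b) [_ d]] := sh l.+1.
Qed.

Lemma divergence_op_smooth i x0 (Ox0 : chart_img i x0) h : smooth_on (chart_img i) h ->
  smooth_on (chart_img i) (divergence_op Ox0 h).
Proof.
move=> sh l; apply: Ck_on_sum; first exact: img_open.
by move=> a; have [_ /(_ 'e_a) [_ d]] := flux_smooth Ox0 a sh l.+1.
Qed.

Lemma partial_local (U : set 'rV[R]_n) a (h1 h2 : 'rV[R]_n -> R) x : open U -> U x ->
  {in U, h1 =1 h2} -> partial a h1 x = partial a h2 x.
Proof.
move=> oU Ux h12; apply: near_eq_derive.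
have : \forall y \near x, U y by exact: open_nbhs_nbhs.
by apply: filterS => y /mem_set; exact: h12.
Qed.

Lemma divergence_op_local i x0 (Ox0 : chart_img i x0) (U : set 'rV[R]_n) h1 h2 x : open U -> U x ->
  {in U, h1 =1 h2} -> divergence_op Ox0 h1 x = divergence_op Ox0 h2 x.
Proof.
move=> oU Ux h12; apply: eq_bigr => a _; apply: (partial_local _ oU Ux) => y /set_mem Uy.
by apply: eq_bigr => b _; congr (_ * _); exact: (partial_local _ oU Uy).
Qed.

Lemma divergence_opD i x0 (Ox0 : chart_img i x0) h1 h2 x : chart_img i x ->
  smooth_on (chart_img i) h1 -> smooth_on (chart_img i) h2 ->
  divergence_op Ox0 (h1 \+ h2) x = divergence_op Ox0 h1 x + divergence_op Ox0 h2 x.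
Proof.
have oi : open (chart_img i) by exact: img_open.
have der h a y : smooth_on (chart_img i) h -> chart_img i y -> derivable h y 'e_a.
  by move=> sh Oy; have [_ /(_ 'e_a) [d _]] := sh 1; exact: d.
move=> Ox s1 s2; rewrite -big_split; apply: eq_bigr => a _ /=.
rewrite /partial -deriveD; [|by apply: der => //; exact: flux_smooth..].
apply: (partial_local _ oi Ox) => y /set_mem Oy.
transitivity (flux Ox0 a h1 y + flux Ox0 a h2 y) => //; rewrite /flux -big_split /=.
by apply: eq_bigr => b _; rewrite /partial deriveD; [rewrite mulrDr|exact: der|exact: der].
Qed.

Lemma divergence_op0 i x0 (Ox0 : chart_img i x0) x : divergence_op Ox0 (cst 0) x = 0.
Proof.
rewrite /divergence_op big1// => a _.
transitivity (partial a (cst 0 : 'rV[R]_n -> R) x); last exact: derive_cst.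
congr (partial a _ x); apply/funext => y; rewrite /flux big1// => b _.
by rewrite /partial derive_cst mulr0.
Qed.

Lemma curve_variation Phi i x0 (Ox0 : chart_img i x0) x : class_curve Phi -> Phi 0 = phi ->
  chart_img i x ->
  'D_1 (fun t => weighted_coef (Phi t) k (chart_param i x)) 0 * rho i x =
  divergence_op Ox0 (fun x => 'D_1 (fun t => Phi t (chart_param i x)) 0) x
  - 'D_1 (fun t => Phi t (chart_param i x)) 0 *
    (weighted_coef phi k (chart_param i x) - lambda * weighted_coef phi k.-1 (chart_param i x))
    * rho i x.
Proof.
move=> cc E Ox; have [sPhi cPhi] := cc.
have hFt t : normal_ambient g lambda (Phi t) (amb (Phi t)) by exact: hamb.
have := density_coef_variation hg hFt (sPhi i) Ox0 hk Ox.
have -> : 'D_1 (fun t => density_coef g lambda (Phi t) (amb (Phi t)) k i x) 0 =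
    'D_1 (fun t => weighted_coef (Phi t) k (chart_param i x)) 0 * rho i x.
  have dw := joint_derivable (weighted_coef_joint k i cc) (t := 0) Ox.
  rewrite (_ : (fun t => _) = (fun t => weighted_coef (Phi t) k (chart_param i x) * rho i x))//.
  have := is_deriveM (derivableP dw) (is_derive_cst (rho i x) (0 : R) (1 : R)).
  move=> h; rewrite [LHS](@derive_val _ _ _ _ _ _ _ h).
  by rewrite scaler0 add0r /GRing.scale /= mulrC.
rewrite !density_coef_weighted /divergence_op /flux /flux_coef => ->.
(* The flux is built from the ambient hypothesis for [phi], the variation formula from the one for
   [Phi 0]; proof irrelevance identifies them. *)
generalize hF; rewrite -E => h; rewrite (Prop_irrelevance h (hFt 0)); congr (_ - _); ring.
Qed.

End FixedPotential.
End Variation.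

Lemma Rintegral_eq0 {R : realType} d (T : measurableType d) (mu : {measure set T -> \bar R})
  (f : T -> R) : (forall x, f x = 0) -> \int[mu]_x f x = 0.
Proof.
by move=> f0; rewrite /Rintegral; under eq_integral do rewrite f0; rewrite integral0.
Qed.

(** * The linearised coefficient and its vanishing integral *)

Section Linearisation.
Context {R : realType} {n : nat} {M : ptopologicalType} {A : atlas R n M}.
Variables (hausM : hausdorff_space M) (g : components A) (hg : riemannian g).
Variables (vol : {measure set (borel M) -> \bar R}) (hvol : riemannian_volume g vol).
Variables (lambda : R) (phi0 : M -> R) (amb : (M -> R) -> wfamily A).
Hypothesis hphi0 : smooth_fun A phi0.
Hypothesis hamb : forall phi, conformal_class A phi0 phi -> normal_ambient g lambda phi (amb phi).
Variables (phi : M -> R) (cphi : conformal_class A phi0 phi) (k : nat) (hk : (0 < k)%N).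
Local Notation rho := (chart_density g).
Local Notation wc := (weighted_coef g lambda amb).
Local Notation div := (divergence_op hamb cphi k).

Let img_at (p : M) : chart_img (chart_at A p) (chart_coord (chart_at A p) p).
Proof. by exists p => //; exact: chart_atP. Qed.

Let rhoN0 (i : chart_index A) x : chart_img i x -> rho i x != 0.
Proof. by move=> Ox; rewrite lt0r_neq0//; exact: (chart_density_gt0 hg Ox). Qed.

(** Computed in the chart attached to the point. That another chart gives the same value is seen
    below without transforming the flux. *)
Definition linearisation (om : M -> R) (p : M) : R :=
  let i := chart_at A p in let x := chart_coord i p in
  div (img_at p) (om \o chart_param i) x / rho i x.

Definition line (om : M -> R) (t : R) : M -> R := phi \+ (fun p => t * om p).

Lemma conformal_class_smooth f : conformal_class A phi0 f -> smooth_fun A f.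
Proof. by case=> w sw -> i j; apply: Ck_onD; [exact: img_open|exact: hphi0|exact: sw]. Qed.

Lemma joint_snd (i : chart_index A) (f : 'rV[R]_n -> R) : smooth_on (chart_img i) f ->
  smooth_on (joint_dom i) (fun q => f q.2).
Proof.
move=> sf j; apply: (@Ck_on_affine _ _ _ _ _ (chart_img i) _ f snd snd) => //.
exact: snd_continuous.
Qed.

Lemma joint_fst l (i : chart_index A) : Ck_on l (joint_dom i) (fun q => q.1 : R).
Proof. by apply: Ck_on_linear => //; exact: fst_continuous. Qed.

Lemma line_curve om : smooth_fun A om -> class_curve (A := A) phi0 (line om).
Proof.
move=> so; split=> [i j|t].
  have oJ := @joint_dom_open R n M A i.
  exact: (Ck_onD oJ (joint_snd (conformal_class_smooth cphi i) j)
    (Ck_onM oJ (joint_fst j i) (joint_snd (so i) j))).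
have [w sw pw] := cphi; exists (w \+ (fun p => t * om p)).
  move=> i j; have oi : open (chart_img i) by exact: img_open.
  apply: (Ck_onD oi (f := w \o chart_param i) (g := fun x => t * om (chart_param i x))); first exact: sw.
  apply: (Ck_onM oi (f := fun=> t) (g := om \o chart_param i)); first exact: Ck_on_cst.
  exact: so.
by apply/funext => p; rewrite /line pw /= addrA.
Qed.

Lemma line0 om : line om 0 = phi.
Proof. by apply/funext => p; rewrite /line /= mul0r addr0. Qed.

Lemma derive_line om p : 'D_1 (fun t => line om t p) 0 = om p.
Proof.
rewrite /line /=; apply: derive_val.
have -> : (fun t => phi p + t * om p) = (fun t => t *: om p + phi p).
  by apply/funext => t; rewrite addrC.
have d : derivable (@id R) (0 *: om p + phi p) (om p) by exact: derivable_id.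
by have := is_derive_line d; rewrite derive_id.
Qed.

(** In either chart the divergence, divided by the volume density, is the derivative of one and the
    same weighted coefficient along the line phi + t om plus the same zeroth-order term. *)
Lemma linearisationE om (i : chart_index A) x0 (Ox0 : chart_img i x0) x : smooth_fun A om ->
  chart_img i x ->
  linearisation om (chart_param i x) * rho i x = div Ox0 (om \o chart_param i) x.
Proof.
move=> so Ox; pose p := chart_param i x; pose c := chart_at A p; pose y := chart_coord c p.
have cp : chart_dom c p by exact: chart_atP.
have py : chart_param c y = p by exact: coordK.
have Oy : chart_img c y by exact: img_at.
have cc := line_curve so.
have omE j : (fun x => 'D_1 (fun t => line om t (chart_param j x)) 0) = om \o chart_param j.
  by apply/funext => z; exact: derive_line.
have := curve_variation hg hamb cphi hk Ox0 cc (line0 om) Ox.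
have := curve_variation hg hamb cphi hk (img_at p) cc (line0 om) Oy.
rewrite !omE !derive_line -/p -/c -/y py.
rewrite /linearisation -/p -/c -/y; have nc := rhoN0 Oy; have ni := rhoN0 Ox.
set d1 := div _ _ y; set d2 := div _ _ x; set D1 := derive _ _ _.
set T := om p * _ => h1 h2.
have -> : d1 = (D1 + T) * rho c y by rewrite mulrDl h1 subrK.
have -> : d2 = (D1 + T) * rho i x by rewrite mulrDl h2 subrK.
by rewrite mulfK.
Qed.

Lemma curve_velocity_smooth Phi : class_curve (A := A) phi0 Phi ->
  smooth_fun A (fun p => 'D_1 (fun t => Phi t p) 0).
Proof.
move=> [sPhi _] i.
exact: (joint_slice_smooth (f := fun q => 'D_1 (fun t => Phi t (chart_param i q.2)) q.1)
  (joint_derive1_smooth (sPhi i)) 0).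
Qed.

Lemma curve_linearisation Phi p : class_curve (A := A) phi0 Phi -> Phi 0 = phi ->
  'D_1 (fun t => wc (Phi t) k p) 0 = linearisation (fun p => 'D_1 (fun t => Phi t p) 0) p
    - 'D_1 (fun t => Phi t p) 0 * (wc phi k p - lambda * wc phi k.-1 p).
Proof.
move=> cc E; pose i := chart_at A p; pose x := chart_coord i p.
have ip : chart_dom i p by exact: chart_atP.
have Ox : chart_img i x by exists p.
have px : chart_param i x = p by exact: coordK.
have := curve_variation hg hamb cphi hk Ox cc E Ox.
rewrite -(linearisationE Ox (curve_velocity_smooth cc) Ox) px -mulrBl.
exact/mulIf/rhoN0.
Qed.

Lemma linearisationD om1 om2 p : smooth_fun A om1 -> smooth_fun A om2 ->
  linearisation (om1 \+ om2) p = linearisation om1 p + linearisation om2 p.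
Proof.
move=> s1 s2; rewrite /linearisation -mulrDl -divergence_opD//.
Qed.

Lemma linearisation_local om p (U : set M) : open U -> U p -> (forall q, U q -> om q = 0) ->
  linearisation om p = 0.
Proof.
move=> oU Up om0; set i := chart_at A p.
have oV : open (chart_img i `&` chart_param i @^-1` U).
  by apply: continuous_open_preimage => //; [exact: img_open|move=> x; exact: param_continuous].
have Vp : (chart_img i `&` chart_param i @^-1` U) (chart_coord i p).
  by split; [exact: img_at|rewrite /= coordK//; exact: chart_atP].
rewrite /linearisation (divergence_op_local hamb cphi k (img_at p) oV Vp (h2 := cst 0)).
  by rewrite divergence_op0 mul0r.
by move=> x /set_mem[_ Ux] /=; exact: om0.
Qed.

Lemma linearisation_smooth om : smooth_fun A om -> smooth_fun A (linearisation om).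
Proof.
move=> so i j; have oi : open (chart_img i) by exact: img_open.
apply: (@Ck_on_local _ _ _ _ _ (linearisation om \o chart_param i)) => // x0 Ox0.
exists (chart_img i); split=> //.
apply: (eq_Ck_on oi (f := fun x => div Ox0 (om \o chart_param i) x * (rho i x)^-1)).
  by move=> x /set_mem Ox; rewrite -linearisationE// mulfK// rhoN0.
apply: Ck_onM => //; first exact: (divergence_op_smooth hamb cphi k Ox0 (so i)).
apply: Ck_onV => //; first by move=> x; exact: rhoN0.
exact: chart_density_smooth.
Qed.

Let linearisation_supp om (K : set M) p : compact K -> (forall p, ~ K p -> om p = 0) ->
  ~ K p -> linearisation om p = 0.
Proof.
move=> cK om0 nKp; apply: (@linearisation_local _ _ (~` K)) => //.
by apply: closed_openC; exact: compact_closed.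
Qed.

Lemma integral_linearisation_chart om (i : chart_index A) (K : set M) : smooth_fun A om ->
  compact K -> K `<=` chart_dom i -> (forall p, ~ K p -> om p = 0) ->
  \int[vol]_p linearisation om p = 0.
Proof.
move=> so cK Ki om0; have lin0 p := @linearisation_supp om K p cK om0.
have [[x0 Ox0]|nimg] := pselect (exists x0, chart_img i x0); last first.
  apply: Rintegral_eq0 => p; apply: lin0 => Kp; apply: nimg; exists (chart_coord i p).
  by exists p => //; exact: Ki.
have oi : open (chart_img i) by exact: img_open.
pose L := chart_coord i @` K.
have cL : compact L.
  apply: continuous_compact => //; apply: continuous_in_subspaceT => p /set_mem/Ki ip.
  exact: Defs.coord_continuous.
have clL : closed L by apply: compact_closed => //; exact: row_hausdorff.
have Limg : L `<=` chart_img i by move=> _ [p Kp <-]; exists p => //; exact: Ki.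
have LK x : chart_img i x -> K (chart_param i x) -> L x.
  by move=> Ox Kx; exists (chart_param i x) => //; exact: chart_paramK.
pose h := om \o chart_param i.
(* The flux extended by zero outside the chart; it is smooth on all of R^n because it vanishes off
   the compact set [L]. *)
pose F a x : R := if pselect (chart_img i x) then flux hamb cphi k Ox0 a h x else 0.
have FE a x : chart_img i x -> F a x = flux hamb cphi k Ox0 a h x.
  by move=> Ox; rewrite /F; case: (pselect (chart_img i x)).
have oC : open (~` L) by exact: closed_openC.
have h0 x : chart_img i x -> ~ L x -> h x = 0.
  by move=> Ox nL; apply: om0 => Kx; apply: nL; exact: LK.
have F0 a x : ~ L x -> F a x = 0.
  move=> nL; rewrite /F; case: (pselect (chart_img i x)) => // Ox.
  rewrite /flux big1// => b _.
  rewrite (partial_local b (openI oi oC) (conj Ox nL) (h2 := cst 0)).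
    by rewrite /partial derive_cst mulr0.
  by move=> y /set_mem[Oy nLy]; exact: h0.
have sF a l : Ck_on l setT (F a).
  apply: (@Ck_on_local _ _ _ _ _ (F a)); first exact: openT.
  move=> x _; have [Lx|nLx] := pselect (L x).
    exists (chart_img i); split=> //; first exact: Limg.
    apply: (eq_Ck_on oi) (flux_smooth hamb cphi k Ox0 a (so i) l).
    by move=> y /set_mem Oy; rewrite FE.
  exists (~` L); split=> //.
  by apply: (eq_Ck_on oC) (Ck_on_cst l (~` L) (0 : R)) => y /set_mem nL; rewrite F0.
have DF0 a x : ~ L x -> 'D_('e_a) (F a) x = 0.
  move=> nL; have := partial_local a oC (x := x) nL (h1 := F a) (h2 := cst 0).
  rewrite /partial derive_cst; apply => y /set_mem; exact: F0.
have DFE a x : chart_img i x -> 'D_('e_a) (F a) x = partial a (flux hamb cphi k Ox0 a h) x.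
  by move=> Ox; apply: (partial_local a oi Ox) => y /set_mem; exact: FE.
have cDF a : continuous ('D_('e_a) (F a)).
  by have [_ /(_ 'e_a) [_ [c _]]] := sF a 1; move=> x; exact: c.
have [r r0 Lr] : exists2 r : R, 0 < r & L `<=` ball 0 r.
  have [r [_ rL]] := compact_bounded cL.
  exists (`|r| + 2); first by rewrite ltr_wpDl.
  move=> x /(rL (`|r| + 1)) h'; rewrite -ball_normE /= sub0r normrN.
  apply: le_lt_trans (h' _) _; last by rewrite ltrD2l ltr1n.
  by rewrite (le_lt_trans (ler_norm r))// ltrDl.
have int0 a : \int[row_volume n]_x 'D_('e_a) (F a) x = 0.
  have F0b x : ~ ball 0 r x -> F a x = 0 by move=> nb; apply: F0 => Lx; apply: nb; exact: Lr.
  exact: (@Rintegral_derive_eq0 R n (F a) 'e_a r r0 (sF a 1) F0b).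
have fL : (row_volume n L < +oo)%E.
  have /andP[_] := row_volume_ball (0 : 'rV[R]_n) r0; apply: le_lt_trans.
  apply: (@le_measure _ _ _ (row_volume n)) => //; apply/mem_set.
    by apply: compact_borel => //; exact: row_hausdorff.
  by apply: open_borel; exact: ball_open.
have iDF a : (row_volume n).-integrable setT (EFin \o 'D_('e_a) (F a)).
  exact: (compact_support_integrable (@row_hausdorff R n) cL fL (cDF a) (DF0 a)).
rewrite (chart_Rintegral hg hvol (i := i) (h := fun x => \sum_a 'D_('e_a) (F a) x)).
(* Additivity over the coordinates is proved together with integrability, which each further summand
   requires. *)
- pose P (s : seq 'I_n) := \int[row_volume n]_x (\sum_(a <- s) 'D_('e_a) (F a) x) = 0 /\
    (row_volume n).-integrable setT (EFin \o (fun x => \sum_(a <- s) 'D_('e_a) (F a) x)).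
  suff [] : P (index_enum 'I_n) by [].
  elim: (index_enum 'I_n) => [|a s [IH1 IH2]].
    split; first by apply: Rintegral_eq0 => x; rewrite big_nil.
    have -> : EFin \o (fun x : 'rV[R]_n => \sum_(a <- [::]) 'D_('e_a) (F a) x) = cst 0%E.
      by apply/funext => x /=; rewrite big_nil.
    exact: integrable0.
  rewrite /P; under eq_fun do rewrite big_cons.
  split; first by rewrite RintegralD// IH1 int0 addr0.
  have := integrableD measurableT (iDF a) IH2.
  by apply: eq_integrable.
- by apply: continuous_measurable; exact: smooth_fun_continuous (linearisation_smooth so).
- by move=> p np; apply: lin0 => /Ki.
- by move=> x Ox; rewrite mulrC (linearisationE Ox0 so Ox); apply: eq_bigr => a _; exact: DFE.
- by move=> x nOx; rewrite big1// => a _; apply: DF0 => /Limg.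
Qed.

Lemma smooth_funM (f1 f2 : M -> R) : smooth_fun A f1 -> smooth_fun A f2 ->
  smooth_fun A (fun p => f1 p * f2 p).
Proof. by move=> s1 s2 i j; apply: Ck_onM; [exact: img_open|exact: s1|exact: s2]. Qed.

Lemma smooth_funN (f : M -> R) : smooth_fun A f -> smooth_fun A (fun p => - f p).
Proof. by move=> s1 i j; apply: Ck_onN; [exact: img_open|exact: s1]. Qed.

Lemma smooth_funD (f1 f2 : M -> R) : smooth_fun A f1 -> smooth_fun A f2 ->
  smooth_fun A (fun p => f1 p + f2 p).
Proof. by move=> s1 s2 i j; apply: Ck_onD; [exact: img_open|exact: s1|exact: s2]. Qed.

Lemma smooth_fun_cst (c : R) : smooth_fun A (fun=> c).
Proof. by move=> i j; exact: Ck_on_cst. Qed.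

Lemma linearisation_integrable om (K : set M) : smooth_fun A om -> compact K ->
  (forall p, ~ K p -> om p = 0) -> vol.-integrable setT (EFin \o linearisation om).
Proof.
move=> so cK om0; apply: (continuous_integrable hausM hg hvol cK).
  exact: smooth_fun_continuous (linearisation_smooth so).
by move=> p; exact: linearisation_supp.
Qed.

(* Fragmentation: split off [om * B p] for one bump [B p] at a time. *)
Lemma integral_linearisation om (K : set M) : smooth_fun A om -> compact K ->
  (forall p, ~ K p -> om p = 0) -> \int[vol]_p linearisation om p = 0.
Proof.
move=> so cK om0.
pose bumpAt (p : M) (b : M -> R) (L N : set M) := [/\ smooth_fun A b,
  forall q, 0 <= b q <= 1, compact L /\ L `<=` setT `&` chart_dom (chart_at A p),
  forall q, ~ L q -> b q = 0 & [/\ open N, N p & forall q, N q -> b q = 1]].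
have bP p : exists bLN : (M -> R) * set M * set M, bumpAt p bLN.1.1 bLN.1.2 bLN.2.
  have [b [L [N h]]] := bump_function hausM (chart_atP A p) openT (I : [set: M] p).
  by exists (b, L, N).
pose B p := (projT1 (cid (bP p))).1.1; pose L p := (projT1 (cid (bP p))).1.2.
pose N p := (projT1 (cid (bP p))).2.
have BP p : bumpAt p (B p) (L p) (N p) by exact: projT2 (cid (bP p)).
have [||s sK] := compact_seq_cover cK (N := N).
- by move=> p; have [_ _ _ _ []] := BP p.
- by move=> p; have [_ _ _ _ []] := BP p.
have {sK} : forall x, om x != 0 -> exists2 p, p \in s & N p x.
  move=> x omx; apply: sK; apply: contrapT => /om0 omx0; by rewrite omx0 eqxx in omx.
elim: s om so om0 => [|p s IH] om so om0 oms.
  apply: Rintegral_eq0 => q; apply: (linearisation_local openT) => // q' _.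
  by apply: contrapT => /eqP/oms[].
have [sb b01 [cLp Lpi] bL [oN Np bN]] := BP p.
pose o1 q := om q * B p q; pose o2 q := om q * (1 - B p q).
have s1 : smooth_fun A o1 by exact: smooth_funM.
have s2 : smooth_fun A o2.
  by apply: smooth_funM => //; apply: smooth_funD; [exact: smooth_fun_cst|exact: smooth_funN].
have o10 q : ~ L p q -> o1 q = 0 by move=> /bL h; rewrite /o1 h mulr0.
have o20 q : ~ K q -> o2 q = 0 by move=> /om0 h; rewrite /o2 h mul0r.
have -> : om = o1 \+ o2 by apply/funext => q; rewrite /o1 /o2 /=; ring.
have -> : \int[vol]_q linearisation (o1 \+ o2) q = \int[vol]_q (linearisation o1 q + linearisation o2 q).
  by apply: eq_Rintegral => q _; exact: linearisationD.
rewrite RintegralD//; [|exact: (linearisation_integrable s1 cLp o10)|exact: (linearisation_integrable s2 cK o20)].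
have int1 := integral_linearisation_chart s1 cLp (fun q Lq => (Lpi q Lq).2) o10.
have int2 : \int[vol]_p linearisation o2 p = 0.
  (* Where [B p] is 1 the remainder [o2] vanishes, so the rest of the list covers the points where
     it does not. *)
  apply: IH => // q; rewrite /o2 mulf_eq0 negb_or => /andP[/oms[r]].
  rewrite inE => /orP[/eqP ->|rs Nr _]; last by exists r.
  by move=> /bN ->; rewrite subrr eqxx.
exact: etrans (f_equal2 +%R int1 int2) (addr0 0).
Qed.

End Linearisation.

(** * Derivatives of the functional and of the constraint *)

Section CriticalPoints.
Context {R : realType} {n : nat} {M : ptopologicalType} {A : atlas R n M}.
Variables (hausM : hausdorff_space M) (g : components A) (hg : riemannian g).
Variables (vol : {measure set (borel M) -> \bar R}) (hvol : riemannian_volume g vol).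
Variables (lambda : R) (phi0 : M -> R) (amb : (M -> R) -> wfamily A).
Hypothesis hphi0 : smooth_fun A phi0.
Hypothesis hamb : forall phi, conformal_class A phi0 phi -> normal_ambient g lambda phi (amb phi).
Variables (k : nat) (hk : (0 < k)%N).
Local Notation wc := (weighted_coef g lambda amb).
Local Notation tau := (1 / (2 * lambda)).

Lemma chart_joint_derivable (f : R -> M -> R) t p :
  (forall i : chart_index A, smooth_on (joint_dom i) (fun q => f q.1 (chart_param i q.2))) ->
  derivable (fun t => f t p) t 1.
Proof.
move=> sf; have ip := chart_atP A p.
have Ox : chart_img (chart_at A p) (chart_coord (chart_at A p) p) by exists p.
have := joint_derivable (sf (chart_at A p)) (t := t) Ox.
by rewrite /= coordK.
Qed.

Lemma chart_joint_continuous (f : R -> M -> R) :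
  (forall i : chart_index A, smooth_on (joint_dom i) (fun q => f q.1 (chart_param i q.2))) ->
  continuous (fun q : R * M => f q.1 q.2).
Proof.
move=> sf [t p]; set i := chart_at A p; have ip : chart_dom i p by exact: chart_atP.
have Ox : chart_img i (chart_coord i p) by exists p.
have [c _] := sf i 0.
pose toc (q : R * M) := (q.1, chart_coord i q.2).
apply: (@near_eq_continuous _ _ ((fun q => f q.1 (chart_param i q.2)) \o toc)).
  have : \forall q \near (t, p), chart_dom i q.2.
    apply: (@snd_continuous R M (t, p) (chart_dom i)).
    by apply: open_nbhs_nbhs; split=> //; exact: dom_open.
  by apply: filterS => q iq /=; rewrite coordK.
apply: continuous_comp; last exact: c.
apply: pair_continuous; first exact: fst_continuous.
apply: (@continuous_comp _ _ _ snd (chart_coord i)); first exact: snd_continuous.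
exact: Defs.coord_continuous.
Qed.

Lemma joint_fun_smooth (f : R -> M -> R) t :
  (forall i : chart_index A, smooth_on (joint_dom i) (fun q => f q.1 (chart_param i q.2))) ->
  smooth_fun A (f t).
Proof. by move=> sf i; exact: (joint_slice_smooth (sf i) t). Qed.

(** For |t| <= 1 the time derivative is continuous and supported in [K], hence dominated by a
    multiple of the indicator of [K], which has finite volume. *)
Lemma is_derive_joint (f : R -> M -> R) (K : set M) :
  (forall i : chart_index A, smooth_on (joint_dom i) (fun q => f q.1 (chart_param i q.2))) ->
  compact K -> (forall t p, ~ K p -> 'D_1 (f ^~ p) t = 0) ->
  vol.-integrable setT (EFin \o f 0) ->
  is_derive (0 : R) 1 (fun t => \int[vol]_p f t p) (\int[vol]_p 'D_1 (f ^~ p) 0).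
Proof.
move=> sf cK D0 i0.
have sD (i : chart_index A) : smooth_on (joint_dom i) (fun q => 'D_1 (f ^~ (chart_param i q.2)) q.1).
  exact: (joint_derive1_smooth (sf i)).
have cD := chart_joint_continuous (f := fun t p => 'D_1 (f ^~ p) t) sD.
have cIK : compact (`[-1, 1]%classic `*` K : set (R * M)).
  by apply: compact_setX => //; exact: segment_compact.
have [C C0 CD] := compact_fun_bound cIK cD.
have mK : measurable (K : set (borel M)) by exact: compact_borel.
have fK : (vol K < +oo)%E by exact: (vol_compact hausM hg hvol cK).
apply: (@is_derive_Rintegral R _ (borel M) vol f (fun p => C * \1_K p) i0).
- move=> t; apply: continuous_measurable; apply: (@smooth_fun_continuous R n M A).
  exact: joint_fun_smooth.
- by move=> t p; exact: chart_joint_derivable.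
- by move=> p; rewrite mulr_ge0.
- exact: (integrable_cst_indic C mK fK).
- move=> t p /andP[t1 t2]; rewrite indicE; have [Kp|nKp] := pselect (K p).
    rewrite (mem_set Kp) mulr1; apply: (CD (t, p)); split=> //=.
    by rewrite in_itv /= !ltW.
  by rewrite D0// normr0 mulr_ge0.
Qed.

Lemma class_curve_shift (Phi : R -> M -> R) t : class_curve (A := A) phi0 Phi ->
  class_curve (A := A) phi0 (fun s => Phi (s + t)).
Proof.
move=> [sPhi cPhi]; split=> [i j|s]; last exact: cPhi.
pose L (q : R * 'rV[R]_n) := (q.1 + t, q.2).
apply: (@Ck_on_affine _ _ _ _ _ (joint_dom i) _ (fun q => Phi q.1 (chart_param i q.2)) L id) => //.
- by move=> h w x; rewrite /L /= -addrA.
- move=> q; apply: (@pair_continuous _ _ _ (fun q : R * 'rV[R]_n => q.1 + t) snd); last exact: snd_continuous.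
  by apply: (@continuous_comp _ _ _ fst (fun s : R => s + t)); [exact: fst_continuous|exact: translation_continuous].
- exact: (sPhi i j).
Qed.

(* The ambient metric is only given pointwise in [t]; that the coefficients do not
   change where the potential does not is read off the variation formula. *)
Lemma weighted_coef_static (Phi : R -> M -> R) (U : set M) t p : class_curve (A := A) phi0 Phi ->
  open U -> U p -> (forall s q, U q -> Phi s q = Phi 0 q) ->
  'D_1 (fun t => wc (Phi t) k p) t = 0.
Proof.
move=> cc oU Up st; have cs := class_curve_shift t cc.
transitivity ('D_1 (fun s => wc (Phi (s + t)) k p) 0).
  have := @derive_affine R R R R (fun t => wc (Phi t) k p) (fun s => s + t) id 0 1.
  by rewrite add0r => <- // h; rewrite addr0 [RHS]/=.
have c0 : conformal_class A phi0 (Phi t) by have [_] := cc; exact.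
have E0 : Phi (0 + t) = Phi t by rewrite add0r.
rewrite (curve_linearisation hg hphi0 hamb c0 hk p cs E0).
have om0 q : U q -> 'D_1 (fun s => Phi (s + t) q) 0 = 0.
  move=> Uq; transitivity ('D_1 (cst (Phi 0 q) : R -> R) 0); last exact: derive_cst.
  by congr (derive _ (0 : R) (1 : R)); apply/funext => s; exact: st.
by rewrite om0// mul0r subr0; exact: (linearisation_local hamb c0 k oU Up om0).
Qed.

Section Base.
Variable phi : M -> R.
Hypothesis hphi : conformal_class1 A vol phi0 lambda phi.
Hypothesis hW : vol.-integrable setT (fun p => (W_integrand g lambda amb k phi p)%:E).

Let cphi : conformal_class A phi0 phi. Proof. by case: hphi. Qed.
Let sphi : smooth_fun A phi. Proof. exact: (conformal_class_smooth hphi0 cphi). Qed.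

Definition gradient (p : M) : R :=
  v_coef g lambda phi (amb phi) k p - lambda * v_coef g lambda phi (amb phi) k.-1 p.

Let c : R := gauss_factor n tau.
Let kappa := tau ^+ k * c.

Lemma weight_smooth : smooth_fun A (fun p => expR (- phi p)).
Proof.
move=> i j; apply: Ck_on_exp; first exact: img_open.
by apply: Ck_onN; [exact: img_open|exact: sphi].
Qed.

Lemma gradient_smooth : smooth_fun A gradient.
Proof.
have s1 := weighted_coef_smooth hg hphi0 hamb k cphi.
have s2 := weighted_coef_smooth hg hphi0 hamb k.-1 cphi.
have sE : smooth_fun A (fun p => expR (phi p)).
  by move=> i j; apply: Ck_on_exp; [exact: img_open|exact: sphi].
have -> : gradient = (fun p => (wc phi k p + (- lambda) * wc phi k.-1 p) * expR (phi p)).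
  apply/funext => p; rewrite /gradient /weighted_coef.
  have e : expR (- phi p) * expR (phi p) = 1 by rewrite -expRD addNr expR0.
  transitivity (gradient p * (expR (- phi p) * expR (phi p))); first by rewrite e mulr1.
  by rewrite /gradient; ring.
apply: smooth_funM => //.
by apply: smooth_funD => //; apply: smooth_funM => //; exact: smooth_fun_cst.
Qed.

(** With [c = 0] the normalisation would read 0 = 1. This excludes the case in which [gauss_factor]
    has its default value. *)
Lemma factor_neq0 : c != 0.
Proof.
have [_ h] := hphi; apply/eqP => c0; move: h; rewrite -/c c0.
rewrite Rintegral_eq0; last by move=> p; rewrite mul0r.
by move/eqP; rewrite eq_sym oner_eq0.
Qed.

(** The constraint concerns a real-valued integral, which is 0 by default when the extended one is
    infinite. The value 1 therefore forces convergence, whatever the sign of [c]. *)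
Lemma weight_integrable : vol.-integrable setT (fun p => (expR (- phi p))%:E).
Proof.
have mE : measurable_fun setT (fun p : borel M => (expR (- phi p))%:E).
  apply/measurable_EFinP; apply: continuous_measurable.
  exact: smooth_fun_continuous weight_smooth.
apply/integrableP; split=> //; rewrite ltey; apply/eqP => h.
have hE : (\int[vol]_p (expR (- phi p))%:E = +oo)%E.
  by rewrite -h; apply: eq_integral => p _; rewrite gee0_abs// lee_fin expR_ge0.
have e0 p : (0 <= (expR (- phi p))%:E)%E by rewrite lee_fin expR_ge0.
have [_] := hphi; rewrite -/c /Rintegral.
have [c0|c0|c0] := ltgtP c 0; last by move: factor_neq0; rewrite c0 eqxx.
  have -> : (\int[vol]_p (c * expR (- phi p))%:E = -oo)%E.
    transitivity (\int[vol]_p (- ((- c)%:E * (expR (- phi p))%:E)))%E.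
      by apply: eq_integral => p _; rewrite -EFinM -EFinN; congr (_%:E); ring.
    rewrite integral_ge0N; last by move=> p _; rewrite mule_ge0// lee_fin oppr_ge0 ltW.
    rewrite ge0_integralZl//; last by rewrite lee_fin oppr_ge0 ltW.
    by rewrite hE gt0_muley// lte_fin oppr_gt0.
  by move/eqP; rewrite /= eq_sym oner_eq0.
have -> : (\int[vol]_p (c * expR (- phi p))%:E = +oo)%E.
  under eq_integral do rewrite EFinM.
  by rewrite ge0_integralZl ?lee_fin ?ltW// hE gt0_muley// lte_fin.
by move/eqP; rewrite /= eq_sym oner_eq0.
Qed.

Section Curve.
Variable Phi : R -> M -> R.
Hypothesis hPhi : C1_curve A vol phi0 lambda phi Phi.
Let om p := 'D_1 (fun t => Phi t p) 0.

Let cc : class_curve (A := A) phi0 Phi.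
Proof. by case: hPhi => sPhi _ _ h; split=> // t; case: (h t). Qed.
Let Phi_0 : Phi 0 = phi. Proof. by case: hPhi. Qed.

Let som : smooth_fun A om. Proof. exact: (curve_velocity_smooth cc). Qed.

Let om_off (K : set M) p : (forall t p, ~ K p -> Phi t p = phi p) -> ~ K p -> om p = 0.
Proof.
move=> off nK; transitivity ('D_1 (cst (phi p) : R -> R) 0); last exact: derive_cst.
by congr (derive _ (0 : R) (1 : R)); apply/funext => t; exact: off.
Qed.

Lemma W_derivative :
  is_derive (0 : R) 1 (fun t => W_functional vol g lambda amb k (Phi t))
    (- (kappa * \int[vol]_p (om p * gradient p * expR (- phi p)))).
Proof.
have [_ _ [K cK off] _] := hPhi.
have oK : open (~` K) by apply: closed_openC; exact: compact_closed.
have WE t p : W_integrand g lambda amb k (Phi t) p = kappa * wc (Phi t) k p.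
  by rewrite /W_integrand /weighted_coef /kappa /c; ring.
have sw := weighted_coef_joint hg hamb k ^~ cc.
have sW (i : chart_index A) : smooth_on (joint_dom i)
    (fun q => W_integrand g lambda amb k (Phi q.1) (chart_param i q.2)).
  move=> j; apply: (eq_Ck_on (@joint_dom_open R n M A i)
    (f := fun q => kappa * wc (Phi q.1) k (chart_param i q.2))).
    by move=> q _; rewrite WE.
  by apply: Ck_onM; [exact: joint_dom_open|exact: Ck_on_cst|exact: sw].
have DW t p : 'D_1 (fun t => W_integrand g lambda amb k (Phi t) p) t =
    kappa * 'D_1 (fun t => wc (Phi t) k p) t.
  have dw : derivable (fun t => wc (Phi t) k p) t 1.
    by apply: (chart_joint_derivable (f := fun t => wc (Phi t) k)) => i; exact: sw.
  have -> : (fun t => W_integrand g lambda amb k (Phi t) p) = kappa \*: (fun t => wc (Phi t) k p).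
    by apply/funext => s; rewrite WE.
  by rewrite deriveZ.
have off0 t p : ~ K p -> 'D_1 (fun t => W_integrand g lambda amb k (Phi t) p) t = 0.
  move=> nK; rewrite DW (weighted_coef_static t cc oK nK) ?mulr0// => s q nKq.
  by rewrite Phi_0; exact: off.
have i0 : vol.-integrable setT (EFin \o W_integrand g lambda amb k (Phi 0)) by rewrite Phi_0.
have := is_derive_joint (f := fun t => W_integrand g lambda amb k (Phi t)) sW cK off0 i0.
have om0 p : ~ K p -> om p = 0 by exact: om_off.
have ilin := linearisation_integrable hausM hg hvol hphi0 hamb cphi hk som cK om0.
have iog : vol.-integrable setT (EFin \o (fun p => om p * gradient p * expR (- phi p))).
  apply: (continuous_integrable hausM hg hvol cK).
    exact: (smooth_fun_continuous (smooth_funM (smooth_funM som gradient_smooth) weight_smooth)).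
  by move=> p /om0 ->; rewrite !mul0r.
suff -> : \int[vol]_p 'D_1 (fun t => W_integrand g lambda amb k (Phi t) p) 0 =
    - (kappa * \int[vol]_p (om p * gradient p * expR (- phi p))) by [].
transitivity (\int[vol]_p (kappa * (linearisation hamb cphi k om p - om p * gradient p * expR (- phi p)))).
  apply: eq_Rintegral => p _; rewrite DW (curve_linearisation hg hphi0 hamb cphi hk p cc Phi_0).
  by congr (_ * (_ - _)); rewrite /weighted_coef /gradient -/(om p); ring.
rewrite RintegralZl//; last first.
  by have := integrableB measurableT ilin iog; apply: eq_integrable.
rewrite RintegralB// (integral_linearisation hausM hg hvol hphi0 hamb cphi hk som cK om0).
by rewrite sub0r mulrN.
Qed.

(** The constraint integral is constant along the curve, and its derivative is this mean multiplied
    by the nonzero number [- c]. *)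
Lemma velocity_mean0 : \int[vol]_p (om p * expR (- phi p)) = 0.
Proof.
have [sPhi _ [K cK off] h1] := hPhi.
have sE (i : chart_index A) :
    smooth_on (joint_dom i) (fun q => c * expR (- Phi q.1 (chart_param i q.2))).
  move=> j; have oJ := @joint_dom_open R n M A i.
  apply: Ck_onM => //; first exact: Ck_on_cst.
  by apply: Ck_on_exp => //; apply: Ck_onN => //; exact: sPhi.
have off0 t p : ~ K p -> 'D_1 (fun t => c * expR (- Phi t p)) t = 0.
  move=> nK; transitivity ('D_1 (cst (c * expR (- phi p)) : R -> R) t); last exact: derive_cst.
  by congr (derive _ t (1 : R)); apply/funext => s; rewrite off.
have i0 : vol.-integrable setT (EFin \o (fun p => c * expR (- Phi 0 p))).
  by rewrite Phi_0; exact: (integrableZl measurableT c weight_integrable).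
have := is_derive_joint (f := fun t p => c * expR (- Phi t p)) sE cK off0 i0.
have DE p : 'D_1 (fun t => c * expR (- Phi t p)) 0 = - c * (om p * expR (- phi p)).
  have d : derivable (fun t => Phi t p) 0 1 by exact: chart_joint_derivable.
  have h := is_derive_comp1 (f := fun t => - Phi t p) (is_derive_expR (- Phi 0 p)) (is_deriveN (derivableP d)).
  have -> : (fun t => c * expR (- Phi t p)) = c \*: (expR \o (fun t => - Phi t p)) by [].
  rewrite deriveZ; last by case: h.
  by rewrite [X in _ *: X](@derive_val _ _ _ _ _ _ _ h) Phi_0 -/(om p) /GRing.scale /=; ring.
have -> : (fun t => \int[vol]_p (c * expR (- Phi t p))) = cst 1.
  by apply/funext => t; have [_] := h1 t.
move=> h; have := @derive_val _ _ _ _ _ _ _ h; rewrite derive_cst => /esym.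
have -> : \int[vol]_p 'D_1 (fun t => c * expR (- Phi t p)) 0 =
    \int[vol]_p (- c * (om p * expR (- phi p))) by apply: eq_Rintegral => p _; exact: DE.
have om0 p : ~ K p -> om p = 0 by exact: om_off.
rewrite RintegralZl//; last first.
  apply: (continuous_integrable hausM hg hvol cK).
    exact: (smooth_fun_continuous (smooth_funM som weight_smooth)).
  by move=> p /om0 ->; rewrite mul0r.
by move/eqP; rewrite mulf_eq0 oppr_eq0 (negbTE factor_neq0) => /eqP.
Qed.

End Curve.
End Base.
End CriticalPoints.

(** * Critical points *)

Section TestCurve.
Context {R : realType} {n : nat} {M : ptopologicalType} {A : atlas R n M}.
Variables (hausM : hausdorff_space M) (g : components A) (hg : riemannian g).
Variables (vol : {measure set (borel M) -> \bar R}) (hvol : riemannian_volume g vol).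
Variables (lambda : R) (phi0 : M -> R) (hphi0 : smooth_fun A phi0).
Variables (phi : M -> R) (hphi : conformal_class1 A vol phi0 lambda phi).
Variables (eta : M -> R) (K : set M) (eps : R).
Hypotheses (seta : smooth_fun A eta) (cK : compact K) (etaK : forall p, ~ K p -> eta p = 0).
Hypotheses (eps0 : 0 < eps) (eta_small : forall p, eps * `|eta p| < 1).
Hypothesis eta_mean : \int[vol]_p (eta p * expR (- phi p)) = 0.

Let sphi : smooth_fun A phi.
Proof. by case: hphi => cphi _; exact: (conformal_class_smooth hphi0 cphi). Qed.

(* A smooth bounded function of [t] vanishing at [0] with derivative [eps], so
   that [1 + ramp t * eta] stays positive. *)
Let ramp (t : R) : R := eps * (t * (1 + t * t)^-1).

Let den_gt0 (t : R) : 0 < 1 + t * t.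
Proof. by rewrite ltr_pwDl// -expr2 sqr_ge0. Qed.

Let ramp_le t : `|ramp t| <= eps.
Proof.
rewrite /ramp normrM (gtr0_norm eps0); apply: ler_piMr; first exact: ltW.
rewrite normrM normfV (gtr0_norm (den_gt0 t)) (ler_pdivrMr _ _ (den_gt0 t)) mul1r.
have h1 : 0 <= (t - 1) ^+ 2 by exact: sqr_ge0.
have h2 : 0 <= (t + 1) ^+ 2 by exact: sqr_ge0.
by rewrite ler_norml; nra.
Qed.

(** Chosen so that exp (- test_curve t) is exp (- phi) times 1 + ramp t eta: the normalisation is
    then affine in [eta] and holds exactly for every [t], not only to first order. *)
Definition test_curve (t : R) (p : M) : R := phi p - ln (1 + ramp t * eta p).

Let pos t p : 0 < 1 + ramp t * eta p.
Proof.
have h : `|ramp t * eta p| < 1.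
  rewrite normrM; apply: le_lt_trans (eta_small p).
  by rewrite ler_wpM2r ?ramp_le.
by move: h; rewrite ltr_norml => /andP[h _]; lra.
Qed.

Let test_exp t p : expR (- test_curve t p) = expR (- phi p) + ramp t * (eta p * expR (- phi p)).
Proof. by rewrite /test_curve opprB expRD lnK ?posrE ?pos// ; ring. Qed.

Let test_joint (i : chart_index A) :
  smooth_on (joint_dom i) (fun q => ln (1 + ramp q.1 * eta (chart_param i q.2))).
Proof.
move=> j; have oJ := @joint_dom_open R n M A i.
apply: (Ck_on_ln oJ); first by move=> q _; exact: pos.
apply: (Ck_onD oJ (f := fun=> 1 : R) (g := fun q => ramp q.1 * eta (chart_param i q.2))).
  exact: Ck_on_cst.
apply: (Ck_onM oJ (f := fun q => ramp q.1) (g := fun q => eta (chart_param i q.2))).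
  have Cf : Ck_on j (joint_dom i) (fun q => q.1 : R) by exact: joint_fst.
  have Cd := Ck_onD oJ (Ck_on_cst j (joint_dom i) (1 : R)) (Ck_onM oJ Cf Cf).
  have CV := Ck_onV oJ (fun q _ => lt0r_neq0 (den_gt0 q.1)) Cd.
  exact: (Ck_onM oJ (Ck_on_cst j (joint_dom i) eps) (Ck_onM oJ Cf CV)).
exact: (joint_snd (seta i)).
Qed.

Lemma test_curve_C1 : C1_curve A vol phi0 lambda phi test_curve.
Proof.
have [cphi h1] := hphi; split.
- move=> i j; have oJ := @joint_dom_open R n M A i.
  exact: (Ck_onD oJ (joint_snd (sphi i) j) (Ck_onN oJ (test_joint i j))).
- by apply/funext => p; rewrite /test_curve /ramp mul0r mulr0 mul0r addr0 ln1 subr0.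
- exists K => // t p /etaK e0; by rewrite /test_curve e0 mulr0 addr0 ln1 subr0.
move=> t; split.
  have [w sw pw] := cphi; exists (fun p => w p - ln (1 + ramp t * eta p)).
    move=> i j; have oi : open (chart_img i) by exact: img_open.
    exact: (Ck_onD oi (sw i j) (Ck_onN oi (joint_slice_smooth (test_joint i) t j))).
  by apply/funext => p; rewrite /test_curve pw /= addrA.
set c := gauss_factor _ _; have iw := weight_integrable hphi0 hphi.
have ie : vol.-integrable setT (EFin \o (fun p => eta p * expR (- phi p))).
  apply: (continuous_integrable hausM hg hvol cK).
    exact: (smooth_fun_continuous (smooth_funM seta (weight_smooth hphi0 hphi))).
  by move=> p /etaK ->; rewrite mul0r.
transitivity (\int[vol]_p (c * expR (- phi p) + c * ramp t * (eta p * expR (- phi p)))).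
  by apply: eq_Rintegral => p _; rewrite test_exp; ring.
rewrite RintegralD//; [|exact: (integrableZl measurableT c iw)|exact: (integrableZl measurableT (c * ramp t) ie)].
by rewrite [X in _ + X]RintegralZl// eta_mean mulr0 addr0.
Qed.

Lemma test_curve_velocity p : 'D_1 (fun t => test_curve t p) 0 = - (eps * eta p).
Proof.
have dr : is_derive (0 : R) 1 ramp eps.
  have dV : derivable (fun t : R => (1 + t * t)^-1) (0 : R) 1.
    have C : Ck_on 1 [set: R] (fun t : R => (1 + t * t)^-1).
      have Cid : Ck_on 1 [set: R] (id : R -> R) by apply: Ck_on_linear => // x; exact: cvg_id.
      apply: Ck_onV; [exact: openT|by move=> t _; rewrite lt0r_neq0|].
      exact: (Ck_onD openT (Ck_on_cst 1 [set: R] (1 : R)) (Ck_onM openT Cid Cid)).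
    by have [_ /(_ 1) [d _]] := C; exact: d.
  have h := is_deriveM (is_derive_id (0 : R) (1 : R)) (derivableP dV).
  have h' := is_deriveZ eps h.
  apply: is_derive_eq h' _.
  by rewrite /= mulr0 addr0 invr1 scale1r scale0r add0r [LHS]mulr1.
have r0 : ramp 0 = 0 by rewrite /ramp mul0r mulr0.
have d1 : is_derive (0 : R) 1 (fun t => 1 + ramp t * eta p) (eps * eta p).
  have h := is_deriveD (is_derive_cst (1 : R) (0 : R) (1 : R))
    (is_deriveM dr (is_derive_cst (eta p) (0 : R) (1 : R))).
  apply: is_derive_eq h _.
  by rewrite scaler0 !add0r /GRing.scale /= mulrC.
have l0 : 0 < 1 + ramp 0 * eta p by exact: pos.
have dl := is_derive_comp1 (f := fun t => 1 + ramp t * eta p) (is_derive1_ln l0) d1.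
have h := is_deriveB (is_derive_cst (phi p) (0 : R) (1 : R)) dl.
rewrite [LHS](@derive_val _ _ _ _ _ _ _ h).
by rewrite r0 mul0r addr0 invr1 mul1r sub0r.
Qed.

End TestCurve.

Theorem theorem1p15 (R : realType) (n : nat) (M : ptopologicalType)
    (hausM : hausdorff_space M) (scM : @second_countable M)
    (A : atlas R n M)
    (g : components A) (hg : riemannian g)
    (vol : {measure set (borel M) -> \bar R}) (hvol : riemannian_volume g vol)
    (phi0 : M -> R) (hphi0 : smooth_fun A phi0)
    (lambda : R) (hlambda : lambda != 0)
    (amb : (M -> R) -> wfamily A)
    (hamb : forall phi, conformal_class A phi0 phi ->
       normal_ambient g lambda phi (amb phi))
    (k : nat) (hk : (1 <= k)%N)
    (phi : M -> R) (hphi : conformal_class1 A vol phi0 lambda phi)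
    (hW : vol.-integrable setT
       (fun p => (W_integrand g lambda amb k phi p)%:E)) :
  critical_point vol phi0 g lambda amb k phi <->
  exists a : R, forall p : M,
    v_coef g lambda phi (amb phi) k p
    - lambda * v_coef g lambda phi (amb phi) k.-1 p = a.
Proof.
pose c : R := gauss_factor n (1 / (2 * lambda)); pose kappa := (1 / (2 * lambda)) ^+ k * c.
have c0 : c != 0 by exact: (factor_neq0 hphi).
have kappa0 : kappa != 0.
  by rewrite mulf_neq0// expf_neq0// div1r invr_neq0// mulf_neq0.
pose w p := expR (- phi p); have w0 p : 0 < w p by exact: expR_gt0.
have sw : smooth_fun A w by exact: (weight_smooth hphi0 hphi).
pose G := gradient g lambda amb k phi.
have sG : smooth_fun A G by exact: (gradient_smooth hg hphi0 hamb k hphi).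
split=> [[_ crit]|[a ha]]; last first.
  split=> // Phi hPhi; apply: is_derive_eq (W_derivative hausM hg hvol hphi0 hamb hk hphi hW hPhi) _.
  have := velocity_mean0 hausM hg hvol hphi0 hphi hPhi.
  set om := fun p => 'D_1 (fun t => Phi t p) 0 => om0.
  have cc : class_curve (A := A) phi0 Phi by case: hPhi => s _ _ h; split=> // t; case: (h t).
  have som : smooth_fun A om by exact: (curve_velocity_smooth cc).
  have [_ P0 [K cK off] _] := hPhi.
  have iom : vol.-integrable setT (EFin \o (fun p => om p * w p)).
    apply: (continuous_integrable hausM hg hvol cK).
      exact: (smooth_fun_continuous (smooth_funM som sw)).
    move=> p nK; rewrite (_ : om p = 0) ?mul0r//.
    transitivity ('D_1 (cst (phi p) : R -> R) 0); last exact: derive_cst.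
    by congr (derive _ (0 : R) (1 : R)); apply/funext => t; exact: off.
  have -> : \int[vol]_p (om p * G p * w p) = \int[vol]_p (a * (om p * w p)).
    by apply: eq_Rintegral => p _; rewrite /G /gradient ha; ring.
  by rewrite RintegralZl// om0 mulr0 mulr0 oppr0.
(* Two values of the gradient would give a curve along which the functional has a nonzero
   derivative. Their midpoint [m] separates two bumps, with the gradient below [m] on the support of
   the first and above it on that of the second. *)
have nc : ~ exists p q, G p < G q.
  move=> [p [q pq]]; pose m := (G p + G q) / 2.
  have pm : G p < m by rewrite ltr_pdivlMr//; lra.
  have mq : m < G q by rewrite ltr_pdivrMr//; lra.
  have cG : continuous G by exact: (smooth_fun_continuous sG).
  have oU : open [set x | G x < m].
    by apply: (@open_comp _ _ G [set y | y < m]); [move=> x _; exact: cG|exact: open_lt].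
  have oV : open [set x | m < G x].
    by apply: (@open_comp _ _ G [set y | m < y]); [move=> x _; exact: cG|exact: open_gt].
  have [b1 [K1 [N1 [s1 b01 [cK1 K1U] bK1 [_ Np bN1]]]]] := bump_function hausM (chart_atP A p) oU pm.
  have [b2 [K2 [N2 [s2 b02 [cK2 K2V] bK2 [_ Nq bN2]]]]] := bump_function hausM (chart_atP A q) oV mq.
  have integ (b f : M -> R) (K : set M) : compact K -> smooth_fun A b -> smooth_fun A f ->
      (forall x, ~ K x -> b x = 0) -> vol.-integrable setT (EFin \o (fun x => b x * f x)).
    move=> cK sb sf b0; apply: (continuous_integrable hausM hg hvol cK).
      exact: (smooth_fun_continuous (smooth_funM sb sf)).
    by move=> x /b0 ->; rewrite mul0r.
  have posit (b f : M -> R) (K : set M) x : compact K -> smooth_fun A b -> smooth_fun A f ->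
      (forall x, ~ K x -> b x = 0) -> (forall x, 0 <= b x * f x) -> 0 < b x * f x ->
      0 < \int[vol]_x (b x * f x).
    move=> cK sb sf b0; apply: (Rintegral_gt0 hausM hg hvol (p := x) cK).
      exact: (smooth_fun_continuous (smooth_funM sb sf)).
    by move=> y /b0 ->; rewrite mul0r.
  pose d1 x := (m - G x) * w x; pose d2 x := (G x - m) * w x.
  have sd1 : smooth_fun A d1.
    apply: smooth_funM => //; apply: smooth_funD; first exact: smooth_fun_cst.
    exact: smooth_funN.
  have sd2 : smooth_fun A d2.
    apply: smooth_funM => //; apply: smooth_funD => //.
    exact: (@smooth_fun_cst _ _ _ A (- m)).
  have b1p : b1 p = 1 by exact: bN1.
  have b2q : b2 q = 1 by exact: bN2.
  pose c1 := \int[vol]_x (b1 x * w x); pose c2 := \int[vol]_x (b2 x * w x).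
  pose I1 := \int[vol]_x (b1 x * d1 x); pose I2 := \int[vol]_x (b2 x * d2 x).
  have c1p : 0 < c1.
    apply: (posit b1 w K1 p) => //; last by rewrite b1p mul1r.
    by move=> x; rewrite mulr_ge0 ?(ltW (w0 x))//; have /andP[] := b01 x.
  have c2p : 0 < c2.
    apply: (posit b2 w K2 q) => //; last by rewrite b2q mul1r.
    by move=> x; rewrite mulr_ge0 ?(ltW (w0 x))//; have /andP[] := b02 x.
  have I1p : 0 < I1.
    apply: (posit b1 d1 K1 p) => //; last by rewrite b1p mul1r mulr_gt0// subr_gt0.
    move=> x; have [K1x|/bK1 ->] := pselect (K1 x); last by rewrite mul0r.
    have /andP[b0 _] := b01 x; rewrite mulr_ge0// mulr_ge0 ?(ltW (w0 x))//.
    by rewrite subr_ge0 ltW//; have [] := K1U x K1x.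
  have I2p : 0 < I2.
    apply: (posit b2 d2 K2 q) => //; last by rewrite b2q mul1r mulr_gt0// subr_gt0.
    move=> x; have [K2x|/bK2 ->] := pselect (K2 x); last by rewrite mul0r.
    have /andP[b0 _] := b02 x; rewrite mulr_ge0// mulr_ge0 ?(ltW (w0 x))//.
    by rewrite subr_ge0 ltW//; have [] := K2V x K2x.
  (* The coefficients make the weighted mean of [eta] vanish. Since both bumps lie between 0 and 1,
     |eta| <= c1 + c2, which accounts for [eps]. *)
  pose eta x := c2 * b1 x - c1 * b2 x; pose K := K1 `|` K2; pose eps := (1 + c1 + c2)^-1.
  have cK : compact K by exact: compactU.
  have eta0 x : ~ K x -> eta x = 0.
    by move=> nK; rewrite /eta bK1 ?bK2 ?mulr0 ?subr0// => h; apply: nK; [right|left].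
  have seta : smooth_fun A eta.
    apply: smooth_funD; first by apply: smooth_funM => //; exact: smooth_fun_cst.
    by apply: smooth_funN; apply: smooth_funM => //; exact: smooth_fun_cst.
  have eps0 : 0 < eps by rewrite invr_gt0; lra.
  have small x : eps * `|eta x| < 1.
    have hb : `|eta x| <= c1 + c2.
      have /andP[x1 x2] := b01 x; have /andP[y1 y2] := b02 x.
      by rewrite ler_norml /eta; nra.
    by rewrite /eps mulrC ltr_pdivrMr ?mul1r; lra.
  have comb (f : M -> R) : smooth_fun A f ->
      \int[vol]_x (eta x * f x) = c2 * \int[vol]_x (b1 x * f x) - c1 * \int[vol]_x (b2 x * f x).
    move=> sf; have i1 := integ b1 f K1 cK1 s1 sf bK1; have i2 := integ b2 f K2 cK2 s2 sf bK2.
    transitivity (\int[vol]_x (c2 * (b1 x * f x) - c1 * (b2 x * f x))).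
      by apply: eq_Rintegral => x _; rewrite /eta; ring.
    rewrite RintegralB//; last 2 first.
    - exact: (integrableZl measurableT c2 i1).
    - exact: (integrableZl measurableT c1 i2).
    by rewrite [X in X - _]RintegralZl// [X in _ - X]RintegralZl.
  have mean : \int[vol]_x (eta x * expR (- phi x)) = 0 by rewrite comb// -/c1 -/c2; ring.
  have C1 := test_curve_C1 hausM hg hvol hphi0 hphi seta cK eta0 eps0 small mean.
  have h1 := W_derivative hausM hg hvol hphi0 hamb hk hphi hW C1.
  have := @derive_val _ _ _ _ _ _ _ h1; rewrite (@derive_val _ _ _ _ _ _ _ (crit _ C1)).
  move/eqP; rewrite eq_sym oppr_eq0 mulf_eq0 (negbTE kappa0) /= => /eqP.
  have sGw : smooth_fun A (fun x => G x * w x) by exact: smooth_funM.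
  have ieta : vol.-integrable setT (EFin \o (fun x => eta x * (G x * w x))).
    exact: (integ eta _ K).
  have -> : \int[vol]_x ('D_1 (fun t => test_curve phi eta eps t x) 0 * G x * expR (- phi x)) =
      \int[vol]_x (- eps * (eta x * (G x * w x))).
    apply: eq_Rintegral => x _; rewrite (test_curve_velocity phi eps0 small x) /w; ring.
  rewrite RintegralZl// => /eqP; rewrite mulf_eq0 oppr_eq0 (gt_eqF eps0) /= => /eqP.
  have E1 : \int[vol]_x (b1 x * (G x * w x)) = m * c1 - I1.
    transitivity (\int[vol]_x (m * (b1 x * w x) - b1 x * d1 x)).
      by apply: eq_Rintegral => x _; rewrite /d1; ring.
    have i1 := integ b1 w K1 cK1 s1 sw bK1.
    rewrite RintegralB//; [|exact: (integrableZl measurableT m i1)|exact: (integ b1 d1 K1)].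
    by rewrite [X in X - _]RintegralZl.
  have E2 : \int[vol]_x (b2 x * (G x * w x)) = m * c2 + I2.
    transitivity (\int[vol]_x (m * (b2 x * w x) + b2 x * d2 x)).
      by apply: eq_Rintegral => x _; rewrite /d2; ring.
    have i2 := integ b2 w K2 cK2 s2 sw bK2.
    rewrite RintegralD//; [|exact: (integrableZl measurableT m i2)|exact: (integ b2 d2 K2)].
    by rewrite [X in X + _]RintegralZl.
  (* The multiples of [m] cancel, leaving - (c2 I1 + c1 I2), which is negative, although criticality
     makes it zero. *)
  rewrite (comb _ sGw) E1 E2.
  have q1 : 0 < c2 * I1 by exact: mulr_gt0.
  have q2 : 0 < c1 * I2 by exact: mulr_gt0.
  move=> e; suff : 0 < 0 :> R by rewrite ltxx.
  by rewrite -{2}e; nra.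
exists (G point) => p; rewrite -[LHS]/(G p).
have [lt|gt|//] := ltgtP (G p) (G point).
  by exfalso; apply: nc; exists p, point.
by exfalso; apply: nc; exists point, p.
Qed.
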